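(* Let $(H,d_H)$ and $(G,d_G)$ be stratified groups with homogeneous distances such that $G$ has step 2 and the projection norm of $d_G$ is strictly convex. Then every isometric embedding $(H,d_H)\hookrightarrow(G,d_G)$ is affine.
   Context: A stratified group is a connected, simply connected Lie group $G$ whose (finite-dimensional real) Lie algebra has a decomposition $\mathfrak{g}=V_1\oplus V_2\oplus\dots\oplus V_s$ with $V_s\neq\{0\}$ and $[V_1,V_k]=V_{k+1}$ for all $k=1,\dots,s$, where $V_{s+1}=\{0\}$; $s$ is its step. The dilation by $\lambda\in\mathbb{R}$ is $\delta_\lambda\colon G\to G$, $\delta_\lambda\exp(X_1+X_2+\dots+X_s)=\exp(\lambda X_1+\lambda^2X_2+\dots+\lambda^sX_s)$ for $X_k\in V_k$. A homogeneous distance on $G$ is a left-invariant distance $d$ (a metric) with $d(\delta_\lambda(g),\delta_\lambda(h))=\lambda d(g,h)$ for all $\lambda>0$ and $g,h\in G$. The projection norm of $d$ is $\|\cdot\|_d\colon V_1\to\mathbb{R}$, $\|X\|_d=d(e,\exp(X))$, where $e$ is the identity element (it is a norm). An isometric embedding is a distance-preserving map (not necessarily surjective). A map $H\to G$ is affine if it is a composition of left translations and group homomorphisms, i.e. of the form $h\mapsto g\,\phi(h)$ with $g\in G$ and $\phi\colon H\to G$ a group homomorphism. A norm is strictly convex if its unit sphere contains no non-degenerate line segment. *)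

(* Defs.v *)
From HB Require Import structures.
From mathcomp Require Import all_boot all_order all_algebra.
From mathcomp Require Import all_classical all_reals.
From mathcomp Require Import topology normedtype derive.

Set Implicit Arguments.
Unset Strict Implicit.
Unset Printing Implicit Defensive.

Import Order.TTheory GRing.Theory Num.Theory.
Import numFieldNormedType.Exports.

Local Open Scope ring_scope.

(* [smooth] is C^oo: all iterated directional derivatives exist everywhere
   and are continuous. *)
Fixpoint Ck (R : realType) (V W : normedModType R) (k : nat) (f : V -> W)
    : Prop :=
  continuous f /\
  if k is k'.+1 then
    forall v, (forall x, derivable f x v) /\ Ck k' (fun x => 'D_v f x)
  else True.

Definition smooth (R : realType) (V W : normedModType R) (f : V -> W) : Prop :=
  forall k, Ck k f.

(* A real Lie group whose exponential map is a global diffeomorphism.  The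
   tangent space at the identity is identified with R^n by a choice of basis,
   and the smooth structure is the one for which [lie_log] is a global chart.
   Such a group is connected and simply connected (it is diffeomorphic to R^n);
   conversely every connected, simply connected Lie group with nilpotent Lie
   algebra, in particular every stratified group, is of this form.
   In the chart [lie_log] inversion is X |-> - X, so its smoothness does not
   have to be required.  The curves t |-> exp (t X) are the smooth
   one-parameter subgroups, so [lie_exp] is the exponential map of the group. *)
Record lieGroup (R : realType) := LieGroup {
  lie_dim : nat;
  lie_sort :> groupType;
  lie_exp : 'rV[R]_lie_dim -> lie_sort;
  lie_log : lie_sort -> 'rV[R]_lie_dim;
  lie_expK : cancel lie_exp lie_log;
  lie_logK : cancel lie_log lie_exp;
  lie_mul_smooth :
    smooth (fun p : 'rV[R]_lie_dim * 'rV[R]_lie_dim =>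
              lie_log (lie_exp p.1 * lie_exp p.2)%g);
  lie_expD : forall (a b : R) (X : 'rV[R]_lie_dim),
    lie_exp ((a + b) *: X) = (lie_exp (a *: X) * lie_exp (b *: X))%g
}.

Arguments lie_dim {R}.
Arguments lie_exp {R} _ _.
Arguments lie_log {R} _ _.

Notation "''g' [ G ]" := 'rV_(lie_dim G)
  (at level 8, G at level 99, format "''g' [ G ]") : type_scope.

Section LieAlgebra.
Context {R : realType} (G : lieGroup R).

(* Ad g is the differential at the identity of h |-> g h g^-1. *)
Definition lie_Ad (g : G) (Y : 'g[G]) : 'g[G] :=
  derive1 (fun t : R => lie_log G (g * lie_exp G (t *: Y) * g^-1)%g) 0.

(* [X, Y] = ad X Y, where ad is the differential of Ad at the identity; this
   is the bracket of the left-invariant vector fields extending X and Y. *)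
Definition lie_bracket (X Y : 'g[G]) : 'g[G] :=
  derive1 (fun t : R => lie_Ad (lie_exp G (t *: X)) Y) 0.

(* W = [U, V], the linear span of the brackets [X, Y], X in U, Y in V. *)
Definition is_bracket_space (U V W : {vspace 'g[G]}) : Prop :=
  (forall X Y, X \in U -> Y \in V -> lie_bracket X Y \in W) /\
  (forall W' : {vspace 'g[G]},
     (forall X Y, X \in U -> Y \in V -> lie_bracket X Y \in W') ->
     (W <= W')%VS).

End LieAlgebra.

(* [layer k] is V_k for 1 <= k <= step + 1; its other values are irrelevant. *)
Record stratifiedGroup (R : realType) := StratifiedGroup {
  strat_lie :> lieGroup R;
  step : nat;
  layer : nat -> {vspace 'g[strat_lie]};
  step_gt0 : (0 < step)%N;
  layer_sum : (\sum_(k < step) layer k.+1)%VS = fullv;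
  layer_direct : directv (\sum_(k < step) layer k.+1);
  layer_step : layer step != 0%VS;
  layer_stepS : layer step.+1 = 0%VS;
  layer_bracket : forall k : nat, (1 <= k <= step)%N ->
    is_bracket_space (layer 1) (layer k) (layer k.+1)
}.

Arguments step {R}.
Arguments layer {R}.

Section Stratified.
Context {R : realType} (G : stratifiedGroup R).

(* The component of X in V_{k+1}. *)
Definition layer_proj (k : 'I_(step G)) (X : 'g[G]) : 'g[G] :=
  sumv_pi (\sum_(i < step G) layer G i.+1)%VS k X.

Definition dilation (lambda : R) (g : G) : G :=
  lie_exp G (\sum_(k < step G)
               lambda ^+ k.+1 *: layer_proj k (lie_log G g)).

Lemma dilation_exp (lambda : R) (X : 'I_(step G) -> 'g[G]) :
  (forall k, X k \in layer G k.+1) ->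
  dilation lambda (lie_exp G (\sum_(k < step G) X k)) =
  lie_exp G (\sum_(k < step G) lambda ^+ k.+1 *: X k).
Proof.
move=> XV; rewrite /dilation lie_expK; congr lie_exp.
set Y := \sum_(k < _) X k.
have Yin : Y \in (\sum_(i < step G) layer G i.+1)%VS by rewrite layer_sum memvf.
have /eqP : Y = \sum_(k < step G) layer_proj k Y.
  by rewrite (sumv_pi_sum (erefl _)).
rewrite (directv_sum_unique (layer_direct G)) //; last first.
  by move=> k _; apply: memv_sum_pi.
by move=> /forall_inP XY; apply: eq_bigr => k _; rewrite -(eqP (XY k _)).
Qed.

Record homogeneous_distance (d : G -> G -> R) : Prop := HomogeneousDistance {
  hdist_ge0 : forall g h, 0 <= d g h;
  hdist_eq0 : forall g h, d g h = 0 <-> g = h;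
  hdist_sym : forall g h, d g h = d h g;
  hdist_triangle : forall g h k, d g k <= d g h + d h k;
  hdist_left_inv : forall a g h, d (a * g)%g (a * h)%g = d g h;
  hdist_dilation : forall (lambda : R) g h, 0 < lambda ->
    d (dilation lambda g) (dilation lambda h) = lambda * d g h
}.

(* Meaningful on V_1 only. *)
Definition projection_norm (d : G -> G -> R) (X : 'g[G]) : R :=
  d 1%g (lie_exp G X).

Definition strictly_convex_projection_norm (d : G -> G -> R) : Prop :=
  forall X Y : 'g[G], X \in layer G 1 -> Y \in layer G 1 ->
    (forall t : R, 0 <= t <= 1 ->
       projection_norm d ((1 - t) *: X + t *: Y) = 1) ->
    X = Y.

End Stratified.

Definition isometric_embedding (R : realType) (A B : Type)
    (dA : A -> A -> R) (dB : B -> B -> R) (f : A -> B) : Prop :=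
  forall x y, dB (f x) (f y) = dA x y.

Definition affine_map (H G : groupType) (f : H -> G) : Prop :=
  exists (g : G) (phi : {multiplicative H -> G}),
    forall h, f h = (g * phi h)%g.

(* Main.v *)
From HB Require Import structures.
Require Import Defs.
From mathcomp Require Import all_boot all_order all_algebra.
From mathcomp Require Import all_classical all_reals.
From mathcomp Require Import interval_inference topology normedtype landau derive realfun sequences exp.
From mathcomp Require Import ring lra.

(** An isometric embedding [f : H -> G] sends horizontal lines to horizontal
    lines; the rest is group theory.

    Rays. A horizontal half-line of unit speed in [H] is a geodesic ray for the
    homogeneous distance, so its image in [G] is a curve [gamma] with
    [d (gamma s) (gamma t) = `|t - s|] for all [s, t >= 0]. Such a curve is a
    half-line of the first layer ([ray_is_line]). In exponential coordinates the
    product of [G] is [x + y + om x y], where [om] is bilinear, depends only on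
    first layer components and takes values in the second layer
    ([chart_mul_step2]); horizontal errors of size [tau] cost [tau], vertical ones
    [sqrt tau]. One argues in three steps.

    First, a vertical error can be repaired at an arbitrarily small cost when its
    direction is a limit of vectors [om b (gamma t)] with [b] tending to 0 and [t]
    to infinity: it is enough to conjugate a long piece of the ray by a small
    multiple of [b] ([unshortenable_extend]). Hence the ray stays a ray in the
    quotient by a maximal unshortenable subspace [U] of the second layer, and
    there [om x (gamma t)] is bounded in [t] ([ray_reduction]). In the formal text
    the quotient map is a linear map [q] with kernel [U].

    Secondly, in the quotient the vertical displacement up to time [t] is at most
    linear in [t], so the horizontal displacement is at least [t - C sqrt t]. A
    limit [Y] of its mean is therefore a unit vector, it is central in the
    quotient ([asymptotic_direction]), and by uniform convexity the ray contains,
    arbitrarily far away, pieces of unit length as close as desired to a segment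
    of direction [Y] ([straight_block]). Replace such a piece by lengthening a
    given unit piece of the ray by [Y], spread uniformly: since [Y] is central,
    the end point hardly changes. As the ray is a geodesic, the lengthened piece
    still has length at least 2, up to [C / sqrt M], when its horizontal steps
    over a subdivision into [M] intervals are considered ([tilted_length]).

    Thirdly, uniform convexity of the norm then forces these horizontal steps to
    be multiples of [Y] on average, whence the horizontal displacement over every
    unit interval is exactly [Y] ([unit_step]). Rescaling gives the same for every
    length of time, so the horizontal component is linear in [t]; then the
    vertical component is additive and quadratically small, that is, zero.

    From rays to homomorphisms. The direction of the image of the half-line
    [t |-> h * exp (t X)] does not depend on [h]: half-lines of direction [X] from
    [h] and [h * exp K] diverge sublinearly in [H] ([parallel_lines_sublinear]),
    whereas half-lines with different directions diverge linearly in [G]. Hence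
    [f (h * exp X) = f h * exp (phi X)] for [X] in the first layer, and
    [(f 1)^-1 * f] is multiplicative because a closed subgroup that contains the
    exponential of the first layer is the whole group ([closed_subgroup_full]).

    Lie theory. The last fact rests on the Trotter formula [trotter], which also
    yields the product of a step two group, and on the continuity of homogeneous
    distances in the exponential chart ([hnorm_small]): small elements are
    products of small elements of the curves [t |-> exp (t v)], [v] in a layer,
    by local surjectivity of a map tangent to the identity. *)

Set Implicit Arguments.
Unset Strict Implicit.
Unset Printing Implicit Defensive.

Import Order.TTheory GRing.Theory Num.Theory.
Import numFieldNormedType.Exports.

Local Open Scope classical_set_scope.
Local Open Scope ring_scope.

(** * Differential calculus in coordinates *)

(** Row vectors form a complete normed module, so that the contraction principle
    applies to them. *)
HB.instance Definition _ (R : realType) n :=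
  Uniform_isComplete.Build 'rV[R]_n cauchy_cvg.

Section Coordinates.
Context {R : realType}.

Lemma row_norm_le n (v : 'rV[R]_n) (M : R) :
  0 <= M -> (forall i, `|v 0 i| <= M) -> `|v| <= M.
Proof.
move=> M0 vM; rewrite [`|v|]/Num.Def.normr /= mx_normrE; apply: bigmax_le => // -[i j] _.
by rewrite (ord1 i) /=; exact: vM.
Qed.

Lemma row_norm_ge n (v : 'rV[R]_n) i : `|v 0 i| <= `|v|.
Proof.
rewrite [leRHS]/Num.Def.normr /= mx_normrE.
exact: (le_bigmax _ (fun ij : 'I_1 * 'I_n => `|v ij.1 ij.2|) (0, i)).
Qed.

Lemma row_sum_bound n (W : normedModType R) (F : 'I_n -> W) (v : 'rV[R]_n) :
  `|\sum_i v 0 i *: F i| <= (\sum_i `|F i|) * `|v|.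
Proof.
rewrite mulr_suml; apply: le_trans (ler_norm_sum _ _ _) _.
apply: ler_sum => i _; rewrite normrZ mulrC ler_wpM2l //; exact: row_norm_ge.
Qed.

Lemma linear_bound n (W : normedModType R) (f : {linear 'rV[R]_n -> W}) :
  exists2 C : R, 0 <= C & forall v, `|f v| <= C * `|v|.
Proof.
exists (\sum_i `|f (delta_mx 0 i)|); first by apply: sumr_ge0.
move=> v; rewrite {1}(row_sum_delta v) linear_sum.
rewrite (eq_bigr (fun i => v 0 i *: f (delta_mx 0 i))); first exact: row_sum_bound.
by move=> i _; rewrite linearZ.
Qed.

(** Every compactness argument below takes the form of a cluster point of a
    sequence, so that no subsequence has to be extracted. *)
Lemma bounded_seq_cluster n (u : nat -> 'rV[R]_n) (M : R) :
  (forall k, `|u k| <= M) ->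
  exists l, forall e : R, 0 < e -> forall k0 : nat, exists2 k, (k0 <= k)%N & `|u k - l| < e.
Proof.
move=> uM; pose A := [set v : 'rV[R]_n | `|v| <= M].
have cA : compact A.
  apply: bounded_closed_compact.
    exists M; split; first exact: num_real.
    by move=> x Mx v /= vM; apply: le_trans vM (ltW Mx).
  have -> : A = Num.norm @^-1` [set x | x <= M] by [].
  apply: closed_comp; last exact: closed_le.
  by move=> x _; exact: norm_continuous.
have [l [_ lc]] : A `&` cluster (u @ \oo) !=set0.
  by apply: cA; exists 0%N => // k _; exact: uM.
exists l => e e0 k0.
have [] := lc [set u k | k in [set k | (k0 <= k)%N]] (ball l e).
- exists k0 => // k /= k0k; by exists k.
- exact: nbhsx_ballx.
move=> v [] /= [k k0k <-]; rewrite -ball_normE /= distrC => H.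
by exists k.
Qed.

End Coordinates.

Section StrictDifferential.
Context {R : realType}.

(** Strict differentiability, rather than differentiability, is what makes the
    contraction argument for local surjectivity work, and it is stable under
    composition at a single point. *)
Definition strict_diff (V W : normedModType R) (f L : V -> W) (p : V) : Prop :=
  forall e : R, 0 < e -> exists2 d : R, 0 < d &
    forall x y, `|x - p| < d -> `|y - p| < d ->
      `|f x - f y - L (x - y)| <= e * `|x - y|.

Lemma derive_row_coord (V : normedModType R) m (f : V -> 'rV[R]_m) (y e : V) (i : 'I_m) :
  (forall x, derivable f x e) -> forall s : R,
  is_derive s (1 : R) (fun s : R => f (y + s *: e) 0 i) ('D_e f (y + s *: e) 0 i).
Proof.
move=> df s.
have H : (fun h : R => h^-1 *: (((fun s : R => f (y + s *: e) 0 i) \o shift s) (h *: 1)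
     - f (y + s *: e) 0 i)) @ 0^' --> 'D_e f (y + s *: e) 0 i.
  have dfs := df (y + s *: e).
  have c : (fun h : R => h^-1 *: ((f \o shift (y + s *: e)) (h *: e) - f (y + s *: e)))
    @ 0^' --> 'D_e f (y + s *: e) by [].
  have := cvg_comp _ _ c (@coord_continuous R _ _ 0 i ('D_e f (y + s *: e))).
  apply: cvg_trans; apply: near_eq_cvg; apply: nearW => h /=.
  rewrite !mxE; congr (_ * (_ - _)); congr (f _ _ _).
  by rewrite [h%:A]mulr1 scalerDl addrCA.
by apply: DeriveDef; [apply/cvg_ex; eexists; exact: H | apply: cvg_lim].
Qed.

(** Mean value theorem, coordinate by coordinate, along a segment of direction
    [e]. *)
Lemma C1_step (V : normedModType R) m (f : V -> 'rV[R]_m) (e p : V) :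
  (forall x, derivable f x e) -> continuous (fun x => 'D_e f x) ->
  forall eps : R, 0 < eps -> exists2 d : R, 0 < d &
    forall y (c : R), `|y - p| < d -> `|y + c *: e - p| < d ->
      `|f (y + c *: e) - f y - c *: 'D_e f p| <= eps * `|c|.
Proof.
move=> df cf eps eps0.
have /cvgrPdist_lt/(_ eps eps0)/nbhs_ballP[d /= d0 dH] := cf p.
exists d => // y c yd ycd.
apply: row_norm_le => [|i]; first by rewrite mulr_ge0 // ltW.
pose g s := f (y + s *: e) 0 i.
have key (a b : R) : a <= b -> (forall s, a <= s <= b -> `|y + s *: e - p| < d) ->
    `|g b - g a - (b - a) * 'D_e f p 0 i| <= eps * (b - a).
  move=> ab H; have [||s sab ->] := @MVT_segment R g (fun s => 'D_e f (y + s *: e) 0 i) a b ab.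
  - by move=> s _; exact: derive_row_coord.
  - apply: continuous_subspaceT => s; apply/differentiable_continuous/derivable1_diffP.
    exact: (@ex_derive _ _ _ _ _ _ _ (derive_row_coord y i df s)).
  rewrite -[_ - _ * _ in leLHS]/(_) mulrC -mulrBr normrM mulrC [`|b - a|]ger0_norm ?subr_ge0 //.
  rewrite ler_wpM2r ?subr_ge0 //.
  have := dH (y + s *: e); rewrite -ball_normE /= distrC => /(_ _)/ltW dd.
  have : `|'D_e f p - 'D_e f (y + s *: e)| <= eps.
    by apply: dd; apply: H; move: sab; rewrite in_itv.
  rewrite distrC; apply: le_trans.
  by apply: le_trans (row_norm_ge _ i); rewrite !mxE.
have seg (t : R) : 0 <= t <= 1 -> `|y + (t * c) *: e - p| < d.
  move=> /andP[t0 t1].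
  have -> : y + (t * c) *: e - p = (1 - t) *: (y - p) + t *: (y + c *: e - p).
    by rewrite addrAC [in RHS](addrAC y) [t *: (_ + _)]scalerDr addrA -scalerDl subrK scale1r scalerA.
  apply: le_lt_trans (ler_normD _ _) _; rewrite !normrZ !ger0_norm ?subr_ge0 //.
  have [->|tn0] := eqVneq t 0; first by rewrite subr0 mul1r mul0r addr0.
  have tp : 0 < t by rewrite lt_def tn0.
  have -> : d = (1 - t) * d + t * d by ring.
  by rewrite ler_ltD // ?ler_wpM2l ?subr_ge0 // ?ltr_pM2l // ltW.
rewrite [X in `|X|](_ : _ = g c - g 0 - (c - 0) * 'D_e f p 0 i); last first.
  by rewrite /g scale0r addr0 subr0 !mxE.
have [c0|/ltW c0] := leP 0 c.
  rewrite (ger0_norm c0) -[X in eps * X]subr0; apply: key => // s /andP[s0 sc].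
  have [cz|cn] := eqVneq c 0.
    by have := seg 0; rewrite mul0r lexx ler01 (_ : s = 0) //; [apply|lra].
  have cp : 0 < c by rewrite lt_def cn.
  by rewrite -[s](divfK cn); apply: seg; rewrite divr_ge0 // ler_pdivrMr // mul1r.
rewrite (ler0_norm c0) -[- c]sub0r -normrN [X in `|X|](_ : _ = g 0 - g c - (0 - c) * 'D_e f p 0 i).
  apply: key => // s /andP[cs s0].
  have [cz|cn] := eqVneq c 0.
    by have := seg 0; rewrite mul0r lexx ler01 (_ : s = 0) //; [apply|lra].
  have cp : c < 0 by rewrite lt_def eq_sym cn.
  rewrite -[s](divfK cn); apply: seg.
  by rewrite -[s / c]mulrNN -invrN divr_ge0 ?ler_pdivrMr ?oppr_ge0 ?oppr_gt0 // mul1r lerN2.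
by ring.
Qed.

(** The increment is split into one step along each direction of the list [s];
    the coordinate functions are bounded by the norm so that the intermediate
    points stay close to [p]. *)
Lemma C1_telescope (V : normedModType R) m (f : V -> 'rV[R]_m) (s : seq (V * (V -> R))) (p : V) :
  (forall b, b \in s -> forall x, `|b.2 x| <= `|x|) ->
  (forall e x, derivable f x e) -> (forall e, continuous (fun x => 'D_e f x)) ->
  forall e : R, 0 < e -> exists2 d : R, 0 < d & forall y v, `|y - p| < d -> `|v| < d ->
    `|f (y + \sum_(b <- s) b.2 v *: b.1) - f y - \sum_(b <- s) b.2 v *: 'D_(b.1) f p|
      <= e * `|v|.
Proof.
move=> + df cf; elim: s => [|b s IH] sb e e0.
  exists 1 => // y v _ _; rewrite !big_nil addr0 subrr subr0 normr0.
  by rewrite mulr_ge0 // ltW.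
have e20 : 0 < e / 2 by lra.
have [d1 d10 H1] := IH (fun c cs => sb c (mem_behead (s := b :: s) cs)) _ e20.
have [d2 d20 H2] := C1_step p (df b.1) (cf b.1) e20.
pose K := 1 + `|b.1|.
have K0 : 0 < K by rewrite ltr_wpDr.
pose d := Num.min d1 d2 / (2 * K).
have md : 0 < Num.min d1 d2 by rewrite lt_min d10 d20.
have d0 : 0 < d by rewrite divr_gt0 // mulr_gt0.
have dd : d * (2 * K) = Num.min d1 d2 by rewrite divfK // gt_eqF // mulr_gt0.
have dK : d * 2 <= Num.min d1 d2.
  by rewrite -dd ler_pM2l // /K; have := normr_ge0 b.1; lra.
have /andP[dd1 dd2] : (d * 2 <= d1) && (d * 2 <= d2) by rewrite -le_min.
exists d => // y v yd vd; rewrite !big_cons addrA.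
have bv : `|b.2 v| <= `|v| by apply: sb; rewrite inE eqxx.
have yb : `|y + b.2 v *: b.1 - p| < Num.min d1 d2.
  rewrite addrAC; apply: le_lt_trans (ler_normD _ _) _; rewrite normrZ.
  have : `|b.2 v| * `|b.1| <= d * `|b.1|.
    by rewrite ler_wpM2r //; apply: le_trans bv (ltW vd).
  rewrite -dd /K; have := normr_ge0 b.1; move: yd; nra.
have /andP[yb1 yb2] : (`|y + b.2 v *: b.1 - p| < d1) && (`|y + b.2 v *: b.1 - p| < d2).
  by rewrite -lt_min.
have A := H1 (y + b.2 v *: b.1) v yb1 _.
have B := H2 y (b.2 v) _ yb2.
have split (a1 a2 a3 c1 c2 : 'rV[R]_m) :
    a1 - a3 - (c1 + c2) = (a1 - a2 - c2) + (a2 - a3 - c1).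
  by apply/rowP => i; rewrite !mxE; ring.
rewrite (split _ (f (y + b.2 v *: b.1))); apply: le_trans (ler_normD _ _) _.
have : `|f (y + b.2 v *: b.1) - f y - b.2 v *: 'D_(b.1) f p| <= e / 2 * `|v|.
  apply: le_trans (B _) _; first by lra.
  by rewrite ler_wpM2l //; lra.
have := A _; rewrite (_ : `|v| < d1); last by lra.
by move=> /(_ isT); lra.
Qed.

Lemma C1_strict_diff (V : normedModType R) m (f : V -> 'rV[R]_m) (s : seq (V * (V -> R))) (p : V) :
  (forall x, x = \sum_(b <- s) b.2 x *: b.1) ->
  (forall b, b \in s -> forall x, `|b.2 x| <= `|x|) ->
  (forall e x, derivable f x e) -> (forall e, continuous (fun x => 'D_e f x)) ->
  strict_diff f (fun v => \sum_(b <- s) b.2 v *: 'D_(b.1) f p) p.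
Proof.
move=> sE sb df cf e e0.
have [d d0 H] := C1_telescope p sb df cf e0.
exists (d / 2); first lra.
move=> x y xd yd; have := H y (x - y); rewrite -(sE (x - y)) (addrC y (x - y)) subrK; apply; first by lra.
apply: le_lt_trans (ler_distD p _ _) _; rewrite [`|p - y|]distrC; lra.
Qed.

Lemma strict_diff_differentiable (V W : normedModType R) (f : V -> W) (L : {linear V -> W})
    (p : V) (C : R) :
  (forall v, `|L v| <= C * `|v|) -> strict_diff f L p ->
  differentiable f p /\ 'd f p = L :> (V -> W).
Proof.
move=> LC fL.
have Lc : continuous L.
  apply: bounded_linear_continuous; apply/linear_boundedP.
  apply: filterS (nbhs_pinfty_ge (num_real C)) => r Cr x.
  by apply: le_trans (LC x) _; rewrite ler_wpM2r.
have dxf : f \o shift p = cst (f p) + L +o_ 0 id.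
  apply/eqaddoP => e e0; have [d d0 H] := fL e e0.
  apply/nbhs_ballP; exists d => //= h; rewrite -ball_normE /= sub0r normrN => hd.
  have := H (h + p) p; rewrite addrK subrr normr0 => /(_ hd d0).
  by rewrite -addrA -opprD.
split; last exact: diff_unique.
apply/diffP => /=.
apply: (@getPex _ (fun (df : {linear V -> W}) => continuous df /\
  forall y, f y = f (lim (nbhs p)) + df (y - lim (nbhs p))
                  +o_(y \near p) (y - lim (nbhs p)))).
exists L; split=> //; rewrite lim_id //.
have E : f = (fun y => f p + L (y - p)) +o_p (fun y => y - p).
  apply/eqaddoP => e e0; have [d d0 H] := fL e e0.
  apply/nbhs_ballP; exists d => //= h; rewrite -ball_normE /= distrC => hd.
  have := H h p; rewrite subrr normr0 => /(_ hd d0).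
  by rewrite -addrA -opprD.
by move=> y; exact: (congr1 (fun g => g y) E).
Qed.

(** Local surjectivity of a map tangent to the identity: for small [y], the map
    [x |-> x + y - f x] is a contraction of a ball, whose fixed point is a
    preimage of [y]. *)
Lemma strict_diff_id_surj n (f : 'rV[R]_n -> 'rV[R]_n) :
  f 0 = 0 -> strict_diff f id 0 ->
  exists2 d : R, 0 < d & forall y, `|y| < d -> exists2 x, `|x| <= 2 * `|y| & f x = y.
Proof.
move=> f0 fid; have [|d d0 H] := fid (1 / 2); first lra.
exists (d / 3); first lra.
move=> y yd; pose U : set 'rV[R]_n := [set x | `|x| <= 2 * `|y|].
have fU x x' : U x -> U x' -> `|f x - f x' - (x - x')| <= 1 / 2 * `|x - x'|.
  rewrite /U /= => Ux Ux'; apply: H; rewrite subr0; have := normr_ge0 y; lra.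
pose g x := x + y - f x.
have gU : {homo g : x / U x}.
  move=> x Ux; have := fU x 0 Ux; rewrite /U /= normr0 f0 !subr0 => /(_ _)H0.
  have -> : g x = y - (f x - x) by rewrite /g opprB addrA [y + x]addrC.
  apply: le_trans (ler_normB _ _) _.
  have := H0 _; rewrite mulr_ge0 // => /(_ isT); move: Ux; rewrite /U /=; lra.
pose G : {fun U >-> U} := HB.pack_for {fun U >-> U} g (isFun.Build _ _ U U g gU).
have ctr : is_contraction G.
  have h0 : 0 <= 1 / 2 :> R by lra.
  exists (NngNum h0); split => /=; first lra.
  move=> [x x'] /= [Ux Ux']; rewrite /g.
  have -> : x + y - f x - (x' + y - f x') = - (f x - f x' - (x - x')).
    by apply/rowP => i; rewrite !mxE; ring.
  by rewrite normrN; exact: fU.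
have [||x Ux /= Gx] := @banach_fixed_point R 'rV[R]_n U G ctr.
- have -> : U = Num.norm @^-1` [set x | x <= 2 * `|y|] by [].
  apply: closed_comp; last exact: closed_le.
  by move=> x _; exact: norm_continuous.
- by exists 0; rewrite /U /= normr0 mulr_ge0.
exists x => //; move: Gx; rewrite /= /g => /eqP.
by rewrite -addrA -[eqbLHS]addr0 (inj_eq (addrI x)) eq_sym subr_eq0 => /eqP.
Qed.

(** In matrix form the differential is visibly linear and bounded. *)
Lemma C1_pair_strict_diff n m (f : 'rV[R]_n * 'rV[R]_n -> 'rV[R]_m) (p : 'rV[R]_n * 'rV[R]_n) :
  Ck 1 f -> exists (A B : 'M[R]_(n, m)),
    strict_diff f (fun v => v.1 *m A + v.2 *m B) p.
Proof.
move=> [_ Cf].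
pose s : seq (('rV[R]_n * 'rV[R]_n) * ('rV[R]_n * 'rV[R]_n -> R)) :=
  [seq ((delta_mx 0 i, 0), fun v : 'rV[R]_n * 'rV[R]_n => v.1 0 i) | i <- index_enum 'I_n] ++
  [seq ((0, delta_mx 0 i), fun v : 'rV[R]_n * 'rV[R]_n => v.2 0 i) | i <- index_enum 'I_n].
have sumE (W : lmodType R) (F : _ -> W) v : \sum_(b <- s) b.2 v *: F b.1 =
  \sum_i v.1 0 i *: F (delta_mx 0 i, 0) + \sum_i v.2 0 i *: F (0, delta_mx 0 i).
  by rewrite big_cat !big_map.
exists (\matrix_i ('D_(delta_mx 0 i, 0) f p)), (\matrix_i ('D_(0, delta_mx 0 i) f p)).
have -> : (fun v : 'rV[R]_n * 'rV[R]_n => v.1 *m (\matrix_i ('D_(delta_mx 0 i, 0) f p))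
     + v.2 *m (\matrix_i ('D_(0, delta_mx 0 i) f p))) =
   fun v => \sum_(b <- s) b.2 v *: 'D_(b.1) f p.
  apply/funext => v; rewrite (sumE _ (fun e => 'D_e f p)) !mulmx_sum_row.
  by congr (_ + _); apply: eq_bigr => i _; rewrite rowK.
apply: C1_strict_diff.
- have pair_sum (F G : 'I_n -> 'rV[R]_n) : \sum_i (F i, G i) = (\sum_i F i, \sum_i G i).
    by elim/big_rec3: _ => // i x y _ _ ->.
  case=> a b; rewrite (sumE _ id) /= {1}(row_sum_delta a) {1}(row_sum_delta b).
  rewrite (eq_bigr (fun i => (a 0 i *: delta_mx 0 i : 'rV[R]_n, 0 : 'rV[R]_n))); last first.
    by move=> i _; congr (_, _); rewrite scaler0.
  rewrite [X in _ + X](eq_bigr (fun i => (0 : 'rV[R]_n, b 0 i *: delta_mx 0 i : 'rV[R]_n))); last first.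
    by move=> i _; congr (_, _); rewrite scaler0.
  rewrite !pair_sum; congr (_, _) => /=.
    by rewrite [X in _ + X]big1 ?addr0.
  by rewrite [X in X + _]big1 ?add0r.
- move=> b; rewrite mem_cat => /orP[] /mapP[i _ ->] v /=.
    by apply: le_trans (row_norm_ge _ i) _; rewrite prod_normE le_max lexx.
  by apply: le_trans (row_norm_ge _ i) _; rewrite prod_normE le_max lexx orbT.
- by move=> e; case: (Cf e).
- by move=> e; case: (Cf e) => _ [].
Qed.
End StrictDifferential.

(** * One-parameter subgroups and the adjoint action *)

Section LieChart.
Context {R : realType} (G : lieGroup R).
Local Notation E := 'rV[R]_(lie_dim G).
Local Notation exp := (lie_exp G).
Local Notation log := (lie_log G).
Implicit Types (g h : G) (X Y Z : E).

(** The group law read in the exponential chart. *)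
Definition chart_mul (X Y : E) : E := log (exp X * exp Y)%g.
Local Notation "X ** Y" := (chart_mul X Y) (at level 40, left associativity).

Lemma exp_mul X Y : exp (X ** Y) = (exp X * exp Y)%g.
Proof. exact: lie_logK. Qed.

Lemma exp0 : exp 0 = 1%g.
Proof.
have := @lie_expD R G 0 0 0; rewrite addr0 !scale0r => /(congr1 (fun x => (exp 0)^-1 * x)%g).
by rewrite mulKg mulVg.
Qed.

Lemma expZD (a b : R) X : exp ((a + b) *: X) = (exp (a *: X) * exp (b *: X))%g.
Proof. exact: lie_expD. Qed.

Lemma expN X : exp (- X) = (exp X)^-1%g.
Proof.
have := @lie_expD R G 1 (-1) X; rewrite subrr scale0r exp0 scale1r scaleN1r.
by move=> /(congr1 (fun x => (exp X)^-1 * x)%g); rewrite mulKg mulg1.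
Qed.

Lemma exp_natmul k X : exp (k%:R *: X) = (exp X ^+ k)%g.
Proof.
elim: k => [|k IH]; first by rewrite scale0r exp0 expg0.
by rewrite expgS -IH -natr1 addrC lie_expD scale1r.
Qed.

Lemma log1 : log 1%g = 0.
Proof. by rewrite -exp0 lie_expK. Qed.

Lemma logV g : log g^-1%g = - log g.
Proof. by rewrite -{1}[g](lie_logK (l := G)) -expN lie_expK. Qed.

Lemma chart_mulX0 X : X ** 0 = X.
Proof. by rewrite /chart_mul exp0 mulg1 lie_expK. Qed.

Lemma chart_mul0X X : 0 ** X = X.
Proof. by rewrite /chart_mul exp0 mul1g lie_expK. Qed.

Lemma chart_mul_differentiable (p : E * E) : differentiable (fun p : E * E => p.1 ** p.2) p.
Proof.
have [A [B AB]] := C1_pair_strict_diff p (@lie_mul_smooth R G 1).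
pose L : E * E -> E := fun v => v.1 *m A + v.2 *m B.
have linL : linear L.
  move=> a v w; rewrite /L /= !mulmxDl -!scalemxAl scalerDr.
  by rewrite addrACA.
pose Lf : {linear (E * E)%type -> E} :=
  HB.pack_for {linear (E * E)%type -> E} L (GRing.isLinear.Build R (E * E)%type E *:%R L linL).
have [CA CA0 HA] := linear_bound (mulmxr A : {linear E -> E}).
have [CB CB0 HB] := linear_bound (mulmxr B : {linear E -> E}).
have [] // := @strict_diff_differentiable R _ _ (fun p : E * E => p.1 ** p.2) Lf p (CA + CB) _ AB.
move=> v; rewrite /= /L; apply: le_trans (ler_normD _ _) _; rewrite mulrDl lerD //.
  by apply: le_trans (HA _) _; rewrite ler_wpM2l // prod_normE le_max lexx.
by apply: le_trans (HB _) _; rewrite ler_wpM2l // prod_normE le_max lexx orbT.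
Qed.

(** The differential of the product at the identity is the sum: restricted to
    either axis the product is the identity map, which determines the two partial
    differentials. *)
Lemma chart_mul_strict0 : strict_diff (fun p : E * E => p.1 ** p.2) (fun v => v.1 + v.2) 0.
Proof.
have [A [B AB]] := C1_pair_strict_diff 0 (@lie_mul_smooth R G 1).
have tangent (M : 'M[R]_(lie_dim G)) : (forall e : R, 0 < e -> exists2 d : R, 0 < d &
    forall x : E, `|x| < d -> `|x - x *m M| <= e * `|x|) -> forall x : E, x *m M = x.
  move=> H x; apply/eqP; rewrite eq_sym -subr_eq0 -normr_eq0 eq_le normr_ge0 andbT.
  have [->|x0] := eqVneq x 0; first by rewrite mul0mx subrr normr0.
  have nx0 : 0 < `|x| by rewrite normr_gt0.
  apply/ler_addgt0Pr => e e0; rewrite add0r.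
  have [d d0 Hd] := H (e / `|x|) (divr_gt0 e0 nx0).
  pose t := d / 2 / `|x|; have t0 : 0 < t by rewrite !divr_gt0.
  have nt : `|t *: x| = d / 2 by rewrite normrZ gtr0_norm // divfK // gt_eqF.
  have := Hd (t *: x); rewrite nt => /(_ ltac:(lra)).
  rewrite -scalemxAl -scalerBr normrZ gtr0_norm // -nt normrZ gtr0_norm // mulrCA.
  by rewrite ler_pM2l // divfK // gt_eqF.
have nA (x : E) : `|(x, 0) : E * E| = `|x| by rewrite prod_normE /= normr0; apply/max_idPl.
have nB (x : E) : `|(0, x) : E * E| = `|x| by rewrite prod_normE /= normr0; apply/max_idPr.
have A1 : forall x : E, x *m A = x.
  apply: tangent => e e0; have [d d0 H] := AB e e0; exists d => // x xd.
  have := H (x, 0) 0; rewrite !subr0 nA normr0 => /(_ xd d0) /=.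
  by rewrite -!/(chart_mul _ _) !chart_mulX0 mul0mx addr0 subr0.
have B1 : forall x : E, x *m B = x.
  apply: tangent => e e0; have [d d0 H] := AB e e0; exists d => // x xd.
  have := H (0, x) 0; rewrite !subr0 nB normr0 => /(_ xd d0) /=.
  by rewrite -!/(chart_mul _ _) !chart_mul0X mul0mx add0r subr0.
move=> e e0; have [d d0 H] := AB e e0; exists d => // x y xd yd.
by have := H x y xd yd; rewrite A1 B1.
Qed.

(** Conjugation commutes with powers, so in the exponential chart it is
    homogeneous under integers, hence equal to its differential at 0: this makes
    it linear and identifies it with [lie_Ad]. *)
Definition chart_conj g Y : E := log (g * exp Y * g^-1)%g.

Lemma exp_conj g Y : exp (chart_conj g Y) = (g * exp Y * g^-1)%g.
Proof. exact: lie_logK. Qed.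

Lemma chart_conjE g Y : chart_conj g Y = log g ** Y ** - log g.
Proof. by rewrite /chart_conj /chart_mul expN !lie_logK. Qed.

Lemma differentiable_chart_mul (V : normedModType R) (a b : V -> E) (x : V) :
  differentiable a x -> differentiable b x -> differentiable (fun x => a x ** b x) x.
Proof.
move=> da db.
apply: (@differentiable_comp _ _ _ _ (fun x => (a x, b x)) (fun p => p.1 ** p.2)).
  exact: differentiable_pair.
exact: chart_mul_differentiable.
Qed.

Lemma chart_conj_differentiable g Y : differentiable (chart_conj g) Y.
Proof.
have -> : chart_conj g = fun Y => log g ** Y ** - log g.
  by apply/funext => ?; rewrite chart_conjE.
by apply: differentiable_chart_mul => //; apply: differentiable_chart_mul.
Qed.

Lemma chart_conj_natmul g k Y : chart_conj g (k%:R *: Y) = k%:R *: chart_conj g Y.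
Proof.
apply: (can_inj (lie_expK (l := G))); rewrite exp_natmul !exp_conj exp_natmul.
elim: k => [|k IH]; first by rewrite !expg0 mulg1 mulgV.
by rewrite !expgS -IH !mulgA mulgVK.
Qed.

Lemma chart_conj0 g : chart_conj g 0 = 0.
Proof. by have := chart_conj_natmul g 0 0; rewrite !scale0r. Qed.

(** Since [f x = k f (x / k)] for all [k], the remainder of the first order
    expansion at 0 vanishes. *)
Lemma natmul_differential (V W : normedModType R) (f : V -> W) :
  differentiable f 0 -> (forall k x, f (k%:R *: x) = k%:R *: f x) ->
  f = 'd f 0 :> (V -> W).
Proof.
move=> df fk; apply/funext => x.
have f0 : f 0 = 0 by have := fk 0%N 0; rewrite !scale0r.
apply/eqP; rewrite -subr_eq0 -normr_eq0 eq_le normr_ge0 andbT.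
have [->|x0] := eqVneq x 0; first by rewrite linear0 f0 subrr normr0.
have nx0 : 0 < `|x| by rewrite normr_gt0.
apply/ler_addgt0Pr => e e0; rewrite add0r.
have /eqaddoP/(_ (e / `|x|) (divr_gt0 e0 nx0))/nbhs_ballP[d /= d0 H] := diff_locally df.
have [k kd] : exists k : nat, `|x| / k.+1%:R < d.
  exists (Num.truncn (`|x| / d)); rewrite ltr_pdivrMr // mulrC -ltr_pdivrMr //.
  exact: truncnS_gt.
have := H (k.+1%:R^-1 *: x); rewrite -ball_normE /= sub0r normrN normrZ.
have k0 : (0 : R) < k.+1%:R^-1 by rewrite invr_gt0.
rewrite gtr0_norm // mulrC => /(_ kd).
have fx : f (k.+1%:R^-1 *: x) = k.+1%:R^-1 *: f x.
  have kk : k.+1%:R * k.+1%:R^-1 = 1 :> R by rewrite divff ?pnatr_eq0.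
  have xE : x = k.+1%:R *: (k.+1%:R^-1 *: x) by rewrite scalerA kk scale1r.
  by rewrite [in RHS]xE fk scalerA mulrC kk scale1r.
have -> : (f \o +%R^~ 0 - (cst (f 0) + 'd f 0)) (k.+1%:R^-1 *: x) = k.+1%:R^-1 *: (f x - 'd f 0 x).
  transitivity (f (k.+1%:R^-1 *: x + 0) - (f 0 + 'd f 0 (k.+1%:R^-1 *: x))) => //.
  by rewrite addr0 f0 add0r linearZ /= scalerBr fx.
rewrite normrZ gtr0_norm // [`|x| * _]mulrC mulrCA ler_pM2l //.
by rewrite divfK // gt_eqF.
Qed.

Lemma chart_conj_linear g : linear (chart_conj g).
Proof.
rewrite (natmul_differential (chart_conj_differentiable g 0) (chart_conj_natmul g)).
exact: linearP.
Qed.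

HB.instance Definition _ g :=
  GRing.isLinear.Build R E E *:%R (chart_conj g) (chart_conj_linear g).

Lemma lie_AdE g Y : lie_Ad g Y = chart_conj g Y.
Proof.
rewrite /lie_Ad derive1E -[RHS]scale1r.
have -> : (fun t : R => log (g * exp (t *: Y) * g^-1)%g) = *:%R^~ (chart_conj g Y).
  by apply/funext => t; rewrite -linearZ.
by rewrite deriveE ?diff_val.
Qed.

Lemma chart_conjM g h Y : chart_conj (g * h)%g Y = chart_conj g (chart_conj h Y).
Proof.
by apply: (can_inj (lie_expK (l := G))); rewrite !exp_conj invgM !mulgA.
Qed.

Lemma chart_conj1 Y : chart_conj 1%g Y = Y.
Proof. by rewrite /chart_conj mul1g invg1 mulg1 lie_expK. Qed.

Local Notation conj_flow X t := (chart_conj (exp (t *: X))).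

Lemma conj_flow_is_derive0 X Y :
  is_derive (0 : R) (1 : R) (fun t : R => conj_flow X t Y) (lie_bracket X Y).
Proof.
have -> : lie_bracket X Y = 'D_(1 : R) (fun t : R => conj_flow X t Y) 0.
  have E : (fun t : R => lie_Ad (exp (t *: X)) Y) = fun t : R => conj_flow X t Y.
    by apply/funext => t; exact: lie_AdE.
  by rewrite -derive1E -E.
apply/derivableP/derivable1_diffP.
have -> : (fun t : R => conj_flow X t Y) = fun t => (t *: X) ** Y ** - (t *: X).
  by apply/funext => t; rewrite chart_conjE lie_expK.
apply: differentiable_chart_mul; first apply: differentiable_chart_mul => //.
by apply: differentiableN.
Qed.
End LieChart.

Section ConjFlow.
Context {R : realType} (G : lieGroup R).
Local Notation E := 'rV[R]_(lie_dim G).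
Local Notation exp := (lie_exp G).
Local Notation log := (lie_log G).
Local Notation conj_flow X t := (chart_conj (exp (t *: X))).
Implicit Types (g h : G) (X Y Z : E).

Lemma chart_conj_continuous g : continuous (@chart_conj R G g).
Proof. by move=> Y; apply: differentiable_continuous; exact: chart_conj_differentiable. Qed.

(** The flow [t |-> Ad (exp (t X)) Y] is the solution of a linear
    differential equation, because [Ad] is multiplicative. *)
Lemma conj_flow_is_derive X Y (t : R) :
  is_derive t (1 : R) (fun t : R => conj_flow X t Y) (conj_flow X t (lie_bracket X Y)).
Proof.
have [dX vX] := conj_flow_is_derive0 X Y.
pose q (f : R -> E) (s h : R) : E := h^-1 *: ((f \o shift s) (h *: (1 : R)) - f s).
have c0 : q (fun t : R => conj_flow X t Y) 0 h @[h --> 0^'] --> lie_bracket X Y.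
  by rewrite -vX.
have ct : q (fun t : R => conj_flow X t Y) t h @[h --> 0^'] --> conj_flow X t (lie_bracket X Y).
  have := cvg_comp _ _ c0 (@chart_conj_continuous (exp (t *: X)) (lie_bracket X Y)).
  apply: cvg_trans; apply: near_eq_cvg; apply: nearW => h; rewrite /q /=.
  rewrite linearZ /= linearB /=; congr (_ *: (_ - _)); last first.
    by rewrite scale0r exp0 chart_conj1.
  by rewrite -chart_conjM -exp_mul /chart_mul -expZD lie_expK addr0 addrC.
by apply: DeriveDef; [apply/cvg_ex; eexists; exact: ct | apply: cvg_lim].
Qed.

(** When [ad X] kills [Y] after [m] steps the flow is polynomial: both sides
    have the same derivative, by induction on [m], and the same value at 0. *)
Lemma conj_flow_formula m X Y : iter m (lie_bracket X) Y = 0 ->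
  forall t : R, conj_flow X t Y = \sum_(j < m) (t ^+ j / j`!%:R) *: iter j (lie_bracket X) Y.
Proof.
elim: m Y => [|m IH] Y; first by move=> /= -> t; rewrite big_ord0 linear0.
rewrite iterSr => /IH F t; apply/rowP => i.
pose p := \poly_(j < m.+1) ((iter j (lie_bracket X) Y) 0 i / j`!%:R).
have pE (s : R) : (\sum_(j < m.+1) (s ^+ j / j`!%:R) *: iter j (lie_bracket X) Y) 0 i = p.[s].
  rewrite horner_poly summxE; apply: eq_bigr => j _; rewrite mxE.
  by rewrite mulrC mulrA mulrAC.
have p'E (s : R) : p^`().[s] = (conj_flow X s (lie_bracket X Y)) 0 i.
  rewrite F summxE (_ : p^`() = \poly_(j < m) ((iter j.+1 (lie_bracket X) Y) 0 i / j`!%:R)).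
    rewrite horner_poly; apply: eq_bigr => j _; rewrite mxE -iterSr.
    by rewrite mulrC mulrA mulrAC.
  apply/polyP => j; rewrite coef_deriv !coef_poly ltnS; case: ltnP => jm; last by rewrite mul0rn.
  rewrite -[LHS]mulr_natr -mulrA; congr (_ * _); rewrite factS natrM invfM mulrC mulrA divff ?mul1r //.
pose h (s : R) := (conj_flow X s Y) 0 i - p.[s].
have dh (s : R) : is_derive s (1 : R) h 0.
  have [d1 v1] := conj_flow_is_derive X Y s.
  have dc := (derivable_mxP _ _ _).1 d1 0 i.
  have dc' : is_derive s (1 : R) (fun s : R => (conj_flow X s Y) 0 i) (p^`().[s]).
    apply: DeriveDef => //.
    by rewrite p'E -v1 derive_mx // mxE.
  have dp : is_derive s (1 : R) (horner p) (p^`().[s]).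
    apply: DeriveDef; first exact: derivable_horner.
    by rewrite derivE derive1E.
  by rewrite -(subrr p^`().[s]); exact: is_deriveB.
have := is_derive_0_is_cst t 0 dh; rewrite /h scale0r exp0 chart_conj1 pE.
rewrite horner_coef0 coef_poly /= divr1 subrr => /eqP.
by rewrite subr_eq0 => /eqP.
Qed.

(** First order form of the Trotter product formula: a consequence of the
    differential of the product at the identity. *)
Lemma trotter X Y :
  (k.+1%:R *: chart_mul (k.+1%:R^-1 *: X : E) (k.+1%:R^-1 *: Y)) @[k --> \oo] --> X + Y.
Proof.
apply/cvgrPdist_le => e e0.
pose M := `|(X, Y)| + 1; have M0 : 0 < M by rewrite ltr_wpDl.
have [d d0 H] := @chart_mul_strict0 R G (e / M) (divr_gt0 e0 M0).
exists (Num.truncn (M / d)) => // k /= kd.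
have k0 : (0 : R) < k.+1%:R by [].
have kM : M / k.+1%:R < d.
  rewrite ltr_pdivrMr // mulrC -ltr_pdivrMr //; apply: lt_le_trans (truncnS_gt _) _.
  by rewrite ler_nat ltnS.
have := H (k.+1%:R^-1 *: (X, Y)) 0.
rewrite !subr0 normr0 normrZ gtr0_norm ?invr_gt0 //= => H'.
have {H'} := H' _ d0; rewrite chart_mulX0 subr0 -scalerDr => H'.
rewrite distrC -[X + Y](@scalerKV _ _ k.+1%:R) ?pnatr_eq0 // -scalerBr normrZ gtr0_norm //.
rewrite -ler_pdivlMl //; apply: le_trans (H' _) _.
  by apply: le_lt_trans kM; rewrite mulrC ler_pM2r ?invr_gt0 // /M; lra.
rewrite mulrCA ler_pM2l ?invr_gt0 // mulrAC ler_pdivrMr // ler_pM2l // /M; lra.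
Qed.
End ConjFlow.

(** * Closed subgroups *)

(** A subset of a vector space stable under the linear operations is the
    membership predicate of a [{vspace _}]: take a contained subspace of maximal
    dimension. *)
Lemma subspace_vspace (K : fieldType) (vT : vectType K) (S : vT -> Prop) :
  S 0 -> (forall u v, S u -> S v -> S (u + v)) -> (forall a v, S v -> S (a *: v)) ->
  exists U : {vspace vT}, forall v, v \in U <-> S v.
Proof.
move=> S0 SD SZ.
pose P (d : nat) := `[< exists U : {vspace vT}, \dim U = d /\ forall v, v \in U -> S v >].
have P0 : exists d, P d.
  exists 0%N; apply/asboolP; exists 0%VS; rewrite dimv0; split=> // v.
  by rewrite memv0 => /eqP ->.
have Pb d : P d -> (d <= \dim {:vT})%N.
  by move=> /asboolP[U [<- _]]; exact: dimvS (subvf U).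
case: (ex_maxnP P0 Pb) => d /asboolP[U [Ud US]] maxd.
exists U => v; split; first exact: US.
move=> Sv; have : P (\dim (U + <[v]>)%VS).
  apply/asboolP; exists (U + <[v]>)%VS; split=> // w /memv_addP[u uU [x /vlineP[a ->] ->]].
  by apply: SD; [exact: US | exact: SZ].
move=> /maxd; rewrite -Ud => dUv.
have : (U + <[v]> <= U)%VS.
  suff /eqP <- : U == (U + <[v]>)%VS by [].
  by rewrite eqEdim addvSl dUv.
by rewrite subv_add => /andP[_]; rewrite -memvE.
Qed.

Section ClosedSubgroups.
Context {R : realType} (G : lieGroup R) (C : G -> Prop).
Local Notation E := 'rV[R]_(lie_dim G).
Local Notation exp := (lie_exp G).
Local Notation log := (lie_log G).
Implicit Types (g h : G) (X Y Z : E).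

(** Closedness is sequential, for the topology of the exponential chart. *)
Record closed_subgroup : Prop := ClosedSubgroup {
  csub1 : C 1%g;
  csubM : forall g h, C g -> C h -> C (g * h)%g;
  csubV : forall g, C g -> C g^-1%g;
  csub_lim : forall (u : nat -> G) g, (forall k, C (u k)) ->
    log (u k) @[k --> \oo] --> log g -> C g
}.

Hypothesis CC : closed_subgroup.

(** The Lie algebra of [C]. *)
Definition tangent_to X : Prop := forall t : R, C (exp (t *: X)).

Lemma csubX g k : C g -> C (g ^+ k)%g.
Proof.
by move=> Cg; elim: k => [|k IH]; rewrite ?expg0 ?expgS; [exact: (csub1 CC) | exact: (csubM CC)].
Qed.

Lemma tangent_lim (u : nat -> E) X : (forall k, tangent_to (u k)) ->
  u k @[k --> \oo] --> X -> tangent_to X.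
Proof.
move=> Su uX t; apply: (csub_lim CC (u := fun k => exp (t *: u k))); first by move=> k; exact: Su.
rewrite lie_expK; under eq_fun do rewrite lie_expK.
by apply: cvgZ uX; exact: cvg_cst.
Qed.

Lemma tangentZ (a : R) X : tangent_to X -> tangent_to (a *: X).
Proof. by move=> SX t; rewrite scalerA; exact: SX. Qed.

Lemma tangent0 : tangent_to 0.
Proof. by move=> t; rewrite scaler0 exp0; exact: (csub1 CC). Qed.

(** By the Trotter formula [exp (t (X + Y))] is a limit of products of elements
    of [C]. *)
Lemma tangentD X Y : tangent_to X -> tangent_to Y -> tangent_to (X + Y).
Proof.
move=> SX SY t.
pose p k := (exp (k.+1%:R^-1 *: (t *: X)) * exp (k.+1%:R^-1 *: (t *: Y)))%g.
apply: (csub_lim CC (u := fun k => (p k ^+ k.+1)%g)).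
  by move=> k; apply: csubX; apply: (csubM CC) => //; rewrite scalerA.
rewrite lie_expK scalerDr.
have -> : (fun k => log (p k ^+ k.+1)%g) = fun k =>
    k.+1%:R *: chart_mul (k.+1%:R^-1 *: (t *: X) : E) (k.+1%:R^-1 *: (t *: Y)).
  apply/funext => k; rewrite -[RHS](lie_expK (l := G)) exp_natmul exp_mul.
  by rewrite /p.
exact: trotter.
Qed.

(** The bracket is the derivative at 0 of [t |-> Ad (exp (t X)) Y], a curve of
    tangent vectors. *)
Lemma tangent_bracket X Y : tangent_to X -> tangent_to Y -> tangent_to (lie_bracket X Y).
Proof.
move=> SX SY.
pose f (t : R) := chart_conj (exp (t *: X)) Y.
have Sf t : tangent_to (f t).
  move=> s; rewrite -linearZ /= exp_conj.
  by apply: (csubM CC) => //; [exact: (csubM CC) | exact: (csubV CC)].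
have [d0 v0] := conj_flow_is_derive0 X Y.
apply: (@tangent_lim (fun k => k.+1%:R *: (f k.+1%:R^-1 - Y))).
  move=> k; apply: tangentZ; apply: tangentD => //.
  by rewrite -scaleN1r; exact: tangentZ.
have c0 : (h^-1 *: ((f \o shift 0) (h *: (1 : R)) - f 0)) @[h --> 0^'] --> lie_bracket X Y.
  by rewrite -v0.
have hk : (k.+1%:R^-1 : R) @[k --> \oo] --> 0^'.
  move=> A A0.
  have H : \forall k \near \oo, (k.+1%:R^-1 : R) != 0 -> A k.+1%:R^-1 := @cvg_harmonic R _ A0.
  by apply: filterS H => k; apply; rewrite invr_eq0 pnatr_eq0.
have := cvg_comp _ _ hk c0; apply: cvg_trans; apply: near_eq_cvg; apply: nearW => k /=.
rewrite invrK /f /= addr0 scale0r exp0 chart_conj1.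
by congr (_ *: (chart_conj (exp (_ *: _)) _ - _)); rewrite [_%:A]mulr1.
Qed.

End ClosedSubgroups.

(** The Lie algebra of a closed subgroup is stable under brackets, so it
    contains every layer as soon as it contains the first one. *)
Theorem closed_subgroup_full (R : realType) (G : stratifiedGroup R) (C : G -> Prop) :
  closed_subgroup C -> (forall X, X \in layer G 1 -> C (lie_exp G X)) -> forall g, C g.
Proof.
move=> CC C1.
have [U US] := subspace_vspace (tangent0 CC) (tangentD CC) (@tangentZ _ _ C).
have U1 : (layer G 1 <= U)%VS.
  by apply/subvP => X X1; apply/US => t; apply: C1; exact: memvZ.
have Uk k : (k < step G)%N -> (layer G k.+1 <= U)%VS.
  elim: k => [//|k IH] ks; have [|_] := layer_bracket (s := G) (k := k.+1).
    by rewrite /= ltnW.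
  apply => X Y X1 Yk; apply/US; apply: tangent_bracket => //; apply/US.
    exact: subvP U1 _ X1.
  exact: subvP (IH (ltnW ks)) _ Yk.
move=> g; rewrite -[g](lie_logK (l := G)) -[lie_log G g]scale1r.
move: (1 : R); apply/US; have := memvf (lie_log G g); rewrite -(layer_sum G).
by apply: subvP; apply/subv_sumP => k _; exact: Uk.
Qed.

(** * Homogeneous distances are continuous in the chart *)

Section ProductsOfCurves.
Context {R : realType} (G : lieGroup R).
Local Notation E := 'rV[R]_(lie_dim G).

(** [chart_mul_strict0] composed with Lipschitz estimates for the two factors. *)
Lemma strict_diff_chart_mul (a b La Lb : E -> E) (C : R) :
  a 0 = 0 -> b 0 = 0 -> 0 <= C ->
  (forall x, `|La x| <= C * `|x|) -> (forall x, `|Lb x| <= C * `|x|) ->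
  strict_diff a La 0 -> strict_diff b Lb 0 ->
  strict_diff (fun x => chart_mul (a x) (b x)) (fun x => La x + Lb x) 0.
Proof.
move=> a0 b0 C0 LaC LbC da db e e0.
have C1 : 0 < C + 1 by lra.
pose e1 := Num.min 1 (e / 4).
have e10 : 0 < e1 by rewrite lt_min ltr01 divr_gt0.
have e11 : e1 <= 1 by rewrite ge_min lexx.
have e1e : e1 <= e / 4 by rewrite ge_min lexx orbT.
have [d1 d10 H1] := da e1 e10.
have [d2 d20 H2] := db e1 e10.
have e30 : 0 < e / 2 / (C + 1) by rewrite !divr_gt0.
have [d3 d30 H3] := @chart_mul_strict0 R G _ e30.
have lip (f L : E -> E) d : (forall x, `|L x| <= C * `|x|) ->
    (forall x y, `|x - 0| < d -> `|y - 0| < d -> `|f x - f y - L (x - y)| <= e1 * `|x - y|) ->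
    forall x y, `|x| < d -> `|y| < d -> `|f x - f y| <= (C + 1) * `|x - y|.
  move=> LC H x y xd yd; rewrite -[_ - _](subrK (L (x - y))).
  apply: le_trans (ler_normD _ _) _; have := H x y; rewrite !subr0 => /(_ xd yd).
  have := LC (x - y); have : e1 * `|x - y| <= 1 * `|x - y| by rewrite ler_wpM2r.
  rewrite mulrDl; lra.
pose d := Num.min (Num.min d1 d2) (d3 / (C + 1)).
have d0 : 0 < d by rewrite !lt_min d10 d20 divr_gt0.
have dd1 : d <= d1 by rewrite !ge_min lexx.
have dd2 : d <= d2 by rewrite !ge_min lexx orbT.
have dd3 : d * (C + 1) <= d3 by rewrite -ler_pdivlMr // ge_min lexx orbT.
exists d => // x y; rewrite !subr0 => xd yd.
have xd1 := lt_le_trans xd dd1; have yd1 := lt_le_trans yd dd1.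
have xd2 := lt_le_trans xd dd2; have yd2 := lt_le_trans yd dd2.
have A := lip a La d1 LaC H1; have B := lip b Lb d2 LbC H2.
have small z : `|z| < d -> `|(a z, b z)| < d3.
  move=> zd; rewrite prod_normE /= gt_max.
  have Az := A z 0 (lt_le_trans zd dd1); have Bz := B z 0 (lt_le_trans zd dd2).
  move: Az Bz; rewrite !normr0 a0 b0 !subr0 => /(_ d10) Az /(_ d20) Bz.
  have zd3 : (C + 1) * `|z| < d3.
    by apply: lt_le_trans dd3; rewrite mulrC ltr_pM2r.
  by rewrite (le_lt_trans Az zd3) (le_lt_trans Bz zd3).
have := H3 (a x, b x) (a y, b y); rewrite !subr0 => /(_ (small _ xd) (small _ yd)) /= H.
have {}H : `|chart_mul (a x) (b x) - chart_mul (a y) (b y) - (a x - a y + (b x - b y))| <= e / 2 * `|x - y|.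
  apply: le_trans H _; rewrite -mulrA ler_wpM2l //; first by lra.
  by rewrite ler_pdivrMl // prod_normE /= ge_max A ?B.
have Hx := H1 x y; rewrite !subr0 in Hx; have {}Hx := Hx xd1 yd1.
have Hy := H2 x y; rewrite !subr0 in Hy; have {}Hy := Hy xd2 yd2.
have -> : chart_mul (a x) (b x) - chart_mul (a y) (b y) - (La (x - y) + Lb (x - y)) =
   (chart_mul (a x) (b x) - chart_mul (a y) (b y) - (a x - a y + (b x - b y))) +
   ((a x - a y - La (x - y)) + (b x - b y - Lb (x - y))).
  by apply/rowP => i; rewrite !mxE; ring.
apply: le_trans (ler_normD _ _) _; have := ler_normD (a x - a y - La (x - y)) (b x - b y - Lb (x - y)).
have : e1 * `|x - y| <= e / 4 * `|x - y| by rewrite ler_wpM2r.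
clear -H Hx Hy; lra.
Qed.

Definition exp_product (ls : seq (E -> E)) (X : E) : E :=
  foldr (fun l acc => chart_mul (l X) acc) 0 ls.

Lemma exp_product_strict_diff (ls : seq {linear E -> E}) :
  strict_diff (exp_product (map (fun l : {linear E -> E} => l : E -> E) ls))
    (fun X => \sum_(l <- ls) l X) 0 /\
  exp_product (map (fun l : {linear E -> E} => l : E -> E) ls) 0 = 0 /\
  exists2 C : R, 0 <= C & forall X, `|\sum_(l <- ls) l X| <= C * `|X|.
Proof.
elim: ls => [|l ls [IH [IH0 [C C0 HC]]]].
  split; last first.
    by split=> //; exists 0 => // X; rewrite big_nil normr0 mul0r.
  by move=> e e0; exists 1 => // x y _ _; rewrite /= subrr big_nil subr0 normr0 mulr_ge0 // ltW.
have [Cl Cl0 HCl] := linear_bound l.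
split; last split.
- have -> : (fun X => \sum_(l0 <- l :: ls) l0 X) = fun X => l X + \sum_(l0 <- ls) l0 X.
    by apply/funext => X; rewrite big_cons.
  apply: (@strict_diff_chart_mul l _ l _ (Cl + C)) => //.
  + exact: linear0.
  + by rewrite addr_ge0.
  + by move=> x; apply: le_trans (HCl x) _; rewrite ler_wpM2r // lerDl.
  + by move=> x; apply: le_trans (HC x) _; rewrite ler_wpM2r // lerDr.
  + by move=> e e0; exists 1 => // x y _ _; rewrite -linearB subrr normr0 mulr_ge0 // ltW.
- by rewrite /= IH0 chart_mulX0 linear0.
exists (Cl + C); first by rewrite addr_ge0.
move=> X; rewrite big_cons mulrDl; apply: le_trans (ler_normD _ _) _.
by rewrite lerD.
Qed.

End ProductsOfCurves.

Section HomogeneousNorm.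
Context {R : realType} (G : stratifiedGroup R) (d : G -> G -> R).
Hypothesis hd : homogeneous_distance d.
Local Notation E := 'rV[R]_(lie_dim G).
Local Notation exp := (lie_exp G).
Local Notation log := (lie_log G).
Local Notation N g := (d 1%g g).
Implicit Types (g h : G) (X Y Z : E).

Lemma hdistE g h : d g h = N (g^-1 * h)%g.
Proof. by rewrite -(hdist_left_inv hd g^-1%g g h) mulVg. Qed.

Lemma hnorm1 : N 1%g = 0.
Proof. exact/(hdist_eq0 hd). Qed.

Lemma hnorm_ge0 g : 0 <= N g.
Proof. exact: (hdist_ge0 hd). Qed.

Lemma hnormV g : N g^-1%g = N g.
Proof. by rewrite (hdist_sym hd) hdistE invgK mulg1. Qed.

Lemma hnormM g h : N (g * h)%g <= N g + N h.
Proof.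
apply: le_trans (hdist_triangle hd _ g _) _.
by rewrite [d g (g * h)%g]hdistE mulKg.
Qed.

Lemma dilation1 (a : R) : dilation a 1%g = 1%g :> G.
Proof.
rewrite /dilation log1 big1 ?exp0 // => k _.
by rewrite /layer_proj linear0 scaler0.
Qed.

Lemma hnorm_dilation (a : R) g : 0 < a -> N (dilation a g) = a * N g.
Proof. by move=> a0; rewrite -{1}(dilation1 a) (hdist_dilation hd). Qed.

Lemma layer_proj_sum X : \sum_(k < step G) layer_proj k X = X.
Proof.
have Xin : X \in (\sum_(i < step G) layer G i.+1)%VS by rewrite layer_sum memvf.
by rewrite /layer_proj (sumv_pi_sum (erefl _)).
Qed.

Lemma layer_proj_in (k : 'I_(step G)) X : layer_proj k X \in layer G k.+1.
Proof. exact: memv_sum_pi. Qed.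

Lemma dilation_layer (a : R) (k : 'I_(step G)) X : X \in layer G k.+1 ->
  dilation a (exp X) = exp (a ^+ k.+1 *: X).
Proof.
move=> Xk; pose F (j : 'I_(step G)) := if j == k then X else 0.
have -> : X = \sum_j F j.
  rewrite (bigD1 k) //= /F eqxx big1 ?addr0 // => j /negPf -> //.
rewrite dilation_exp; last first.
  by move=> j; rewrite /F; case: eqP => [->//|_]; exact: mem0v.
by congr exp; rewrite scaler_sumr; apply: eq_bigr => j _; rewrite /F; case: eqP => [->//|_]; rewrite !scaler0.
Qed.

(** On the line spanned by a vector of the [(k+1)]-st layer the norm is
    homogeneous of degree [1 / (k+1)]. *)
Lemma hnorm_layer_small (k : 'I_(step G)) X : X \in layer G k.+1 ->
  forall e : R, 0 < e -> exists2 dl : R, 0 < dl & forall t : R, `|t| < dl -> N (exp (t *: X)) < e.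
Proof.
move=> Xk e e0; pose c := N (exp X) + 1.
have c0 : 0 < c by rewrite /c; have := hnorm_ge0 (exp X); lra.
have ec : 0 < e / c by rewrite divr_gt0.
exists ((e / c) ^+ k.+1); first by rewrite exprn_gt0.
have pos t : 0 < t -> t < (e / c) ^+ k.+1 -> N (exp (t *: X)) < e.
  move=> t0 te; pose a := t `^ (k.+1%:R^-1).
  have a0 : 0 < a by rewrite powR_gt0.
  have at_ : a ^+ k.+1 = t.
    by rewrite -powR_mulrn ?ltW // -powRrM mulVf ?powRr1 ?ltW // pnatr_eq0.
  have ae : a < e / c.
    by rewrite -(ltr_pXn2r (n := k.+1)) ?nnegrE ?ltW // at_.
  rewrite -at_ -(dilation_layer a Xk) hnorm_dilation //.
  apply: le_lt_trans (_ : a * c < _); first by rewrite ler_pM2l // /c; lra.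
  by rewrite -ltr_pdivlMr.
move=> t tl; have [t0|t0|->] := ltgtP t 0.
- rewrite -hnormV -expN -scaleNr; apply: pos; first by lra.
  by rewrite -(ltr0_norm t0).
- by apply: pos; rewrite // -(gtr0_norm t0).
- by rewrite scale0r exp0 hnorm1.
Qed.

(** Small elements are products of small elements of the curves
    [t |-> exp (t v)], [v] in a layer: the product map is tangent to the
    identity, hence locally surjective. *)
Theorem hnorm_small (e : R) : 0 < e ->
  exists2 dl : R, 0 < dl & forall X, `|X| < dl -> N (exp X) < e.
Proof.
move=> e0.
(* One curve for each component [v j] of each vector of the standard basis: a
   basis adapted to the layers is thus avoided. *)
pose I := ('I_(lie_dim G) * 'I_(step G))%type.
pose v (j : I) : E := layer_proj j.2 (delta_mx 0 j.1).
pose lf (j : I) (X : E) : E := X 0 j.1 *: v j.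
have lin j : linear (lf j) by move=> a X Y; rewrite /lf !mxE scalerDl scalerA.
pose l (j : I) : {linear E -> E} :=
  HB.pack_for {linear E -> E} (lf j) (GRing.isLinear.Build R E E *:%R (lf j) (lin j)).
pose ls := [seq l j | j <- index_enum I].
have [SD [P0 _]] := exp_product_strict_diff ls.
set P := exp_product _ in SD P0.
have sumE : (fun X => \sum_(l <- ls) l X) = id.
  apply/funext => X; rewrite big_map /= {2}(row_sum_delta X).
  rewrite -(pair_bigA _ (fun i k => X 0 i *: layer_proj k (delta_mx 0 i))) /=.
  by apply: eq_bigr => i _; rewrite -scaler_sumr layer_proj_sum.
rewrite sumE in SD.
have [r r0 surj] := strict_diff_id_surj P0 SD.
have Pbound X : N (exp (P X)) <= \sum_j N (exp (X 0 j.1 *: v j)).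
  rewrite /P /ls -map_comp; elim: (index_enum I) => [|j js IH].
    by rewrite big_nil /= exp0 hnorm1.
  by rewrite big_cons /= exp_mul; apply: le_trans (hnormM _ _) _; rewrite lerD2l.
pose m := #|{: I}|.+1%:R : R; have m0 : 0 < m by [].
have em : 0 < e / m by rewrite divr_gt0.
have [dl dl0 Hdl] : exists2 dl : R, 0 < dl & forall j (t : R), `|t| < dl -> N (exp (t *: v j)) < e / m.
  have H j := hnorm_layer_small (layer_proj_in j.2 (delta_mx 0 j.1)) em.
  pose D j := s2val (cid2 (H j)).
  exists (\big[Num.min/1]_j D j).
    by apply: lt_bigmin => // j _; rewrite /D; case: cid2.
  move=> j t tD; have : `|t| < D j by apply: lt_le_trans tD _; exact: bigmin_le_cond.
  by rewrite /D; case: cid2 => /= ? ? ; apply.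
exists (Num.min r (dl / 2)); first by rewrite lt_min r0 divr_gt0.
move=> Y; rewrite lt_min => /andP[Yr Yd].
have [X XY <-] := surj Y Yr.
apply: le_lt_trans (Pbound X) _.
apply: le_lt_trans (_ : \sum_(j : I) (e / m) < _).
  apply: ler_sum => j _; apply/ltW/Hdl; apply: le_lt_trans (row_norm_ge _ _) _.
  by apply: le_lt_trans XY _; lra.
rewrite sumr_const -[X in X < _]mulr_natr mulrAC ltr_pdivrMr // ltr_pM2l //.
by rewrite ltr_nat.
Qed.

End HomogeneousNorm.

(** * The group law in step two *)

Section StepTwo.
Context {R : realType} (G : stratifiedGroup R).
Hypothesis step2 : step G = 2%N.
Local Notation E := 'rV[R]_(lie_dim G).
Local Notation exp := (lie_exp G).
Local Notation log := (lie_log G).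
Local Notation "X ** Y" := (@chart_mul R G X Y) (at level 40, left associativity).
Implicit Types (g h : G) (X Y Z : E).

Lemma layer_proj_unique (F : 'I_(step G) -> E) (j : 'I_(step G)) :
  (forall k, F k \in layer G k.+1) -> layer_proj j (\sum_k F k) = F j.
Proof.
move=> FV; set Y := \sum_k F k.
have /eqP : Y = \sum_(k < step G) layer_proj k Y by rewrite layer_proj_sum.
rewrite (directv_sum_unique (layer_direct G)) //; last by move=> k _; exact: layer_proj_in.
by move=> /forall_inP XY; rewrite (eqP (XY j _)).
Qed.

Definition hproj : E -> E := layer_proj (Ordinal (step_gt0 G)).

Lemma hproj_is_linear : linear hproj.
Proof. by move=> a X Y; rewrite /hproj /layer_proj linearP. Qed.

HB.instance Definition _ := GRing.isLinear.Build R E E *:%R hproj hproj_is_linear.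

Lemma hproj_in X : hproj X \in layer G 1.
Proof. exact: layer_proj_in. Qed.

Lemma hproj_id X : X \in layer G 1 -> hproj X = X.
Proof.
move=> X1; pose F (k : 'I_(step G)) := if k == Ordinal (step_gt0 G) then X else 0.
have {1}-> : X = \sum_k F k.
  by rewrite (bigD1 (Ordinal (step_gt0 G))) //= /F eqxx big1 ?addr0 // => k /negPf ->.
rewrite /hproj layer_proj_unique /F ?eqxx // => k.
by case: eqP => [->//|_]; exact: mem0v.
Qed.

Lemma step2_ord1 : (1 < step G)%N. Proof. by rewrite step2. Qed.

Lemma hproj_layer2 X : X \in layer G 2 -> hproj X = 0.
Proof.
move=> X2; pose F (k : 'I_(step G)) := if k == Ordinal step2_ord1 then X else 0.
have {1}-> : X = \sum_k F k.
  by rewrite (bigD1 (Ordinal step2_ord1)) //= /F eqxx big1 ?addr0 // => k /negPf ->.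
rewrite /hproj layer_proj_unique /F //= => k.
by case: eqP => [->//|_]; exact: mem0v.
Qed.

Lemma ord_step2 (k : 'I_(step G)) :
  k != Ordinal (step_gt0 G) -> k = Ordinal step2_ord1.
Proof.
case: k => m mlt k0; apply/val_inj => /=; have := mlt; rewrite step2.
by have : m != 0%N by []; case: m {mlt k0} => [//|[|[]]].
Qed.

Lemma vproj_in X : X - hproj X \in layer G 2.
Proof.
rewrite -{1}(layer_proj_sum X) (bigD1 (Ordinal (step_gt0 G))) //= addrAC subrr add0r.
by apply: memv_suml => k /ord_step2 ->; exact: layer_proj_in.
Qed.

Lemma dilation_exp2 (a : R) X :
  dilation a (exp X) = exp (a *: hproj X + a ^+ 2 *: (X - hproj X)).
Proof.
pose F (k : 'I_(step G)) := if k == Ordinal (step_gt0 G) then hproj X else X - hproj X.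
have FV k : F k \in layer G k.+1.
  rewrite /F; case: ifPn => [/eqP ->|/ord_step2 ->]; [exact: hproj_in | exact: vproj_in].
have sumF (c : 'I_(step G) -> R) : \sum_k c k *: F k =
    c (Ordinal (step_gt0 G)) *: hproj X + c (Ordinal step2_ord1) *: (X - hproj X).
  rewrite (bigD1 (Ordinal (step_gt0 G))) //= {1}/F eqxx (bigD1 (Ordinal step2_ord1)) //= /F /=.
  by rewrite big1 ?addr0 // => k /andP[/ord_step2 ->]; rewrite eqxx.
have XE : X = \sum_k F k.
  under eq_bigr do rewrite -[F _]scale1r.
  by rewrite (sumF (fun=> 1)) !scale1r addrC subrK.
by rewrite {1}XE dilation_exp // sumF.
Qed.

Lemma bracket_layer11 X Y : X \in layer G 1 -> Y \in layer G 1 ->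
  lie_bracket X Y \in layer G 2.
Proof.
move=> X1 Y1; have [|H _] := layer_bracket (s := G) (k := 1%N); last exact: H.
by rewrite step2.
Qed.

Lemma bracket_layer12 X Z : X \in layer G 1 -> Z \in layer G 2 -> lie_bracket X Z = 0.
Proof.
move=> X1 Z2; have [|H _] := layer_bracket (s := G) (k := 2%N); first by rewrite step2.
by have := H X Z X1 Z2; have := layer_stepS G; rewrite step2 => ->; rewrite memv0 => /eqP.
Qed.

(** The second layer is central: the centralizer of [exp Z] is a closed subgroup,
    and it contains the first layer because [[V_1, V_2] = 0]. *)
Lemma layer2_conj g Z : Z \in layer G 2 -> chart_conj g Z = Z.
Proof.
move=> Z2; move: g; apply: closed_subgroup_full; last first.
  move=> X X1; have := @conj_flow_formula R G 1 X Z (bracket_layer12 X1 Z2) 1.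
  by rewrite big_ord1 scale1r expr0 divr1 scale1r.
split.
- exact: chart_conj1.
- by move=> g h gZ hZ; rewrite chart_conjM hZ gZ.
- by move=> g gZ; rewrite -{1}gZ -chart_conjM mulVg chart_conj1.
move=> u g uZ ug.
pose f X := X ** Z ** - X.
have fc : continuous f.
  move=> X; apply: differentiable_continuous; rewrite /f.
  by apply: differentiable_chart_mul; [apply: differentiable_chart_mul | apply: differentiableN].
have H : f (log (u k)) @[k --> \oo] --> f (log g) by apply: continuous_cvg => //; exact: fc.
rewrite chart_conjE -/(f _); apply/esym/(cvg_unique _ _ H) => //.
have -> : (fun k => f (log (u k))) = fun=> Z.
  by apply/funext => k; rewrite /f -chart_conjE uZ.
exact: cvg_cst.
Qed.

Lemma layer2_commute X Z : Z \in layer G 2 -> (exp X * exp Z = exp Z * exp X)%g.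
Proof.
move=> Z2; have := exp_conj (exp X) Z; rewrite layer2_conj // => {2}->.
by rewrite mulgVK.
Qed.

(** The way in which the Trotter formula is used: identify the limit of an
    explicit sequence. *)
Lemma trotter_limit X Y W (c : nat -> R) (l : R) (V : E) : c k @[k --> \oo] --> l ->
  (forall k, k.+1%:R *: ((k.+1%:R^-1 *: X) ** (k.+1%:R^-1 *: Y)) = W + c k *: V) ->
  W + l *: V = X + Y.
Proof.
move=> cl H; have T := @trotter R G X Y.
have H2 : W + c k *: V @[k --> \oo] --> W + l *: V.
  by apply: cvgD; [exact: cvg_cst | apply: cvgZ => //; exact: cvg_cst].
apply: (cvg_unique _ H2) => //.
by have -> : (fun k => W + c k *: V) = _ := esym (funext H).
Qed.

Lemma chart_mul_layer2 X Z : Z \in layer G 2 -> X ** Z = X + Z.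
Proof.
move=> Z2; have := @trotter_limit X Z (X ** Z) (fun=> 0) 0 0 (@cvg_cst _ _ _ _ _).
rewrite scaler0 addr0 => -> // k; rewrite ?scaler0 ?addr0.
apply: (can_inj (lie_expK (l := G))); rewrite exp_natmul !exp_mul expgMn; last first.
  by apply: layer2_commute; exact: memvZ.
by rewrite -!exp_natmul !scalerA divff ?pnatr_eq0 // !scale1r.
Qed.

Lemma conj_layer1 X Y : X \in layer G 1 -> Y \in layer G 1 ->
  chart_conj (exp X) Y = Y + lie_bracket X Y.
Proof.
move=> X1 Y1; have XY2 := bracket_layer11 X1 Y1.
have := @conj_flow_formula R G 2 X Y _ 1.
rewrite /= bracket_layer12 // => /(_ erefl); rewrite scale1r => ->.
by rewrite !big_ord_recr big_ord0 /= add0r expr0 expr1 divr1 !scale1r.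
Qed.

Lemma layer1_commutator X Y : X \in layer G 1 -> Y \in layer G 1 ->
  (exp X * exp Y = exp Y * exp X * exp (lie_bracket X Y))%g.
Proof.
move=> X1 Y1; have XY2 := bracket_layer11 X1 Y1.
have := exp_conj (exp X) Y; rewrite conj_layer1 // -chart_mul_layer2 // exp_mul.
move=> /(congr1 (fun g => g * exp X)%g); rewrite mulgVK => <-.
by rewrite -!mulgA; congr (_ * _)%g; exact: esym (layer2_commute X XY2).
Qed.

Lemma bracketZr X (a : R) Y : X \in layer G 1 -> Y \in layer G 1 ->
  lie_bracket X (a *: Y) = a *: lie_bracket X Y.
Proof.
move=> X1 Y1; apply: (addrI (a *: Y)).
by rewrite -conj_layer1 ?memvZ // linearZ /= conj_layer1 // scalerDr.
Qed.

Lemma bracketDr X Y Z : X \in layer G 1 -> Y \in layer G 1 -> Z \in layer G 1 ->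
  lie_bracket X (Y + Z) = lie_bracket X Y + lie_bracket X Z.
Proof.
move=> X1 Y1 Z1; apply: (addrI (Y + Z)).
by rewrite -conj_layer1 ?memvD // linearD /= !conj_layer1 // addrACA.
Qed.

Lemma bracketC X Y : X \in layer G 1 -> Y \in layer G 1 ->
  lie_bracket X Y = - lie_bracket Y X.
Proof.
move=> X1 Y1; apply/eqP; rewrite -addr_eq0; apply/eqP.
rewrite addrC -chart_mul_layer2 ?bracket_layer11 // /chart_mul.
have := layer1_commutator X1 Y1; rewrite [(exp Y * exp X)%g]layer1_commutator // -!mulgA.
move=> /(congr1 (fun g => (exp Y)^-1 * ((exp X)^-1 * g))%g).
by rewrite !mulKg mulVg => <-; rewrite log1.
Qed.

Lemma bracketZl X (a : R) Y : X \in layer G 1 -> Y \in layer G 1 ->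
  lie_bracket (a *: X) Y = a *: lie_bracket X Y.
Proof.
by move=> X1 Y1; rewrite bracketC ?memvZ // bracketZr // [lie_bracket Y X]bracketC // scalerN opprK.
Qed.

Lemma expM_commutator (x y w : G) m : (y * x = x * y * w)%g ->
  (forall g, g * w = w * g)%g -> ((x * y) ^+ m = x ^+ m * y ^+ m * w ^+ 'C(m, 2))%g.
Proof.
move=> yx wc; have wcn k g : (g * w ^+ k = w ^+ k * g)%g.
  by elim: k => [|k IH]; rewrite ?expg0 ?mulg1 ?mul1g // expgS mulgA wc -!mulgA IH.
have yxm k : (y ^+ k * x = x * y ^+ k * w ^+ k)%g.
  elim: k => [|k IH]; first by rewrite !expg0 !mul1g !mulg1.
  by rewrite expgS -mulgA IH !mulgA yx -!mulgA; congr (_ * (_ * _))%g; rewrite mulgA -wc -mulgA -expgS.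
elim: m => [|m IH]; first by rewrite !expg0 !mulg1.
rewrite expgSr IH binS bin1 addnC expgnDr -!mulgA.
rewrite expgSr -!mulgA; congr (_ * _)%g.
rewrite [(w ^+ _ * (x * y))%g](_ : _ = x * y * w ^+ 'C(m, 2))%g; last by rewrite wcn.
rewrite !mulgA yxm [(y ^+ m.+1)%g]expgSr -!mulgA; congr (_ * (_ * _))%g.
by rewrite !mulgA -wcn.
Qed.

(** Baker-Campbell-Hausdorff formula. Reordering [(exp (X / m) exp (Y / m)) ^ m]
    creates ['C(m, 2)] commutators, each of size [m ^- 2], whence the limit [1 / 2];
    on the other hand this power converges to [exp (X + Y)]. *)
Lemma chart_mul_layer1 X Y : X \in layer G 1 -> Y \in layer G 1 ->
  X ** Y = X + Y + 2^-1 *: lie_bracket X Y.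
Proof.
move=> X1 Y1; have XY2 := bracket_layer11 X1 Y1.
pose c k : R := - ('C(k.+1, 2)%:R / k.+1%:R ^+ 2).
have cl : c k @[k --> \oo] --> (- 2^-1 : R).
  have -> : c = fun k => - 2^-1 + 2^-1 * harmonic k.
    apply/funext => k; rewrite /c /harmonic /=.
    have k0 : (k%:R + 1 : R) != 0 by rewrite natr1 pnatr_eq0.
    have : 2 * 'C(k.+1, 2)%:R = (k%:R + 1) * k%:R :> R.
      by rewrite natr1 -!natrM -mul_bin_diag /= bin1.
    rewrite -natr1 => H; have -> : 'C(k.+1, 2)%:R = (k%:R + 1) * k%:R / 2 :> R.
      by rewrite -H mulrC mulKf ?pnatr_eq0.
    by field.
  rewrite -[X in _ --> X]addr0 -[X in _ + X](mulr0 2^-1).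
  by apply: cvgD; [exact: cvg_cst | apply: cvgM; [exact: cvg_cst | exact: cvg_harmonic]].
have H k : k.+1%:R *: ((k.+1%:R^-1 *: X) ** (k.+1%:R^-1 *: Y)) = X ** Y + c k *: lie_bracket X Y.
  have m0 : (k.+1%:R : R) != 0 by rewrite pnatr_eq0.
  rewrite -chart_mul_layer2 ?memvZ //.
  apply: (can_inj (lie_expK (l := G))); rewrite exp_natmul !exp_mul.
  rewrite (@expM_commutator _ _ (exp (- (k.+1%:R^-1 ^+ 2) *: lie_bracket X Y))).
  - rewrite -!exp_natmul !scalerA divff // !scale1r; congr (_ * exp (_ *: _))%g.
    by rewrite /c mulrN exprVn.
  - rewrite layer1_commutator ?memvZ //; congr (_ * exp _)%g.
    by rewrite bracketZl ?bracketZr ?memvZ // [lie_bracket Y X]bracketC // scalerA -expr2 scalerN scaleNr.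
  - by move=> g; rewrite -[g](lie_logK (l := G)) layer2_commute // memvZ.
by rewrite -(trotter_limit cl H) -addrA -scalerDl addNr scale0r addr0.
Qed.

(** The quadratic part of the group law. *)
Definition half_bracket X Y : E := 2^-1 *: lie_bracket (hproj X) (hproj Y).

Lemma chart_mul_step2 X Y : X ** Y = X + Y + half_bracket X Y.
Proof.
have split Z : exp Z = (exp (hproj Z) * exp (Z - hproj Z))%g.
  by rewrite -exp_mul chart_mul_layer2 ?vproj_in // addrC subrK.
have hb : half_bracket X Y \in layer G 2 by rewrite memvZ // bracket_layer11 ?hproj_in.
apply: (can_inj (lie_expK (l := G))); rewrite exp_mul [exp X]split [exp Y]split.
move: (vproj_in X) (vproj_in Y) (hproj_in X) (hproj_in Y) hb.
rewrite /half_bracket; set a := hproj X; set b := hproj Y.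
set z := X - a; set w := Y - b => z2 w2 a1 b1 ab2.
rewrite -(mulgA (exp a)) (mulgA (exp z)) -(layer2_commute b z2) -(mulgA (exp b)) (mulgA (exp a)).
rewrite -(exp_mul a b) -(exp_mul z w) -(exp_mul (a ** b) (z ** w)); congr exp.
rewrite (chart_mul_layer2 z w2) (chart_mul_layer2 (a ** b) (memvD z2 w2)).
rewrite chart_mul_layer1 // /z /w.
by move: (2^-1 *: _) => V; apply/rowP => i; rewrite !mxE; ring.
Qed.

End StepTwo.

(** * Homogeneous norms on step two groups *)

Section StepTwoNorm.
Context {R : realType} {n : nat}.
Local Notation E := 'rV[R]_n.

(** A homogeneous norm [N] on the step two group with underlying space [E] and
    product [x + y + om x y], where [P] projects onto the first layer along the
    second. *)
Record step2_norm (P : {linear E -> E}) (om : E -> E -> E) (N : E -> R) : Prop := Step2Norm {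
  s2_PP : forall x, P (P x) = P x;
  s2_omD : forall x y z, om x (y + z) = om x y + om x z;
  s2_omZ : forall a x y, om x (a *: y) = a *: om x y;
  s2_omC : forall x y, om x y = - om y x;
  s2_omP : forall x y, om x (P y) = om x y;
  s2_Pom : forall x y, P (om x y) = 0;
  s2_ge0 : forall x, 0 <= N x;
  s2_eq0 : forall x, N x = 0 -> x = 0;
  s2_N : forall x, N (- x) = N x;
  s2_D : forall x y, N (x + y + om x y) <= N x + N y;
  s2_dil : forall (a : R) x, 0 < a -> N (a *: P x + a ^+ 2 *: (x - P x)) = a * N x
}.

Context {P : {linear E -> E}} {om : E -> E -> E} {N : E -> R}.
Hypothesis H : step2_norm P om N.
Implicit Types x y z : E.

Lemma omDl x y z : om (x + y) z = om x z + om y z.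
Proof. by rewrite !(s2_omC H _ z) (s2_omD H) opprD. Qed.

Lemma omZl a x z : om (a *: x) z = a *: om x z.
Proof. by rewrite !(s2_omC H _ z) (s2_omZ H) scalerN. Qed.

Lemma omNl x z : om (- x) z = - om x z.
Proof. by rewrite -scaleN1r omZl scaleN1r. Qed.

Lemma omNr x z : om x (- z) = - om x z.
Proof. by rewrite -scaleN1r (s2_omZ H) scaleN1r. Qed.

Lemma om0r x : om x 0 = 0.
Proof. by have := s2_omZ H 0 x 0; rewrite !scale0r. Qed.

Lemma om0l x : om 0 x = 0.
Proof. by rewrite (s2_omC H) om0r oppr0. Qed.

Lemma omxx x : om x x = 0.
Proof.
have /eqP := s2_omC H x x; rewrite -addr_eq0 -mulr2n -scaler_nat scaler_eq0 pnatr_eq0 /=.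
by move/eqP.
Qed.

Lemma omPl x y : om (P x) y = om x y.
Proof. by rewrite !(s2_omC H _ y) (s2_omP H). Qed.

Lemma om_vr x z : P z = 0 -> om x z = 0.
Proof. by move=> Pz; rewrite -(s2_omP H) Pz om0r. Qed.

Lemma om_vl x z : P z = 0 -> om z x = 0.
Proof. by move=> Pz; rewrite (s2_omC H) om_vr ?oppr0. Qed.

Lemma Pvert x : P (x - P x) = 0.
Proof. by rewrite linearB /= (s2_PP H) subrr. Qed.

Lemma N0 : N 0 = 0.
Proof.
have := s2_dil H 0 (ltr0Sn R 1); rewrite linear0 subr0 !scaler0 addr0 => /eqP.
by rewrite -subr_eq0 -[X in X - _]mul1r -mulrBl mulf_eq0 => /orP[|/eqP//]; rewrite subr_eq0 => /eqP; lra.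
Qed.

Lemma N_vD x z : P z = 0 -> N (x + z) <= N x + N z.
Proof. by move=> Pz; have := s2_D H x z; rewrite om_vr ?addr0. Qed.

Lemma N_dilv (a : R) z : P z = 0 -> 0 < a -> N (a ^+ 2 *: z) = a * N z.
Proof. by move=> Pz a0; have := s2_dil H z a0; rewrite Pz scaler0 add0r subr0. Qed.

Lemma N_vZ (a : R) z : P z = 0 -> N (a *: z) = Num.sqrt `|a| * N z.
Proof.
move=> Pz; have pos b : 0 < b -> N (b *: z) = Num.sqrt `|b| * N z.
  move=> b0; rewrite -{1}(sqr_sqrtr (ltW b0)) N_dilv ?sqrtr_gt0 //.
  by rewrite gtr0_norm.
have [a0|a0|->] := ltgtP a 0; last by rewrite scale0r normr0 sqrtr0 mul0r N0.
  by rewrite -(s2_N H) -scaleNr pos ?oppr_gt0 // normrN.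
exact: pos.
Qed.

Lemma N_hZ (a : R) x : P x = x -> N (a *: x) = `|a| * N x.
Proof.
move=> Px; have pos b : 0 < b -> N (b *: x) = `|b| * N x.
  by move=> b0; have := s2_dil H x b0; rewrite Px subrr scaler0 addr0 gtr0_norm.
have [a0|a0|->] := ltgtP a 0; last by rewrite scale0r normr0 mul0r N0.
  by rewrite -(s2_N H) -scaleNr pos ?oppr_gt0 // normrN.
exact: pos.
Qed.

Lemma N_natmul k x : N (k%:R *: x) <= k%:R * N x.
Proof.
elim: k => [|k IH]; first by rewrite scale0r N0 mul0r.
have := s2_D H (k%:R *: x) x; rewrite omZl omxx scaler0 addr0 -natr1 scalerDl mulrDl.
by rewrite scale1r mul1r => /le_trans; apply; rewrite lerD2r.
Qed.

(** The [k]-th power of [x] has norm at most [k * N x]; rescaled by [1 / k] it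
    has first layer component [P x] and second layer component of order [1 / k]. *)
Lemma N_horiz_le x : N (P x) <= N x.
Proof.
apply/ler_addgt0Pr => e e0.
set z := x - P x; have Pz : P z = 0 by exact: Pvert.
have [k kz] : exists k : nat, (N z / e) ^+ 2 < k.+1%:R.
  exists (Num.truncn ((N z / e) ^+ 2)); exact: truncnS_gt.
have k0 : (0 : R) < k.+1%:R by [].
have ki : (0 : R) < k.+1%:R^-1 by rewrite invr_gt0.
have A : N (P x + k.+1%:R^-1 *: z) <= N x.
  have := s2_dil H (k.+1%:R *: x) ki; rewrite linearZ /= scalerA mulVf ?gt_eqF // scale1r.
  rewrite -scalerBr scalerA expr2 -mulrA mulVf ?gt_eqF // mulr1 => ->.
  by rewrite ler_pdivrMl // N_natmul.
have B : N (- (k.+1%:R^-1 *: z)) <= e.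
  rewrite (s2_N H) N_vZ // gtr0_norm // sqrtrV ?(ltW k0) // ler_pdivrMl ?sqrtr_gt0 //.
  rewrite -ler_pdivrMr //; apply: le_trans (ler_norm _) _.
  by rewrite -sqrtr_sqr ler_sqrt ?(ltW kz) // ltW.
have := @N_vD (P x + k.+1%:R^-1 *: z) (- (k.+1%:R^-1 *: z)).
rewrite addrK linearN linearZ /= Pz scaler0 oppr0 => /(_ erefl); lra.
Qed.

Lemma N_hD x y : P x = x -> P y = y -> N (x + y) <= N x + N y.
Proof.
move=> Px Py; apply: le_trans (s2_D H x y).
have := N_horiz_le (x + y + om x y).
by rewrite !linearD /= Px Py (s2_Pom H) addr0.
Qed.

Lemma N_hB x y : P x = x -> P y = y -> N (x - y) <= N x + N y.
Proof. by move=> Px Py; rewrite -(s2_N H y) N_hD // linearN /= Py. Qed.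

Lemma N_hsum (I : Type) (r : seq I) (F : I -> E) : (forall i, P (F i) = F i) ->
  N (\sum_(i <- r) F i) <= \sum_(i <- r) N (F i).
Proof.
move=> PF; elim: r => [|i r IH]; first by rewrite !big_nil N0.
rewrite !big_cons; apply: le_trans (N_hD _ _) _; rewrite ?PF ?lerD2l //.
by rewrite linear_sum; apply: eq_bigr => j _; rewrite PF.
Qed.

Lemma N_vsum (I : Type) (r : seq I) (F : I -> E) : (forall i, P (F i) = 0) ->
  N (\sum_(i <- r) F i) <= \sum_(i <- r) N (F i).
Proof.
move=> PF; elim: r => [|i r IH]; first by rewrite !big_nil N0.
rewrite !big_cons; apply: le_trans (N_vD _ _) _; rewrite ?lerD2l //.
by rewrite linear_sum big1.
Qed.

Lemma om_bound : exists2 K : R, 0 <= K & forall x y, `|om x y| <= K * `|x| * `|y|.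
Proof.
have lin y : linear (om^~ y) by move=> a u v; rewrite omDl omZl.
pose l y : {linear E -> E} :=
  HB.pack_for {linear E -> E} (om^~ y) (GRing.isLinear.Build R E E *:%R (om^~ y) (lin y)).
pose b y := s2val (cid2 (linear_bound (l y))).
have b0 y : 0 <= b y by rewrite /b; case: cid2.
have bE x y : `|om x y| <= b y * `|x|.
  by rewrite /b; case: cid2 => /= C _ /(_ x).
exists (\sum_i b (delta_mx 0 i)); first exact: sumr_ge0.
move=> x y; have -> : om x y = \sum_i y 0 i *: om x (delta_mx 0 i).
  rewrite {1}(row_sum_delta y) (big_morph (om x) (s2_omD H x) (om0r x)).
  by apply: eq_bigr => i _; rewrite (s2_omZ H).
rewrite -mulrA mulr_suml; apply: le_trans (ler_norm_sum _ _ _) _.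
apply: ler_sum => i _; rewrite normrZ mulrC [`|x| * _]mulrC.
rewrite [leRHS]mulrCA [leRHS]mulrC.
by rewrite ler_pM // ?row_norm_ge.
Qed.

Lemma N_upper : exists2 K : R, 0 <= K &
  forall x, N x <= K * (`|P x| + Num.sqrt `|x - P x|).
Proof.
pose a := \sum_i N (P (delta_mx 0 i)); pose b := \sum_i N (delta_mx 0 i - P (delta_mx 0 i)).
have a0 : 0 <= a by apply: sumr_ge0 => i _; exact: (s2_ge0 H).
have b0 : 0 <= b by apply: sumr_ge0 => i _; exact: (s2_ge0 H).
have hor x : N (P x) <= a * `|P x|.
  have {1}-> : P x = \sum_i (P x) 0 i *: P (delta_mx 0 i).
    rewrite -{1}(s2_PP H) {1}(row_sum_delta (P x)) linear_sum.
    by apply: eq_bigr => i _; rewrite linearZ.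
  apply: le_trans (N_hsum _ _) _; first by move=> i; rewrite linearZ /= (s2_PP H).
  rewrite mulr_suml; apply: ler_sum => i _; rewrite N_hZ ?(s2_PP H) // mulrC.
  by rewrite ler_wpM2l ?(s2_ge0 H) // row_norm_ge.
have ver x : N (x - P x) <= b * Num.sqrt `|x - P x|.
  set z := x - P x; have Pz : P z = 0 by exact: Pvert.
  have {1}-> : z = \sum_i z 0 i *: (delta_mx 0 i - P (delta_mx 0 i)).
    rewrite -[LHS]subr0 -[X in _ - X]Pz {1 2}(row_sum_delta z) linear_sum -sumrB.
    by apply: eq_bigr => i _; rewrite linearZ scalerBr.
  apply: le_trans (N_vsum _ _) _; first by move=> i; rewrite linearZ /= Pvert scaler0.
  rewrite mulr_suml; apply: ler_sum => i _; rewrite N_vZ ?Pvert // mulrC.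
  by rewrite ler_wpM2l ?(s2_ge0 H) // ler_sqrt // row_norm_ge.
exists (a + b); first exact: addr_ge0.
move=> x; rewrite -{1}[x](subrK (P x)) addrC; apply: le_trans (N_vD _ (Pvert x)) _.
apply: le_trans (lerD (hor x) (ver x)) _; rewrite mulrDr !mulrDl.
by rewrite lerD ?lerDl ?lerDr ?mulr_ge0 ?sqrtr_ge0.
Qed.

(** [N] is continuous and does not vanish on the unit sphere. *)
Lemma N_positive : exists2 c : R, 0 < c & forall x, `|x| = 1 -> c <= N x.
Proof.
have [KP KP0 HP] := linear_bound P; have [Ko Ko0 Ho] := om_bound; have [K K0 HK] := N_upper.
apply: contrapT => /forall2NP nc.
have seqk k : {x : E | `|x| = 1 & N x < k.+1%:R^-1}.
  apply: cid2; have [|] := nc k.+1%:R^-1; first by rewrite invr_gt0.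
  by move=> /existsNP[x] /not_implyP[x1 /negP]; rewrite -ltNge => xk; exists x.
pose u k := s2val (seqk k).
have u1 k : `|u k| = 1 by rewrite /u; case: (seqk k).
have uN k : N (u k) < k.+1%:R^-1 by rewrite /u; case: (seqk k).
have [l ul] : exists l, forall e : R, 0 < e -> forall k0 : nat, exists2 k, (k0 <= k)%N & `|u k - l| < e.
  by apply: (@bounded_seq_cluster _ _ u 1) => k; rewrite u1.
have l1 : `|l| = 1.
  apply/eqP; rewrite eq_le; apply/andP; split; apply/ler_addgt0Pr => e e0;
    have [k _ kl] := ul e e0 0%N; rewrite -(u1 k).
    rewrite -[l](subKr (u k)); apply: le_trans (ler_normB _ _) _; lra.
  rewrite -{1}[u k](subrK l); apply: le_trans (ler_normD _ _) _; lra.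
suff /(s2_eq0 H) l0 : N l = 0 by move: l1; rewrite l0 normr0; lra.
apply/eqP; rewrite eq_le (s2_ge0 H) andbT; apply/ler_addgt0Pr => e e0; rewrite add0r.
pose K1 := 1 + KP + Ko; have K10 : 0 < K1 by rewrite /K1; lra.
pose K2 := 1 + K; have K20 : 0 < K2 by rewrite /K2; lra.
pose f := Num.min (e / 3 / K2 / K1) ((e / 3 / K2) ^+ 2 / K1).
have e3 : 0 < e / 3 / K2 by rewrite !divr_gt0.
have f0 : 0 < f by rewrite lt_min !divr_gt0 // exprn_gt0.
have [k kk kl] := ul f f0 (Num.truncn (3 / e)).
pose y := l - u k; have yf : `|y| < f by rewrite /y distrC.
have ke : k.+1%:R^-1 < e / 3.
  rewrite -[e / 3]invrK invf_div ltf_pV2 ?posrE ?divr_gt0 //.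
  by apply: lt_le_trans (truncnS_gt _) _; rewrite ler_nat ltnS.
have -> : l = u k + (y + om y l) + om (u k) (y + om y l).
  rewrite (s2_omD H) [om (u k) (om _ _)]om_vr ?(s2_Pom H) // addr0.
  have -> : om y l = - om (u k) l by rewrite /y omDl omxx add0r omNl.
  rewrite /y (s2_omD H) omNr omxx subr0.
  by apply/rowP => i; rewrite !mxE; ring.
apply: le_trans (s2_D H _ _) _.
have yK : `|y| * K1 < e / 3 / K2 /\ `|y| * K1 < (e / 3 / K2) ^+ 2.
  by rewrite -!ltr_pdivlMr //; move: yf; rewrite lt_min => /andP.
have oy : `|om y l| <= Ko * `|y| by have := Ho y l; rewrite l1 mulr1.
have yy : N (y + om y l) <= e / 3 + e / 3.
  apply: le_trans (HK _) _; rewrite linearD /= (s2_Pom H) addr0 mulrDr.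
  have KK2 : K <= K2 by rewrite /K2; lra.
  have A : `|P y| <= e / 3 / K2.
    apply: le_trans (HP y) _; rewrite mulrC; apply: le_trans (ltW yK.1).
    by rewrite ler_wpM2l // /K1; lra.
  have B : Num.sqrt `|y + om y l - P y| <= e / 3 / K2.
    rewrite -[leRHS]gtr0_norm // -sqrtr_sqr ler_sqrt ?exprn_ge0 ?(ltW e3) //.
    apply: le_trans (ltW yK.2); rewrite /K1 !mulrDr mulr1 addrAC.
    apply: le_trans (ler_normD _ _) _; rewrite [`|y| * Ko]mulrC lerD // .
    by apply: le_trans (ler_normB _ _) _; rewrite lerD2l mulrC.
  rewrite lerD //.
    by apply: le_trans (ler_pM _ _ KK2 A) _ => //; rewrite mulrC divfK // gt_eqF.
  by apply: le_trans (ler_pM _ (sqrtr_ge0 _) KK2 B) _ => //; rewrite mulrC divfK // gt_eqF.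
have := lt_trans (uN k) ke; lra.
Qed.

(** Gathered with a single constant [K] in order to keep the later estimates
    readable. *)
Record norm_bounds (K : R) : Prop := NormBounds {
  nb_gt0 : 0 < K;
  nb_P : forall x, `|P x| <= K * `|x|;
  nb_om : forall x y, `|om x y| <= K * `|x| * `|y|;
  nb_N : forall x, N x <= K * (`|P x| + Num.sqrt `|x - P x|);
  nb_h : forall x, P x = x -> `|x| <= K * N x;
  nb_v : forall z, P z = 0 -> `|z| <= K * N z ^+ 2
}.

Lemma step2_norm_bounds : exists K : R, norm_bounds K.
Proof.
have [KP KP0 HP] := linear_bound P; have [Ko Ko0 Ho] := om_bound.
have [K K0 HK] := N_upper; have [c c0 Hc] := N_positive.
pose c1 := c^-1 + (c^-1) ^+ 2.
have ci : 0 < c^-1 by rewrite invr_gt0.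
have ci2 : 0 < c^-1 ^+ 2 by rewrite exprn_gt0.
exists (1 + KP + Ko + K + c1); rewrite /c1; split.
- by lra.
- by move=> x; apply: le_trans (HP x) _; rewrite ler_wpM2r //; lra.
- move=> x y; apply: le_trans (Ho x y) _; rewrite !ler_wpM2r //; lra.
- move=> x; apply: le_trans (HK x) _; rewrite ler_wpM2r ?addr_ge0 ?sqrtr_ge0 //; lra.
- move=> x Px; have [->|x0] := eqVneq x 0; first by rewrite normr0 N0 mulr0.
  have nx : 0 < `|x| by rewrite normr_gt0.
  have : c <= N (`|x|^-1 *: x) by apply: Hc; rewrite normrZ gtr0_norm ?invr_gt0 // mulVf // gt_eqF.
  rewrite N_hZ // gtr0_norm ?invr_gt0 // mulrC ler_pdivlMr // mulrC -ler_pdivlMr // => A.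
  apply: le_trans A _; rewrite mulrC ler_wpM2r ?(s2_ge0 H) //; lra.
move=> x Px; have [->|x0] := eqVneq x 0; first by rewrite normr0 N0 expr0n mulr0.
have nx : 0 < `|x| by rewrite normr_gt0.
have : c <= N (`|x|^-1 *: x) by apply: Hc; rewrite normrZ gtr0_norm ?invr_gt0 // mulVf // gt_eqF.
rewrite N_vZ // gtr0_norm ?invr_gt0 // sqrtrV ?(ltW nx) // mulrC ler_pdivlMr ?sqrtr_gt0 //.
rewrite mulrC -ler_pdivlMr // => A.
have : Num.sqrt `|x| ^+ 2 <= (N x / c) ^+ 2.
  by rewrite ler_pXn2r ?nnegrE ?sqrtr_ge0 ?divr_ge0 ?(s2_ge0 H) ?(ltW c0).
rewrite sqr_sqrtr ?(ltW nx) // exprMn => /le_trans; apply; rewrite mulrC ler_wpM2r ?sqr_ge0 //; lra.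
Qed.

End StepTwoNorm.
Arguments norm_bounds {R n} P om N K.

(** * Geodesic rays in step two groups *)

Section Rays.
Context {R : realType} {n : nat}.
Local Notation E := 'rV[R]_n.
Context {P : {linear E -> E}} {om : E -> E -> E} {N : E -> R}.
Hypothesis H : step2_norm P om N.
Implicit Types (x y z : E) (s t : R).

(** The group increment of the curve between the times [s] and [t]: its inverse
    at time [s] times its value at time [t]. *)
Definition inc (gamma : R -> E) s t := gamma t - gamma s - om (gamma s) (gamma t).

Definition ray (gamma : R -> E) := forall s t, 0 <= s -> 0 <= t ->
  N (inc gamma s t) = `|t - s|.

(** The errors below have the form [D * tau + L * sqrt (F * tau)], a horizontal
    error costing its size and a vertical one the square root of its size. *)
Lemma small_sqrt (D F L e : R) : 0 <= D -> 0 <= F -> 0 <= L -> 0 < e ->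
  exists2 tau : R, 0 < tau & D * tau + L * Num.sqrt (F * tau) <= e.
Proof.
move=> D0 F0 L0 e0.
pose a := e / 2 / (D + 1); pose b := (e / 2 / (L + 1)) ^+ 2 / (F + 1).
have e2 : 0 < e / 2 by lra.
have c0 : 0 < e / 2 / (L + 1) by rewrite divr_gt0 //; lra.
have a0 : 0 < a by rewrite divr_gt0 //; lra.
have b0 : 0 < b by rewrite divr_gt0 ?exprn_gt0 //; lra.
exists (Num.min a b); first by rewrite lt_min a0 b0.
set tau := Num.min a b; have ta : tau <= a by rewrite ge_min lexx.
have tb : tau <= b by rewrite ge_min lexx orbT.
have t0 : 0 < tau by rewrite lt_min a0 b0.
have A : D * tau <= e / 2.
  apply: le_trans (_ : (D + 1) * a <= _); first by rewrite ler_pM //; lra.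
  by rewrite /a mulrC divfK //; lra.
have B : Num.sqrt (F * tau) <= e / 2 / (L + 1).
  rewrite -[leRHS]gtr0_norm // -sqrtr_sqr ler_sqrt ?exprn_ge0 ?(ltW c0) //.
  apply: le_trans (_ : (F + 1) * b <= _); first by rewrite ler_pM ?(ltW t0) //; lra.
  by rewrite /b mulrC divfK //; lra.
have C : L * Num.sqrt (F * tau) <= e / 2.
  apply: le_trans (_ : (L + 1) * (e / 2 / (L + 1)) <= _); first by rewrite ler_pM ?sqrtr_ge0 //; lra.
  by rewrite mulrC divfK //; lra.
lra.
Qed.

(** A model for the quotient by [U]. *)
Lemma complement_proj (U : {vspace E}) : exists q : {linear E -> E},
  (forall z, z - q z \in U) /\ (forall z, z \in U -> q z = 0).
Proof.
have lin : linear (fun z : E => z - projv U z).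
  by move=> a x y; rewrite linearP scalerBr opprD addrACA.
exists (HB.pack_for {linear E -> E} (fun z : E => z - projv U z)
  (GRing.isLinear.Build R E E *:%R (fun z : E => z - projv U z) lin)); split=> z /=.
  by rewrite opprB addrC subrK; exact: memv_proj.
by move=> zU; rewrite projv_id // subrr.
Qed.

Lemma cluster_linear (u : nat -> E) (l : E) (f : {linear E -> E}) :
  (forall e : R, 0 < e -> forall k0 : nat, exists2 k, (k0 <= k)%N & `|u k - l| < e) ->
  (forall k, f (u k) = 0) -> f l = 0.
Proof.
move=> ul fu; have [C C0 HC] := linear_bound f.
apply/eqP; rewrite -normr_eq0 eq_le normr_ge0 andbT; apply/ler_addgt0Pr => e e0; rewrite add0r.
have C1 : 0 < C + 1 by lra.
have [k _ kl] := ul (e / (C + 1)) (divr_gt0 e0 C1) 0%N.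
rewrite -[f l]opprK -[- f l]add0r -(fu k) -linearB normrN.
apply: le_trans (HC _) _; apply: le_trans (_ : (C + 1) * (e / (C + 1)) <= _).
  by rewrite ler_pM ?(ltW kl) //; lra.
by rewrite mulrC divfK // gt_eqF.
Qed.

Lemma conj_word y a r :
  y + a + om y a + r + om (y + a + om y a) r - a
     + om (y + a + om y a + r + om (y + a + om y a) r) (- a)
  = y + r + om y r + 2 *: om a r.
Proof.
have ov x x' x'' : om (om x x') x'' = 0 by rewrite (om_vl H) ?(s2_Pom H).
rewrite (omNr H) !(omDl H) !ov (omxx H) ?(om0l H) [om r a](s2_omC H).
by apply/rowP => i; rewrite !mxE; ring.
Qed.

Context {gamma : R -> E}.
Hypothesis Hray : ray gamma.
Local Notation g := (inc gamma).

Lemma P_inc s t : P (g s t) = P (gamma t) - P (gamma s).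
Proof. by rewrite /inc !linearB /= (s2_Pom H) subr0. Qed.

Lemma om_inc x s t : om x (g s t) = om x (gamma t) - om x (gamma s).
Proof.
rewrite /inc !(s2_omD H) !(omNr H) [om x (om _ _)](om_vr H) ?(s2_Pom H) //.
by rewrite oppr0 addr0.
Qed.

Lemma incM s t u : g s u = g s t + g t u + om (g s t) (g t u).
Proof.
rewrite om_inc ![om (g s t) _](s2_omC H) !om_inc !(omxx H) /inc.
rewrite [om (gamma t) (gamma s)](s2_omC H) [om (gamma u) (gamma s)](s2_omC H).
rewrite [om (gamma u) (gamma t)](s2_omC H).
by apply/rowP => i; rewrite !mxE; ring.
Qed.

Lemma N_P_inc s t : 0 <= s -> 0 <= t -> N (P (g s t)) <= `|t - s|.
Proof. by move=> s0 t0; rewrite -Hray //; exact: (N_horiz_le H). Qed.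

Lemma N_vert_inc s t : 0 <= s -> 0 <= t -> N (g s t - P (g s t)) <= 2 * `|t - s|.
Proof.
move=> s0 t0; have := s2_D H (g s t) (- P (g s t)).
rewrite (omNr H) (s2_omP H) (omxx H) oppr0 addr0 (s2_N H) => /le_trans; apply.
by rewrite mulr_natl mulr2n lerD ?N_P_inc // Hray.
Qed.

Context {K : R}.
Hypothesis HK : norm_bounds P om N K.
Let K0 := nb_gt0 HK.
Let KP := nb_P HK.
Let Kom := nb_om HK.
Let KN := nb_N HK.
Let Kh := nb_h HK.
Let Kv := nb_v HK.

Lemma N_vert_bound z : P z = 0 -> N z <= K * Num.sqrt `|z|.
Proof. by move=> Pz; have := KN z; rewrite Pz normr0 add0r subr0. Qed.

Lemma N_horiz_bound x : P x = x -> N x <= K * `|x|.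
Proof. by move=> Px; have := KN x; rewrite Px subrr normr0 sqrtr0 addr0. Qed.

Lemma P_inc_bound s t : 0 <= s -> 0 <= t -> `|P (g s t)| <= K * `|t - s|.
Proof.
move=> s0 t0; apply: le_trans (Kh (s2_PP H _)) _.
by rewrite ler_wpM2l ?(ltW K0) // N_P_inc.
Qed.

Lemma vert_inc_bound s t : 0 <= s -> 0 <= t -> `|g s t - P (g s t)| <= 4 * K * (t - s) ^+ 2.
Proof.
move=> s0 t0; apply: le_trans (Kv (Pvert H _)) _.
rewrite [4 * K]mulrC -mulrA ler_wpM2l ?(ltW K0) // -[(t - s) ^+ 2]real_normK ?num_real //.
have -> : 4 = 2 ^+ 2 :> R by rewrite expr2; ring.
by rewrite -exprMn ler_pXn2r ?nnegrE ?(s2_ge0 H) ?mulr_ge0 // N_vert_inc.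
Qed.

(** [U] consists of vertical directions along which no increment of the ray can
    be shortened: the ray stays a ray in the quotient by [U]. *)
Definition unshortenable (U : {vspace E}) := (forall z, z \in U -> P z = 0) /\
  forall s t z, 0 <= s -> s <= t -> z \in U -> t - s <= N (g s t + z).

(** Dimensions are bounded and the zero subspace is unshortenable. *)
Lemma maximal_unshortenable : exists2 U, unshortenable U &
  forall U', unshortenable U' -> (\dim U' <= \dim U)%N.
Proof.
pose Q (d : nat) := `[< exists2 U : {vspace E}, unshortenable U & \dim U = d >].
have Q0 : exists d, Q d.
  exists 0%N; apply/asboolP; exists 0%VS; last by rewrite dimv0.
  split=> [z|s t z s0 st]; rewrite memv0 => /eqP ->; first exact: linear0.
  by rewrite addr0 Hray ?(le_trans s0) // ger0_norm // subr_ge0.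
have Qb d : Q d -> (d <= \dim {:E})%N.
  by move=> /asboolP[U _ <-]; exact: dimvS (subvf U).
case: (ex_maxnP Q0 Qb) => d /asboolP[U UU <-] maxd.
by exists U => // U' UU'; apply: maxd; apply/asboolP; exists U'.
Qed.

(** A vertical direction [W0] that is a limit of [q (om b (gamma t))] with
    [b] small can be corrected for at small cost: a vertical error [c W0]
    disappears when the far piece of the ray, up to time [t], is conjugated by
    a small multiple of [b]. *)
Lemma unshortenable_extend (U : {vspace E}) (q : {linear E -> E}) (W0 : E)
    (b : nat -> E) (T : nat -> R) :
  unshortenable U -> (forall z, z - q z \in U) -> P W0 = 0 -> q W0 = W0 ->
  (forall k, 0 <= T k) -> (forall k, `|b k| <= k.+1%:R^-1) ->
  (forall k, `|q (om (b k) (gamma (T k)))| = 1) ->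
  (forall e : R, 0 < e -> forall k0 : nat, exists2 k, (k0 <= k)%N &
     `|q (om (b k) (gamma (T k))) - W0| < e) ->
  unshortenable (U + <[W0]>)%VS.
Proof.
move=> [UP UN] qU PW0 qW0 T0 bk qb bW.
split=> [z /memv_addP[z1 z1U [_ /vlineP[c ->] ->]]|s t z s0 st].
  by rewrite linearD linearZ /= PW0 scaler0 addr0 UP.
move=> /memv_addP[z1 z1U [_ /vlineP[c ->] ->]].
have t0 : 0 <= t by exact: le_trans st.
have [Kq Kq0 Hq] := linear_bound q.
pose M := `|P (gamma 0)| + K * t.
have M0 : 0 <= M by rewrite addr_ge0 // mulr_ge0 // ltW.
have PgM tau : 0 <= tau -> tau <= t -> `|P (gamma tau)| <= M.
  move=> u0 ut; have := P_inc_bound (lexx 0) u0; rewrite P_inc subr0 (ger0_norm u0) => A.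
  rewrite -[P (gamma tau)](subrK (P (gamma 0))) addrC; apply: le_trans (ler_normD _ _) _.
  by rewrite lerD2l; apply: le_trans A _; rewrite ler_pM2l.
have qom y tau : 0 <= tau -> tau <= t -> `|q (om y (gamma tau))| <= Kq * K * M * `|y|.
  move=> u0 ut; apply: le_trans (Hq _) _; rewrite -!mulrA ler_wpM2l // -(s2_omP H).
  by apply: le_trans (Kom _ _) _; rewrite -mulrA ler_pM2l // mulrC ler_wpM2r // PgM.
apply/ler_addgt0Pr => e e0.
pose D := K * K * `|c|; pose F := `|c| * (1 + Kq * K * M).
have KKM : 0 <= Kq * K * M by rewrite !mulr_ge0 // ltW.
have D0 : 0 <= D by rewrite !mulr_ge0 // ltW.
have F0 : 0 <= F by rewrite mulr_ge0 // addr_ge0.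
have [tau tau0 small] := small_sqrt D0 F0 (ltW K0) e0.
pose tau' := Num.min tau (1 + Kq * K * M)^-1.
have M1 : 0 < 1 + Kq * K * M by lra.
have [k kk kW] := bW tau tau0 (Num.truncn tau'^-1).
have tau'0 : 0 < tau' by rewrite lt_min tau0 invr_gt0.
have kt : k.+1%:R^-1 < tau'.
  rewrite -[tau']invrK ltf_pV2 ?posrE ?invr_gt0 //.
  by apply: lt_le_trans (truncnS_gt _) _; rewrite ler_nat ltnS.
have [ktau kM] : k.+1%:R^-1 < tau /\ k.+1%:R^-1 < (1 + Kq * K * M)^-1.
  by move: kt; rewrite lt_min => /andP.
have bt := le_lt_trans (bk k) ktau.
have tT : t <= T k.
  rewrite leNgt; apply/negP => Tt.
  have := qom (b k) (T k) (T0 k) (ltW Tt); rewrite qb leNgt => /negP; apply.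
  apply: le_lt_trans (_ : Kq * K * M * (1 + Kq * K * M)^-1 < _).
    by rewrite ler_wpM2l // ltW // (le_lt_trans (bk k)).
  by rewrite ltr_pdivrMr //; lra.
(* [y] is the modified piece from [s] to [t]; following it, conjugate the piece
   [r] from [t] to [T k] by [a]. By [conj_word] this adds [2 om a r] to the
   product, which cancels [c W0] up to a small vector [q v] and an element of [U]. *)
pose a := - (c / 2) *: P (b k).
pose r := g t (T k).
pose y := g s t + (z1 + c *: W0).
pose v := c *: W0 - c *: om (b k) (gamma (T k)) + c *: om (b k) (gamma t).
have Pz : P (z1 + c *: W0) = 0 by rewrite linearD linearZ /= PW0 scaler0 addr0 UP.
have Pv : P v = 0 by rewrite linearD linearB /= !linearZ /= PW0 !(s2_Pom H) !scaler0 oppr0 scaler0 !addr0.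
have Pa : P a = a by rewrite linearZ /= (s2_PP H).
have conj : y + a + om y a + r + om (y + a + om y a) r - a
     + om (y + a + om y a + r + om (y + a + om y a) r) (- a) = g s (T k) + z1 + v.
  rewrite conj_word; have -> : om y r = om (g s t) r.
    by rewrite /y (omDl H) (om_vl H _ Pz) addr0.
  have -> : 2 *: om a r = - c *: (om (b k) (gamma (T k)) - om (b k) (gamma t)).
    rewrite /a (omZl H) (omPl H) /r om_inc scalerA; congr (_ *: _).
    by field.
  rewrite (incM s t (T k)) -/r /v /y; move: (om (g s t) r) (om (b k) _) (om (b k) _).
  by move=> x1 x2 x3; apply/rowP => i; rewrite !mxE; ring.
have up : N (g s (T k) + z1 + v) <= N y + N a + N r + N a.
  rewrite -conj; apply: le_trans (s2_D H _ _) _; rewrite (s2_N H) lerD2r.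
  apply: le_trans (s2_D H _ _) _; rewrite lerD2r; exact: s2_D H _ _.
have Na : N a <= K * K * `|c| / 2 * tau.
  apply: le_trans (N_horiz_bound Pa) _; rewrite /a normrZ normrN normrM (ger0_norm (_ : 0 <= 2^-1)) ?invr_ge0 //.
  have -> : K * K * `|c| / 2 * tau = K * (`|c| / 2 * (K * tau)) by ring.
  rewrite ler_pM2l // ler_wpM2l ?divr_ge0 //; apply: le_trans (KP _) _.
  by rewrite ler_pM2l // ltW.
have Nr : N r = T k - t by rewrite /r Hray // ger0_norm // subr_ge0.
have qv : `|q v| <= F * tau.
  rewrite /v linearD linearB !linearZ /= qW0 -!scalerDr normrZ /F -mulrA ler_wpM2l //.
  apply: le_trans (ler_normD _ _) _; rewrite mulrDl mul1r lerD //; first by rewrite distrC ltW.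
  by apply: le_trans (qom _ _ t0 (lexx t)) _; rewrite ler_wpM2l // ltW.
have Pqv : P (q v) = 0.
  by rewrite -[q v](subKr v) linearB /= Pv UP // subrr.
have Nqv : N (- q v) <= K * Num.sqrt (F * tau).
  rewrite (s2_N H); apply: le_trans (N_vert_bound Pqv) _.
  by rewrite ler_pM2l // ler_sqrt ?mulr_ge0 // ltW.
have low : T k - s <= N (g s (T k) + z1 + v) + N (- q v).
  apply: le_trans (UN s (T k) (z1 + (v - q v)) s0 (le_trans st tT) (memvD z1U (qU v))) _.
  have := N_vD H (g s (T k) + z1 + v) (z := - q v).
  by rewrite linearN /= Pqv oppr0 !addrA => /(_ erefl).
have -> : t - s = (T k - s) - (T k - t) by ring.
have KK : D * tau = K * K * `|c| / 2 * tau + K * K * `|c| / 2 * tau by rewrite /D; field.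
move: small; rewrite KK -/y; clear -low up Na Nr Nqv; lra.
Qed.

(** For a maximal unshortenable subspace the brackets with the ray are bounded
    in the quotient; otherwise, normalized unbounded brackets would have a cluster
    point by which the subspace could be extended. *)
Lemma ray_reduction : exists (q : {linear E -> E}) (B : R), [/\ 0 <= B,
  forall s t z, 0 <= s -> s <= t -> P z = 0 -> q z = 0 -> t - s <= N (g s t + z),
  forall z, P z = 0 -> P (q z) = 0 /\ q (z - q z) = 0 &
  forall x t, 0 <= t -> `|q (om x (gamma t))| <= B * `|x|].
Proof.
have [U [UP UN] maxU] := maximal_unshortenable.
have [q [qU q0]] := complement_proj U.
have Pq z : P z = 0 -> P (q z) = 0.
  by move=> Pz; rewrite -[q z](subKr z) linearB /= Pz UP // subrr.
have qq z : q (q z) = q z.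
  by apply/eqP; rewrite eq_sym -subr_eq0 -linearB; apply/eqP/q0.
apply: contrapT => nex.
have nB k : {bT : E * R | 0 <= bT.2 /\ k.+1%:R * `|bT.1| < `|q (om bT.1 (gamma bT.2))|}.
  apply: cid; apply: contrapT => nk; apply: nex; exists q, k.+1%:R; split=> //.
  - by move=> s t z s0 st _ qz; apply: UN => //; rewrite -[z]subr0 -qz.
  - by move=> z Pz; split; [exact: Pq | rewrite linearB /= qq subrr].
  - move=> x t t0; rewrite leNgt; apply/negP => lt; apply: nk; by exists (x, t).
pose x k := (sval (nB k)).1; pose T k := (sval (nB k)).2.
have T0 k : 0 <= T k by rewrite /T; case: (nB k) => ? [].
have xT k : k.+1%:R * `|x k| < `|q (om (x k) (gamma (T k)))|.
  by rewrite /T /x; case: (nB k) => ? [].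
pose r k := `|q (om (x k) (gamma (T k)))|.
have r0 k : 0 < r k by apply: le_lt_trans (xT k); rewrite mulr_ge0.
pose b k := (r k)^-1 *: x k.
have bk k : `|b k| <= k.+1%:R^-1.
  rewrite normrZ gtr0_norm ?invr_gt0 // ler_pdivrMl // ler_pdivlMr // mulrC.
  by apply/ltW; exact: xT.
have qb k : `|q (om (b k) (gamma (T k)))| = 1.
  by rewrite (omZl H) linearZ /= normrZ gtr0_norm ?invr_gt0 // mulVf // gt_eqF // r0.
have [W0 bW] : exists l, forall e : R, 0 < e -> forall k0 : nat, exists2 k, (k0 <= k)%N &
    `|q (om (b k) (gamma (T k))) - l| < e.
  by apply: (@bounded_seq_cluster _ _ (fun k => q (om (b k) (gamma (T k)))) 1) => k; rewrite qb.
have PW0 : P W0 = 0 by apply: cluster_linear bW _ => k; rewrite Pq ?(s2_Pom H).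
have lin : linear (fun z : E => z - q z).
  by move=> a y z; rewrite linearP scalerBr opprD addrACA.
pose p := HB.pack_for {linear E -> E} (fun z : E => z - q z)
  (GRing.isLinear.Build R E E *:%R (fun z : E => z - q z) lin).
have qW0 : q W0 = W0.
  have : p W0 = 0 by apply: cluster_linear bW _ => k; rewrite /= qq subrr.
  by move=> /eqP; rewrite subr_eq0 => /eqP.
have W0n : W0 != 0.
  apply/eqP => W00; have [k _] := bW 1 ltr01 0%N; by rewrite W00 subr0 qb ltxx.
have := maxU _ (unshortenable_extend (conj UP UN) qU PW0 qW0 T0 bk qb bW).
rewrite leqNgt => /negP; apply.
have : ~~ (U + <[W0]> <= U)%VS.
  rewrite subv_add subvv /= -memvE; apply/negP => /q0.
  by rewrite qW0 => /eqP; apply/negP.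
by rewrite ltnNge; apply: contra => dU; rewrite [X in (X <= _)%VS](_ : _ = U) //; apply/esym/eqP; rewrite eqEdim addvSl.
Qed.

End Rays.
Arguments inc {R n} om gamma s t.
Arguments ray {R n} om N gamma.

(** * Uniform convexity *)

Section UniformConvexity.
Context {R : realType} {n : nat}.
Local Notation E := 'rV[R]_n.
Context {P : {linear E -> E}} {om : E -> E -> E} {N : E -> R} {K : R}.
Hypothesis H : step2_norm P om N.
Hypothesis HK : norm_bounds P om N K.
Implicit Types (x y z : E).

Definition strictly_convex_on_range (P' : E -> E) (N' : E -> R) := forall x y, P' x = x -> P' y = y ->
  (forall t : R, 0 <= t <= 1 -> N' ((1 - t) *: x + t *: y) = 1) -> x = y.

Hypothesis SC : strictly_convex_on_range P N.

Lemma range_fixed x y : P x = x -> P y = y -> P (x - y) = x - y.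
Proof. by move=> Px Py; rewrite linearB /= Px Py. Qed.

Lemma range_fixedD x y : P x = x -> P y = y -> P (x + y) = x + y.
Proof. by move=> Px Py; rewrite linearD /= Px Py. Qed.

Lemma range_fixedZ (a : R) x : P x = x -> P (a *: x) = a *: x.
Proof. by move=> Px; rewrite linearZ /= Px. Qed.

Lemma N_dist_le x y : P x = x -> P y = y -> N x <= N y + N (x - y).
Proof. by move=> Px Py; have := N_hD H Py (range_fixed Px Py); rewrite addrC subrK. Qed.

Lemma cluster_fixed (u : nat -> E) (l : E) :
  (forall e : R, 0 < e -> forall k0 : nat, exists2 k, (k0 <= k)%N & `|u k - l| < e) ->
  (forall k, P (u k) = u k) -> P l = l.
Proof.
move=> ul Pu.
have lin : linear (fun z : E => P z - z).
  by move=> a y z; rewrite linearP scalerBr opprD addrACA.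
pose p := HB.pack_for {linear E -> E} (fun z : E => P z - z)
  (GRing.isLinear.Build R E E *:%R (fun z : E => P z - z) lin).
have : p l = 0 by apply: cluster_linear ul _ => k; rewrite /= Pu subrr.
by move=> /eqP; rewrite subr_eq0 => /eqP.
Qed.

(** If the midpoint of [x] and [y] has norm 1, so has every point of the segment:
    the sum of the two points with parameters [t] and [1 - t] is [x + y]. *)
Lemma strictly_convex_midpoint x y : P x = x -> P y = y -> N x <= 1 -> N y <= 1 ->
  2 <= N (x + y) -> x = y.
Proof.
move=> Px Py x1 y1 xy2; apply: SC => // t /andP[t0 t1].
have le1 s : 0 <= s -> s <= 1 -> N ((1 - s) *: x + s *: y) <= 1.
  move=> s0 s1; apply: le_trans (N_hD H (range_fixedZ _ Px) (range_fixedZ _ Py)) _.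
  rewrite !(N_hZ H) // !ger0_norm ?subr_ge0 //.
  have : (1 - s) * N x <= (1 - s) * 1 by rewrite ler_wpM2l ?subr_ge0.
  have : s * N y <= s * 1 by rewrite ler_wpM2l.
  lra.
apply/eqP; rewrite eq_le le1 //=.
have s0 : 0 <= 1 - t by lra.
have s1 : 1 - t <= 1 by lra.
have B := le1 _ s0 s1; have PZ := range_fixedZ.
have := N_hD H (range_fixedD (PZ (1 - t) _ Px) (PZ t _ Py)) (range_fixedD (PZ (1 - (1 - t)) _ Px) (PZ (1 - t) _ Py)).
have -> : (1 - t) *: x + t *: y + ((1 - (1 - t)) *: x + (1 - t) *: y) = x + y.
  by apply/rowP => i; rewrite !mxE; ring.
lra.
Qed.

(** By compactness strict convexity is uniform; the linearized form is the one
    that can be averaged over a subdivision. *)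
Lemma uniform_convexity y (e : R) : P y = y -> N y <= 1 -> 0 < e ->
  exists2 D : R, 0 <= D & forall x, P x = x -> N x <= 1 -> N (x - y) <= e + D * (2 - N (x + y)).
Proof.
move=> Py y1 e0; have K0 := nb_gt0 HK.
have [dl dl0 Hdl] : exists2 dl : R, 0 < dl & forall x, P x = x -> N x <= 1 -> e < N (x - y) ->
    N (x + y) <= 2 - dl.
  apply: contrapT => /forall2NP nd.
  have nk k : exists x, [/\ P x = x, N x <= 1, e < N (x - y) & 2 - k.+1%:R^-1 < N (x + y)].
    have [|] := nd k.+1%:R^-1; first by rewrite invr_gt0.
    move=> /existsNP[x] /not_implyP[Px] /not_implyP[x1] /not_implyP[xe] /negP.
    by rewrite -ltNge => xk; exists x.
  pose u k := sval (cid (nk k)).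
  have uP k : [/\ P (u k) = u k, N (u k) <= 1, e < N (u k - y) & 2 - k.+1%:R^-1 < N (u k + y)].
    by rewrite /u; case: cid.
  have [l ul] : exists l, forall e : R, 0 < e -> forall k0 : nat, exists2 k, (k0 <= k)%N & `|u k - l| < e.
    apply: (@bounded_seq_cluster _ _ u (K * 1)) => k; have [Pu u1 _ _] := uP k.
    by apply: le_trans (nb_h HK Pu) _; rewrite ler_pM2l.
  have Pl : P l = l by apply: cluster_fixed ul _ => k; case: (uP k).
  have near (tau : R) : 0 < tau -> exists k, N (u k - l) <= tau /\ N (l - u k) <= tau /\ k.+1%:R^-1 <= tau.
    move=> tau0; have [k kk kl] := ul (tau / K) (divr_gt0 tau0 K0) (Num.truncn tau^-1).
    have [Pu _ _ _] := uP k.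
    have A : N (u k - l) <= tau.
      apply: le_trans (N_horiz_bound HK (range_fixed Pu Pl)) _.
      by rewrite mulrC -ler_pdivlMr // ltW.
    exists k; split=> //; split; first by rewrite -(s2_N H) opprB.
    rewrite -[tau]invrK lef_pV2 ?posrE ?invr_gt0 //; apply/ltW/(lt_le_trans (truncnS_gt _)).
    by rewrite ler_nat ltnS.
  have l1 : N l <= 1.
    apply/ler_addgt0Pr => f f0; have [k [_ [A _]]] := near f f0.
    have [Pu u1 _ _] := uP k; have := N_dist_le Pl Pu; lra.
  have l2 : 2 <= N (l + y).
    apply/ler_addgt0Pr => f f0; have [|k [A [_ B]]] := near (f / 2); first lra.
    have [Pu _ _ C] := uP k; have := N_dist_le (range_fixedD Pu Py) (range_fixedD Pl Py).
    rewrite opprD addrACA subrr addr0; move: C B; move: (k.+1%:R^-1) => w; lra.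
  have l3 : e <= N (l - y).
    apply/ler_addgt0Pr => f f0; have [k [A _]] := near f f0.
    have [Pu _ C _] := uP k; have := N_dist_le (range_fixed Pu Py) (range_fixed Pl Py).
    rewrite opprB subrKA; lra.
  have := strictly_convex_midpoint Pl Py l1 y1 l2 => ly.
  by move: l3; rewrite ly subrr (N0 H); lra.
(* [N (x - y) <= 2], so the slope [2 / dl] is enough when the defect exceeds [dl]. *)
exists (2 / dl); first by rewrite divr_ge0 // ltW.
move=> x Px x1; have A : N (x + y) <= 2 by have := N_hD H Px Py; lra.
have [xe|xe] := leP (N (x - y)) e.
  by apply: le_trans xe _; rewrite lerDl mulr_ge0 ?divr_ge0 ?subr_ge0 // ltW.
have := Hdl x Px x1 xe => B.
have C : N (x - y) <= 2 by have := N_hB H Px Py; lra.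
apply: le_trans C _; apply: le_trans (_ : 2 / dl * (2 - N (x + y)) <= _); last by rewrite lerDr ltW.
by rewrite mulrAC ler_pdivlMr // ler_pM2l //; lra.
Qed.

End UniformConvexity.

(** * Rays have constant horizontal speed *)

Section UnitSteps.
Context {R : realType} {n : nat}.
Local Notation E := 'rV[R]_n.
Context {P : {linear E -> E}} {om : E -> E -> E} {N : E -> R} {K : R} {gamma : R -> E}.
Hypothesis H : step2_norm P om N.
Hypothesis HK : norm_bounds P om N K.
Hypothesis SC : strictly_convex_on_range P N.
Hypothesis Hray : ray om N gamma.
Context {q : {linear E -> E}} {B : R}.
Hypothesis B0 : 0 <= B.
Hypothesis unshort : forall s t z, 0 <= s -> s <= t -> P z = 0 -> q z = 0 -> t - s <= N (inc om gamma s t + z).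
Hypothesis q_vert : forall z, P z = 0 -> P (q z) = 0 /\ q (z - q z) = 0.
Hypothesis q_bracket : forall x t, 0 <= t -> `|q (om x (gamma t))| <= B * `|x|.
Implicit Types (x y z : E) (s t : R).
Local Notation g := (inc om gamma).
Let K0 := nb_gt0 HK.

(** The vertical part of an increment, modulo the kernel of [q]. *)
Definition qv s t : E := q (g s t - P (g s t)).

Lemma q_om_inc x s t : 0 <= s -> 0 <= t -> `|q (om x (g s t))| <= 2 * B * `|x|.
Proof.
move=> s0 t0; rewrite (om_inc H) linearB /=; apply: le_trans (ler_normB _ _) _.
by rewrite -mulrA mulr_natl mulr2n lerD // q_bracket.
Qed.

Lemma qvM s t u : qv s u = qv s t + qv t u + q (om (g s t) (g t u)).
Proof.
rewrite /qv (incM H s t u) -!linearD; congr (q _); rewrite !linearD /= (s2_Pom H).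
by apply/rowP => i; rewrite !mxE; ring.
Qed.

Lemma qv_bound : exists2 C : R, 0 <= C & forall s t, 0 <= s -> 0 <= t -> `|qv s t| <= C * (t - s) ^+ 2.
Proof.
have [C C0 HC] := linear_bound q; exists (C * (4 * K)); first by rewrite !mulr_ge0 // ltW.
move=> s t s0 t0; apply: le_trans (HC _) _; rewrite -mulrA ler_wpM2l //.
exact: (vert_inc_bound H Hray HK s0 t0).
Qed.

(** The element [e] defined below corrects [h] to the increment of the ray; its
    component in the kernel of [q] costs nothing, by [unshort]. *)
Lemma compare s t h : 0 <= s -> s <= t ->
  t - s <= N h + K * (`|P (g s t) - P h| +
     Num.sqrt `|qv s t - q (h - P h) - q (om h (g s t))|).
Proof.
move=> s0 st; set e := g s t - h - om h (g s t).
set Qe := e - P e; have PQe : P Qe = 0 := Pvert H e.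
have [PqQ qQ] := q_vert PQe.
have -> : P (g s t) - P h = P e by rewrite /e !linearB /= !(s2_Pom H) !subr0.
have -> : qv s t - q (h - P h) - q (om h (g s t)) = q Qe.
  rewrite /qv -!linearB; congr (q _); rewrite /Qe /e !linearB /= !(s2_Pom H).
  by apply/rowP => i; rewrite !mxE; ring.
have Pk : P (- (Qe - q Qe)) = 0 by rewrite linearN linearB /= PqQ PQe subrr oppr0.
have qk : q (- (Qe - q Qe)) = 0 by rewrite linearN /= qQ oppr0.
apply: le_trans (unshort s0 st Pk qk) _.
have -> : g s t + - (Qe - q Qe) = h + (P e + q Qe) + om h (P e + q Qe).
  have -> : om h (P e + q Qe) = om h (g s t).
    rewrite (s2_omD H) (om_vr H _ PqQ) addr0 (s2_omP H) /e (s2_omD H) (s2_omD H) !(omNr H).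
    by rewrite (omxx H) [om h (om _ _)](om_vr H) ?(s2_Pom H) // !oppr0 !addr0.
  move: (q Qe) => a; rewrite /Qe; move: (P e) => b; rewrite /e.
  move: (om h (g s t)) (g s t) => c d; by apply/rowP => i; rewrite !mxE; ring.
apply: le_trans (s2_D H _ _) _; rewrite lerD2l; apply: le_trans (nb_N HK _) _.
have -> : P (P e + q Qe) = P e by rewrite linearD /= (s2_PP H) PqQ addr0.
by rewrite [P e + _]addrC addrK.
Qed.

(** Each unit of time adds a bounded amount, because the bracket of the new
    increment with the preceding part of the ray is bounded. *)
Lemma qv_linear_growth : exists2 C : R, 0 <= C & forall m : nat, `|qv 0 m%:R| <= C * m%:R.
Proof.
have [C1 C10 HC] := qv_bound.
exists (C1 + 2 * B * K); first by rewrite addr_ge0 // !mulr_ge0 // ltW.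
elim=> [|m IH].
  by have := HC 0 0 (lexx 0) (lexx 0); rewrite subrr expr0n !mulr0.
have m0 : (0 : R) <= m%:R by []; have m1 : (0 : R) <= m.+1%:R by [].
have mm : (m.+1%:R - m%:R : R) = 1 by rewrite -natr1 addrC addKr.
have -> : (C1 + 2 * B * K) * m.+1%:R = (C1 + 2 * B * K) * m%:R + (C1 + 2 * B * K).
  by rewrite -[m.+1%:R]natr1 mulrDr mulr1.
rewrite (qvM 0 m%:R) -addrA.
apply: le_trans (ler_normD _ _) _; rewrite lerD //; apply: le_trans (ler_normD _ _) _.
rewrite lerD //; first by have := HC _ _ m0 m1; rewrite mm expr1n mulr1.
rewrite (s2_omC H) linearN normrN -(omPl H).
apply: le_trans (q_om_inc _ (lexx 0) m0) _; rewrite ler_wpM2l ?mulr_ge0 //.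
by have := P_inc_bound H Hray HK m0 m1; rewrite mm normr1 mulr1.
Qed.

Lemma speed_bound : exists2 C : R, 0 <= C & forall m : nat,
  m%:R <= N (P (g 0 m%:R)) + K * Num.sqrt (C * m%:R).
Proof.
have [C C0 HC] := qv_linear_growth; exists C => // m.
have := compare (P (g 0 m%:R)) (lexx 0) (ler0n R m).
rewrite (s2_PP H) !subrr normr0 add0r linear0 (omPl H) (omxx H) linear0 ?subr0 ?addr0 => A.
apply: le_trans A _; rewrite lerD2l ler_pM2l // ler_sqrt ?mulr_ge0 //; exact: HC.
Qed.

Definition mean_step (k : nat) : E := k.+1%:R^-1 *: P (g 0 k.+1%:R).

Lemma P_mean_step k : P (mean_step k) = mean_step k.
Proof. by rewrite /mean_step linearZ /= (s2_PP H). Qed.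

Lemma N_mean_step_le k : N (mean_step k) <= 1.
Proof.
rewrite /mean_step (N_hZ H) ?(s2_PP H) // ger0_norm // ler_pdivrMl // mulr1.
by have := N_P_inc H Hray (lexx 0) (ler0n R k.+1); rewrite subr0 ger0_norm.
Qed.

(** The asymptotic direction [Y] of the ray has unit norm, because vertical
    displacements grow at most linearly; it is central modulo the kernel of [q],
    because brackets with the ray are bounded. *)
Lemma asymptotic_direction : exists Y, [/\ P Y = Y, N Y = 1,
  forall x, q (om x Y) = 0 &
  forall e : R, 0 < e -> forall k0 : nat, exists2 k, (k0 <= k)%N & `|mean_step k - Y| < e].
Proof.
have [Y mY] : exists l, forall e : R, 0 < e -> forall k0 : nat,
    exists2 k, (k0 <= k)%N & `|mean_step k - l| < e.
  apply: (@bounded_seq_cluster _ _ mean_step (K * 1)) => k.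
  by apply: le_trans (nb_h HK (P_mean_step k)) _; rewrite ler_pM2l // N_mean_step_le.
have PY : P Y = Y by apply: cluster_fixed mY P_mean_step.
have near (tau : R) : 0 < tau -> exists k, `|mean_step k - Y| <= tau /\ k.+1%:R^-1 <= tau.
  move=> tau0; have [k kk /ltW kl] := mY tau tau0 (Num.truncn tau^-1); exists k; split=> //.
  rewrite -[tau]invrK lef_pV2 ?posrE ?invr_gt0 //; apply/ltW/(lt_le_trans (truncnS_gt _)).
  by rewrite ler_nat ltnS.
have dist k : N (mean_step k - Y) <= K * `|mean_step k - Y|.
  by apply: N_horiz_bound HK _ _; apply: range_fixed => //; exact: P_mean_step.
have [C C0 HC] := speed_bound.
exists Y; split=> //.
  apply/eqP; rewrite eq_le; apply/andP; split.
    apply/ler_addgt0Pr => e e0; have [k [A _]] := near (e / K) (divr_gt0 e0 K0).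
    have := N_dist_le H PY (P_mean_step k); rewrite -[Y - _]opprB (s2_N H).
    have : K * `|mean_step k - Y| <= e by rewrite mulrC -ler_pdivlMr.
    have := dist k; have := N_mean_step_le k; lra.
  apply/ler_addgt0Pr => e e0.
  have [tau tau0 small] := small_sqrt (ltW K0) C0 (ltW K0) e0.
  have [k [A A']] := near tau tau0.
  have k1 : (0 : R) < k.+1%:R by [].
  have S : 1 <= N (mean_step k) + K * Num.sqrt (C * k.+1%:R^-1).
    have ki : (0 : R) <= k.+1%:R^-1 by rewrite invr_ge0.
    have := ler_wpM2l ki (HC k.+1); rewrite mulVf ?gt_eqF // mulrDr /mean_step.
    rewrite (N_hZ H) ?(s2_PP H) // (ger0_norm ki) => /le_trans; apply.
    rewrite lerD2l mulrCA ler_pM2l //.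
    have -> : C * k.+1%:R^-1 = (k.+1%:R^-1) ^+ 2 * (C * k.+1%:R).
      by rewrite expr2 mulrCA -mulrA mulVf ?mulr1 ?gt_eqF.
    by rewrite [leRHS]sqrtrM ?sqr_ge0 // sqrtr_sqr ger0_norm.
  have S' : Num.sqrt (C * k.+1%:R^-1) <= Num.sqrt (C * tau).
    by rewrite ler_sqrt ?mulr_ge0 ?(ltW tau0) // ler_wpM2l.
  have S'' : K * Num.sqrt (C * k.+1%:R^-1) <= K * Num.sqrt (C * tau) by rewrite ler_pM2l.
  have S3 : K * `|mean_step k - Y| <= K * tau by rewrite ler_pM2l.
  have := N_dist_le H (P_mean_step k) PY; have := dist k.
  move: S S'' S3 small; lra.
move=> x; apply/eqP; rewrite -normr_eq0 eq_le normr_ge0 andbT; apply/ler_addgt0Pr => e e0.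
rewrite add0r; have [Kq Kq0 Hq] := linear_bound q.
pose D := Kq * (K * `|x|) + 2 * B * `|x|.
have D0 : 0 <= D by rewrite addr_ge0 // !mulr_ge0 // ltW.
have D1 : 0 < D + 1 by lra.
have [k [A A']] := near (e / (D + 1)) (divr_gt0 e0 D1).
have -> : om x Y = k.+1%:R^-1 *: om x (g 0 k.+1%:R) - om x (mean_step k - Y).
  rewrite (s2_omD H) (omNr H) /mean_step (s2_omZ H) (s2_omP H).
  by rewrite opprD opprK addrA subrr add0r.
rewrite linearB linearZ /=; apply: le_trans (ler_normB _ _) _.
have X1 : `|k.+1%:R^-1 *: q (om x (g 0 k.+1%:R))| <= 2 * B * `|x| * (e / (D + 1)).
  rewrite normrZ ger0_norm // mulrC ler_pM // ; exact: q_om_inc.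
have X2 : `|q (om x (mean_step k - Y))| <= Kq * (K * `|x|) * (e / (D + 1)).
  apply: le_trans (Hq _) _; rewrite -mulrA ler_wpM2l //.
  by apply: le_trans (nb_om HK _ _) _; rewrite ler_wpM2l // mulr_ge0 // ltW.
apply: le_trans (lerD X1 X2) _; rewrite -mulrDl [2 * _ * _ + _]addrC.
apply: le_trans (_ : (D + 1) * (e / (D + 1)) <= _); last by rewrite mulrC divfK // gt_eqF.
by rewrite ler_wpM2r ?divr_ge0 ?(ltW D1) ?(ltW e0) // /D lerDl.
Qed.

End UnitSteps.

Section Subdivision.
Context {R : realType} {n : nat}.
Local Notation E := 'rV[R]_n.
Context {P : {linear E -> E}} {om : E -> E -> E} {N : E -> R} {K : R} {gamma : R -> E}.
Hypothesis H : step2_norm P om N.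
Hypothesis HK : norm_bounds P om N K.
Hypothesis SC : strictly_convex_on_range P N.
Hypothesis Hray : ray om N gamma.
Implicit Types (x y z : E) (s t a : R) (M : nat).
Local Notation g := (inc om gamma).
Let K0 := nb_gt0 HK.

Definition subdiv a M (j : nat) : R := a + j%:R / M.+1%:R.

Definition horizontal_step a M j : E := P (g (subdiv a M j) (subdiv a M j.+1)).

Lemma subdiv0 a M : subdiv a M 0 = a.
Proof. by rewrite /subdiv mul0r addr0. Qed.

Lemma subdivM a M : subdiv a M M.+1 = a + 1.
Proof. by rewrite /subdiv divff // pnatr_eq0. Qed.

Lemma subdiv_ge0 a M j : 0 <= a -> 0 <= subdiv a M j.
Proof. by move=> a0; rewrite addr_ge0 // divr_ge0. Qed.

Lemma subdivS a M j : subdiv a M j.+1 - subdiv a M j = M.+1%:R^-1.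
Proof. by rewrite /subdiv opprD addrACA subrr add0r -mulrBl -natr1 addrC addKr mul1r. Qed.

Lemma P_hstep a M j : P (horizontal_step a M j) = horizontal_step a M j.
Proof. exact: (s2_PP H). Qed.

Lemma N_hstep a M j : 0 <= a -> N (horizontal_step a M j) <= M.+1%:R^-1.
Proof.
move=> a0; apply: le_trans (N_P_inc H Hray (subdiv_ge0 M j a0) (subdiv_ge0 M j.+1 a0)) _.
by rewrite subdivS ger0_norm.
Qed.

Lemma sum_hstep a M i : \sum_(j < i) horizontal_step a M j = P (g a (subdiv a M i)).
Proof.
elim: i => [|i IH].
  by rewrite big_ord0 subdiv0 (P_inc H) subrr.
by rewrite big_ord_recr /= IH /horizontal_step !(P_inc H) addrC subrKA.
Qed.

Context {Y : E}.
Hypotheses (PY : P Y = Y) (NY : N Y = 1).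

(** Averaging the linearized uniform convexity over a subdivision. *)
Lemma sum_hstep_defect (e D a : R) M : 0 <= a ->
  (forall x, P x = x -> N x <= 1 -> N (x - Y) <= e + D * (2 - N (x + Y))) ->
  \sum_(j < M.+1) N (horizontal_step a M j - M.+1%:R^-1 *: Y) <=
  e + D * (2 - \sum_(j < M.+1) N (horizontal_step a M j + M.+1%:R^-1 *: Y)).
Proof.
move=> a0 UC; set w := M.+1%:R^-1.
have w0 : 0 < w by rewrite invr_gt0.
have wM : M.+1%:R * w = 1 by rewrite divff // pnatr_eq0.
have sc x : w *: (M.+1%:R *: x) = x by rewrite scalerA mulrC wM scale1r.
have Ph j : P (horizontal_step a M j) = horizontal_step a M j := P_hstep a M j.
have step j : N (horizontal_step a M j - w *: Y) <= w * e + D * (2 * w - N (horizontal_step a M j + w *: Y)).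
  have PM : P (M.+1%:R *: horizontal_step a M j) = M.+1%:R *: horizontal_step a M j by exact: range_fixedZ.
  have N1 : N (M.+1%:R *: horizontal_step a M j) <= 1.
    rewrite (N_hZ H) // ger0_norm //.
    by apply: le_trans (ler_wpM2l (ler0n R M.+1) (N_hstep M j a0)) _; rewrite wM.
  have := ler_wpM2l (ltW w0) (UC _ PM N1).
  have -> : w * (e + D * (2 - N (M.+1%:R *: horizontal_step a M j + Y))) =
     w * e + D * (2 * w - w * N (M.+1%:R *: horizontal_step a M j + Y)) by ring.
  have wN x : P x = x -> w * N x = N (w *: x) by move=> Px; rewrite (N_hZ H) // gtr0_norm.
  rewrite (wN _ (range_fixed PM PY)) (wN _ (range_fixedD PM PY)).
  by rewrite scalerBr scalerDr sc.
apply: (@le_trans _ _ (\sum_(j < M.+1) (w * e + D * (2 * w - N (horizontal_step a M j + w *: Y))))).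
  by apply: ler_sum => j _; exact: step.
have E1 : \sum_(j < M.+1) (w * e) = e by rewrite sumr_const card_ord -mulr_natl mulrA wM mul1r.
have E2 : \sum_(j < M.+1) (2 * w) = 2 by rewrite sumr_const card_ord -[LHS]mulr_natl mulrCA wM mulr1.
by rewrite big_split /= E1 -mulr_sumr sumrB E2.
Qed.

Hypothesis mY : forall e : R, 0 < e -> forall k0 : nat,
  exists2 k, (k0 <= k)%N & `|mean_step (P := P) (om := om) (gamma := gamma) k - Y| < e.

(** Since the mean of the unit steps is close to the unit vector [Y], most of
    them are, even after a further subdivision. *)
Lemma straight_block M (eps : R) (k0 : nat) : 0 < eps -> exists2 c : nat, (k0 <= c)%N &
  \sum_(j < M.+1) N (horizontal_step c%:R M j - M.+1%:R^-1 *: Y) <= eps.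
Proof.
move=> eps0; pose e := eps / 4; have e0 : 0 < e by rewrite divr_gt0.
have NY1 : N Y <= 1 by rewrite NY.
have [D D0 UC] := uniform_convexity H HK SC PY NY1 e0.
have DK : 0 <= D * K by rewrite mulr_ge0 // ltW.
have DK1 : 0 < D * K + 1 by lra.
have [k kk kY] := mY (divr_gt0 e0 DK1) (2 * k0)%N.
set m := k.+1.
pose S (c : nat) := \sum_(j < M.+1) N (horizontal_step c%:R M j - M.+1%:R^-1 *: Y).
have S0 c : 0 <= S c by apply: sumr_ge0 => j _; exact: (s2_ge0 H).
have N_add (F : nat -> E) i : (forall j, P (F j) = F j) -> N (\sum_(j < i) F j) <= \sum_(j < i) N (F j).
  by move=> PF; exact: (N_hsum H).
have SD (c : nat) : S c <= e + D * (2 - N (P (g c%:R c.+1%:R) + Y)).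
  apply: le_trans (sum_hstep_defect M (ler0n R c) UC) _.
  rewrite lerD2l ler_wpM2l // lerD2l lerN2.
  have -> : P (g c%:R c.+1%:R) + Y = \sum_(j < M.+1) (horizontal_step c%:R M j + M.+1%:R^-1 *: Y).
    rewrite big_split /= sum_hstep subdivM natr1 sumr_const card_ord -[X in _ = _ + X]scaler_nat scalerA.
    by rewrite divff ?scale1r // pnatr_eq0.
  apply: (N_add (fun j => horizontal_step c%:R M j + M.+1%:R^-1 *: Y)) => j.
  by apply: range_fixedD; [exact: P_hstep | exact: range_fixedZ].
have SS : \sum_(c < m) S c <= m%:R * (2 * e).
  apply: (@le_trans _ _ (\sum_(c < m) (e + D * (2 - N (P (g c%:R c.+1%:R) + Y))))).
    by apply: ler_sum => c _; exact: SD.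
  have E1 : \sum_(c < m) e = m%:R * e by rewrite sumr_const card_ord -[LHS]mulr_natl.
  have E2 : \sum_(c < m) 2 = m%:R * 2 :> R by rewrite sumr_const card_ord -[LHS]mulr_natl.
  rewrite big_split /= E1 -mulr_sumr sumrB E2.
  have tele (i : nat) : \sum_(c < i) P (g c%:R c.+1%:R) = P (g 0 i%:R).
    elim: i => [|i IH]; first by rewrite big_ord0 (P_inc H) subrr.
    by rewrite big_ord_recr /= IH !(P_inc H) addrC subrKA.
  have A : N (P (g 0 m%:R) + m%:R *: Y) <= \sum_(c < m) N (P (g c%:R c.+1%:R) + Y).
    have -> : P (g 0 m%:R) + m%:R *: Y = \sum_(c < m) (P (g c%:R c.+1%:R) + Y).
      by rewrite big_split /= tele sumr_const card_ord scaler_nat.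
    by apply: (N_add (fun c => P (g c%:R c.+1%:R) + Y)) => j; apply: range_fixedD => //; exact: (s2_PP H).
  have B : m%:R * (2 - K * (e / (D * K + 1))) <= N (P (g 0 m%:R) + m%:R *: Y).
    have -> : P (g 0 m%:R) + m%:R *: Y = m%:R *: (mean_step (P := P) (om := om) (gamma := gamma) k + Y).
      by rewrite scalerDr /mean_step scalerA divff ?scale1r // pnatr_eq0.
    have Pm := P_mean_step H (gamma := gamma) k.
    rewrite (N_hZ H _ (range_fixedD Pm PY)) ger0_norm // ler_wpM2l //.
    have := N_dist_le H (range_fixedD PY PY) (range_fixedD Pm PY).
    rewrite opprD addrACA subrr addr0 -[Y - _]opprB (s2_N H).
    have := N_horiz_bound HK (range_fixed Pm PY).
    have : K * `|mean_step (P := P) (om := om) (gamma := gamma) k - Y| <= K * (e / (D * K + 1)).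
      by rewrite ler_pM2l // ltW.
    have -> : N (Y + Y) = 2 by rewrite -mulr2n -scaler_nat (N_hZ H _ PY) NY ger0_norm ?mulr1.
    lra.
  have C : D * (K * (e / (D * K + 1))) <= e.
    rewrite mulrA mulrA ler_pdivrMr // [e * _]mulrC ler_wpM2r ?(ltW e0) //; lra.
  have m0 : (0 : R) <= m%:R by [].
  have := ler_wpM2l m0 C; have := ler_wpM2l D0 (le_trans B A).
  move: (\sum_(c < m) N _) => X; lra.
(* At least half of the blocks start after [k0], and they cannot all exceed
   [eps = 4 e] while the total is at most [2 m e]. *)
apply: contrapT => nc.
have big (c : nat) : (k0 <= c)%N -> eps <= S c.
  by move=> kc; rewrite leNgt; apply/negP => /ltW Sc; apply: nc; exists c.
have km : (k0 < m)%N by rewrite ltnS; apply: leq_trans kk; rewrite mul2n -addnn leq_addr.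
have L : (m - k0)%:R * eps <= \sum_(c < m) S c.
  rewrite -(big_mkord xpredT S) (@big_cat_nat _ _ _ k0) //= ?(ltnW km) //.
  apply: le_trans (_ : \sum_(k0 <= c < m) S c <= _); last by rewrite lerDr sumr_ge0.
  have -> : (m - k0)%:R * eps = \sum_(k0 <= c < m) eps by rewrite sumr_const_nat mulr_natl.
  by rewrite !big_nat; apply: ler_sum => c /andP[kc _]; exact: big.
have mk : m%:R < 2 * (m - k0)%:R :> R.
  by rewrite -natrM ltr_nat mulnBr ltn_subRL [X in (_ < X)%N]mul2n -addnn ltn_add2r ltnS.
have := le_trans L SS; rewrite /e => Q.
have : m%:R * eps < 2 * (m - k0)%:R * eps by rewrite ltr_pM2r.
move: Q; move: (m%:R) ((m - k0)%:R) => u v; lra.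
Qed.

End Subdivision.

Section ConstantSpeed.
Context {R : realType} {n : nat}.
Local Notation E := 'rV[R]_n.
Context {P : {linear E -> E}} {om : E -> E -> E} {N : E -> R} {K : R} {gamma : R -> E}.
Hypothesis H : step2_norm P om N.
Hypothesis HK : norm_bounds P om N K.
Hypothesis SC : strictly_convex_on_range P N.
Hypothesis Hray : ray om N gamma.
Context {q : {linear E -> E}} {B : R}.
Hypothesis B0 : 0 <= B.
Hypothesis unshort : forall s t z, 0 <= s -> s <= t -> P z = 0 -> q z = 0 -> t - s <= N (inc om gamma s t + z).
Hypothesis q_vert : forall z, P z = 0 -> P (q z) = 0 /\ q (z - q z) = 0.
Hypothesis q_bracket : forall x t, 0 <= t -> `|q (om x (gamma t))| <= B * `|x|.
Context {Y : E}.
Hypotheses (PY : P Y = Y) (NY : N Y = 1) (qY : forall x, q (om x Y) = 0).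
Hypothesis mY : forall e : R, 0 < e -> forall k0 : nat,
  exists2 k, (k0 <= k)%N & `|mean_step (P := P) (om := om) (gamma := gamma) k - Y| < e.
Implicit Types (x y z : E) (s t a : R) (M : nat).
Local Notation g := (inc om gamma).
Local Notation hst := (horizontal_step (P := P) (om := om) (gamma := gamma)).
Local Notation qv := (qv (P := P) (om := om) (gamma := gamma) (q := q)).
Let K0 := nb_gt0 HK.

Lemma qYl x : q (om Y x) = 0.
Proof. by rewrite (s2_omC H) linearN /= qY oppr0. Qed.

Lemma q_om_shift x x' (b b' : R) : q (om (x + b *: Y) (x' + b' *: Y)) = q (om x x').
Proof.
rewrite !(omDl H) !(s2_omD H) !(s2_omZ H) !(omZl H) (omxx H) !linearD !linearZ /=.
by rewrite qY qYl !(linear0, scaler0, addr0).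
Qed.

(** The product of the horizontal parts of the increments of the ray on a
    subdivision of [[a, a + 1]], each lengthened by the same multiple of [Y]. *)
Fixpoint tilted a M (i : nat) : E :=
  if i is j.+1 then let u := hst a M j + M.+1%:R^-1 *: Y in
    tilted a M j + u + om (tilted a M j) u
  else 0.

Lemma P_tilted a M i : P (tilted a M i) = P (g a (subdiv a M i)) + (i%:R / M.+1%:R) *: Y.
Proof.
elim: i => [|i IH]; first by rewrite /= linear0 subdiv0 (P_inc H) subrr mul0r scale0r addr0.
rewrite [in RHS](P_inc H) /= !linearD /= (s2_Pom H) addr0 IH linearZ /= PY (P_hstep H) /horizontal_step !(P_inc H).
rewrite -[i.+1%:R]natr1 mulrDl mul1r scalerDl.
by apply/rowP => j; rewrite !mxE; ring.
Qed.

Lemma N_tilted a M i : N (tilted a M i) <= \sum_(j < i) N (hst a M j + M.+1%:R^-1 *: Y).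
Proof.
elim: i => [|i IH]; first by rewrite big_ord0 (N0 H).
rewrite big_ord_recr /=; apply: le_trans (s2_D H _ _) _.
by rewrite lerD2r.
Qed.

(** The lengthening does not change the vertical part modulo the kernel of [q],
    since [Y] is central there; the vertical parts of the increments, which are
    dropped, are quadratic in the length of the intervals. *)
Lemma qv_tilted (C a : R) M i : 0 <= a ->
  (forall s t, 0 <= s -> 0 <= t -> `|qv s t| <= C * (t - s) ^+ 2) ->
  `|qv a (subdiv a M i) - q (tilted a M i - P (tilted a M i))| <= i%:R * (C * M.+1%:R^-1 ^+ 2).
Proof.
move=> a0 HC; elim: i => [|i IH].
  rewrite /= linear0 subr0 linear0 subr0 mul0r; have := HC _ _ a0 (subdiv_ge0 M 0 a0).
  by rewrite subdiv0 subrr expr0n mulr0.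
set w := M.+1%:R^-1; set h := tilted a M i; set u := hst a M i + w *: Y.
have Pu : P u = u by apply: range_fixedD; [exact: (P_hstep H) | exact: range_fixedZ].
have -> : tilted a M i.+1 - P (tilted a M i.+1) = (h - P h) + om h u.
  have PD x y : P (x + y) = P x + P y by exact: linearD.
  have -> : tilted a M i.+1 = h + u + om h u by [].
  rewrite (PD (h + u)) (PD h) (s2_Pom H) Pu.
  by apply/rowP => j; rewrite !mxE; ring.
have -> : q ((h - P h) + om h u) = q (h - P h) + q (om (g a (subdiv a M i)) (g (subdiv a M i) (subdiv a M i.+1))).
  rewrite linearD; congr (_ + _); rewrite -(omPl H) P_tilted /u q_om_shift /horizontal_step.
  by rewrite (omPl H) (s2_omP H).
rewrite (qvM H a (subdiv a M i)) -[i.+1%:R]natr1 mulrDl mul1r.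
set x1 := qv a _ in IH *; set x2 := q (h - _) in IH *; set x3 := qv _ _; set x4 := q _.
have -> : x1 + x3 + x4 - (x2 + x4) = (x1 - x2) + x3.
  by apply/rowP => j; rewrite !mxE; ring.
apply: le_trans (ler_normD _ _) _; rewrite lerD //.
by have := HC _ _ (subdiv_ge0 M i a0) (subdiv_ge0 M i.+1 a0); rewrite subdivS.
Qed.

Lemma qv_block (C a : R) M i : 0 <= a ->
  (forall s t, 0 <= s -> 0 <= t -> `|qv s t| <= C * (t - s) ^+ 2) ->
  `|qv a (subdiv a M i)| <= i%:R * (C * M.+1%:R^-1 ^+ 2) +
     2 * B * K * \sum_(j < i) N (hst a M j - M.+1%:R^-1 *: Y).
Proof.
move=> a0 HC; elim: i => [|i IH].
  rewrite mul0r big_ord0 mulr0 addr0; have := HC _ _ a0 (subdiv_ge0 M 0 a0).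
  by rewrite subdiv0 subrr expr0n mulr0.
set w := M.+1%:R^-1; have p0 j := subdiv_ge0 M j a0.
rewrite (qvM H a (subdiv a M i)) -[i.+1%:R]natr1 mulrDl mul1r big_ord_recr /= mulrDr.
have A : `|qv (subdiv a M i) (subdiv a M i.+1)| <= C * w ^+ 2.
  by have := HC _ _ (p0 i) (p0 i.+1); rewrite subdivS.
have Pd : P (hst a M i - w *: Y) = hst a M i - w *: Y.
  by apply: range_fixed; [exact: (P_hstep H) | exact: range_fixedZ].
have D : `|q (om (g a (subdiv a M i)) (g (subdiv a M i) (subdiv a M i.+1)))| <=
    2 * B * K * N (hst a M i - w *: Y).
  have -> : q (om (g a (subdiv a M i)) (g (subdiv a M i) (subdiv a M i.+1))) =
      - q (om (hst a M i - w *: Y) (g a (subdiv a M i))).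
    rewrite -linearN -(s2_omC H) (s2_omD H) (omNr H) (s2_omZ H) linearB linearZ /= qY scaler0 subr0.
    by rewrite /horizontal_step (s2_omP H).
  rewrite normrN; apply: le_trans (q_om_inc H q_bracket _ a0 (p0 i)) _.
  by rewrite -[leRHS]mulrA ler_wpM2l ?mulr_ge0 // (nb_h HK).
apply: le_trans (ler_normD _ _) _; have := ler_normD (qv a (subdiv a M i)) (qv (subdiv a M i) (subdiv a M i.+1)).
move: IH A D; rewrite -/w; lra.
Qed.

(** Lengthening a unit piece of the ray by [Y] and removing, far away, a piece
    of the ray that is nearly a segment of direction [Y] cannot shorten the ray. *)
Lemma tilted_length : exists2 C : R, 0 <= C & forall a M, 0 <= a ->
  2 <= \sum_(j < M.+1) N (hst a M j + M.+1%:R^-1 *: Y) + C * Num.sqrt (M.+1%:R^-1).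
Proof.
have [C1 C10 HC] := qv_bound H HK Hray (q := q).
pose C2 := 2 * C1 + 2 * B * K.
have C20 : 0 <= C2 by rewrite addr_ge0 ?mulr_ge0 // ltW.
exists (K * (K + Num.sqrt C2)); first by rewrite mulr_ge0 ?addr_ge0 ?sqrtr_ge0 // ltW.
move=> a M a0; set w := M.+1%:R^-1; have w0 : 0 < w by rewrite invr_gt0.
have w1 : w <= 1 by rewrite invf_le1 // ler1n.
have wM : M.+1%:R * w = 1 by rewrite divff // pnatr_eq0.
have [c kc block] := straight_block H HK SC Hray PY NY mY M (Num.truncn (a + 1)).+1 w0.
have ac : a + 1 <= c%:R.
  apply/ltW/(lt_le_trans (truncnS_gt _)); by rewrite ler_nat.
have c0 : 0 <= c%:R :> R by [].
have a10 : 0 <= a + 1 by lra.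
have c10 : 0 <= c%:R + 1 :> R by lra.
set p := g a (a + 1); set r := g (a + 1) c%:R; set p' := g c%:R (c%:R + 1).
set hM := tilted a M M.+1; set h := hM + r + om hM r.
have PhM : P hM = P p + Y by rewrite /hM P_tilted subdivM divff ?scale1r // pnatr_eq0.
have ac1 : a <= c%:R + 1 by lra.
have PD x y : P (x + y) = P x + P y by exact: linearD.
have ozz x u v y : om x (x + om u v + y + om x y) = om x y.
  by rewrite !(s2_omD H) (omxx H) !(om_vr H _ (s2_Pom H _ _)) !addr0 add0r.
have gE : g a (c%:R + 1) = p + r + om p r + p' + om (p + r) p'.
  rewrite (incM H a c%:R) (incM H a (a + 1)) -/p -/r -/p'; congr (_ + _).
  by rewrite (omDl H) (om_vl H _ (s2_Pom H _ _)) addr0.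
have qgE : qv a (c%:R + 1) = qv a (a + 1) + qv (a + 1) c%:R + q (om p r) + qv c%:R (c%:R + 1)
    + q (om (p + r) p').
  rewrite (qvM H a c%:R) (qvM H a (a + 1)) -/p -/r -/p'; congr (_ + q _).
  by rewrite (incM H a (a + 1)) -/p -/r (omDl H) (om_vl H _ (s2_Pom H _ _)) addr0.
have PgE : P (g a (c%:R + 1)) = P p + P r + P p'.
  by rewrite gE 2!PD (PD (p + r)) (PD p) !(s2_Pom H) !addr0.
have PhE : P h = P p + Y + P r by rewrite /h 2!PD PhM (s2_Pom H) addr0.
have qhM x : q (om hM x) = q (om p x).
  by rewrite -(omPl H) PhM (omDl H) (omPl H) linearD /= qYl addr0.
(* [h] replaces the two unit pieces [p] and [p'] at the ends of [p r p'] by the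
   lengthened piece [hM] at the beginning. *)
have X1 : P (g a (c%:R + 1)) - P h = \sum_(j < M.+1) (hst c%:R M j - w *: Y).
  rewrite sumrB (sum_hstep H) subdivM sumr_const card_ord -[X in _ = _ - X]scaler_nat scalerA wM scale1r.
  rewrite PgE PhE -/p'; move: (P p) (P r) (P p') => x1 x2 x3.
  by apply/rowP => j; rewrite !mxE; ring.
have X2 : qv a (c%:R + 1) - q (h - P h) - q (om h (g a (c%:R + 1))) =
    (qv a (a + 1) - q (hM - P hM)) + qv c%:R (c%:R + 1).
  have -> : q (h - P h) = q (hM - P hM) + qv (a + 1) c%:R + q (om p r).
    rewrite /qv -/r -qhM -!linearD; congr (q _); rewrite /h 2!PD (s2_Pom H).
    move: (P hM) (P r) (om hM r) => x1 x2 x3.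
    by apply/rowP => j; rewrite !mxE; ring.
  have -> : q (om h (g a (c%:R + 1))) = q (om (p + r) p').
    have -> : q (om h (g a (c%:R + 1))) = q (om (p + r) (g a (c%:R + 1))).
      rewrite /h (omDl H) (om_vl H _ (s2_Pom H _ _)) addr0 !(omDl H hM, omDl H p).
      by rewrite 2!linearD qhM.
    by rewrite gE ozz.
  rewrite qgE; move: (q _) (q _) (q _) (qv _ _) (qv _ _) (qv _ _) => x1 x2 x3 x4 x5 x6.
  by apply/rowP => j; rewrite !mxE; ring.
have A := compare H HK unshort q_vert h a0 ac1; rewrite X1 X2 in A.
have Nh : N h <= \sum_(j < M.+1) N (hst a M j + w *: Y) + (c%:R - (a + 1)).
  apply: le_trans (s2_D H _ _) _; apply: lerD; first exact: N_tilted.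
  by rewrite /r Hray // ger0_norm // subr_ge0.
have B1 : `|\sum_(j < M.+1) (hst c%:R M j - w *: Y)| <= K * w.
  have Pd j : P (hst c%:R M j - w *: Y) = hst c%:R M j - w *: Y.
    by apply: range_fixed; [exact: (P_hstep H) | exact: range_fixedZ].
  have Ps : P (\sum_(j < M.+1) (hst c%:R M j - w *: Y)) = \sum_(j < M.+1) (hst c%:R M j - w *: Y).
    by rewrite linear_sum; apply: eq_bigr => j _; exact: Pd.
  apply: le_trans (nb_h HK Ps) _; rewrite ler_pM2l //; apply: le_trans block.
  exact: (N_hsum H _ (fun j : 'I_M.+1 => Pd j)).
have B2 : `|(qv a (a + 1) - q (hM - P hM)) + qv c%:R (c%:R + 1)| <= C2 * w.
  apply: le_trans (ler_normD _ _) _.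
  have := qv_tilted M M.+1 a0 HC; have := qv_block M M.+1 c0 HC.
  rewrite !subdivM -/hM -/w expr2.
  have -> : M.+1%:R * (C1 * (w * w)) = C1 * w.
    by rewrite mulrCA [M.+1%:R * _]mulrA wM mul1r.
  have : 2 * B * K * \sum_(j < M.+1) N (hst c%:R M j - w *: Y) <= 2 * B * K * w.
    by rewrite ler_wpM2l // !mulr_ge0 // ltW.
  rewrite /C2; move: (\sum_(j < M.+1) _) => S; lra.
have sw : w <= Num.sqrt w.
  rewrite -{1}(sqr_sqrtr (ltW w0)) expr2 -[leRHS]mul1r ler_wpM2r ?sqrtr_ge0 //.
  by rewrite -sqrtr1 ler_sqrt.
have B3 : Num.sqrt `|(qv a (a + 1) - q (hM - P hM)) + qv c%:R (c%:R + 1)| <= Num.sqrt C2 * Num.sqrt w.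
  by rewrite -sqrtrM // ler_sqrt // mulr_ge0 // ltW.
have B4 : K * w <= K * Num.sqrt w by rewrite ler_pM2l.
move: A; set T1 := `|\sum_(j < M.+1) _| in B1 *; set T2 := Num.sqrt `|_| in B3 *.
move=> A; have B5 : K * (T1 + T2) <= K * (K * Num.sqrt w + Num.sqrt C2 * Num.sqrt w).
  by rewrite ler_pM2l // lerD // (le_trans B1).
rewrite -mulrA mulrDl; move: A Nh B5.
move: (\sum_(j < M.+1) N _) (N h) (Num.sqrt w) => S T3 sq A Nh B5; lra.
Qed.

(** Uniform convexity turns the nearly additive lengths of [tilted_length] into
    small distances between the steps and the corresponding multiples of [Y]. *)
Lemma unit_step a : 0 <= a -> P (gamma (a + 1)) - P (gamma a) = Y.
Proof.
move=> a0; have [C C0 HC] := tilted_length.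
have Pd : P (P (g a (a + 1)) - Y) = P (g a (a + 1)) - Y by apply: range_fixed => //; exact: (s2_PP H).
suff : N (P (g a (a + 1)) - Y) = 0.
  by move=> /(s2_eq0 H)/eqP; rewrite subr_eq0 (P_inc H) => /eqP.
apply/eqP; rewrite eq_le (s2_ge0 H) andbT; apply/ler_addgt0Pr => e e0; rewrite add0r.
have e2 : 0 < e / 2 by rewrite divr_gt0.
have NY1 : N Y <= 1 by rewrite NY.
have [D D0 UC] := uniform_convexity H HK SC PY NY1 e2.
have [tau tau0 small] := small_sqrt (lexx 0) ler01 (mulr_ge0 D0 C0) e2.
pose M := Num.truncn tau^-1.
have Mt : M.+1%:R^-1 <= tau.
  by rewrite -[tau]invrK lef_pV2 ?posrE ?invr_gt0 //; apply/ltW/truncnS_gt.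
have w0 : (0 : R) <= M.+1%:R^-1 by rewrite invr_ge0.
have S1 := sum_hstep_defect H Hray PY M a0 UC.
have S2 := HC a M a0.
have S3 : N (P (g a (a + 1)) - Y) <= \sum_(j < M.+1) N (hst a M j - M.+1%:R^-1 *: Y).
  have <- : \sum_(j < M.+1) (hst a M j - M.+1%:R^-1 *: Y) = P (g a (a + 1)) - Y.
    rewrite sumrB (sum_hstep H) subdivM sumr_const card_ord -[X in _ - X]scaler_nat scalerA.
    by rewrite divff ?scale1r // pnatr_eq0.
  apply: (N_hsum H _ (fun j : 'I_M.+1 => _)) => j.
  by apply: range_fixed; [exact: (P_hstep H) | exact: range_fixedZ].
have S4 : Num.sqrt M.+1%:R^-1 <= Num.sqrt (1 * tau) by rewrite mul1r ler_sqrt // ltW.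
have S5 : D * C * Num.sqrt M.+1%:R^-1 <= D * C * Num.sqrt (1 * tau).
  by rewrite ler_wpM2l // mulr_ge0.
have S6 : D * 2 <= D * (\sum_(j < M.+1) N (hst a M j + M.+1%:R^-1 *: Y)) + D * C * Num.sqrt M.+1%:R^-1.
  by rewrite -[D * C * _]mulrA -mulrDr ler_wpM2l.
rewrite mul0r add0r in small; move: S1 S3 S5 S6 small.
move: (\sum_(j < M.+1) N _) (\sum_(j < M.+1) N _) (Num.sqrt _) (Num.sqrt _) (N _) => x1 x2 x3 x4 x5.
move=> S1 S3 S5 S6 small; lra.
Qed.

End ConstantSpeed.

(** * Rays are lines *)

Section RayTheorem.
Context {R : realType} {n : nat}.
Local Notation E := 'rV[R]_n.
Context {P : {linear E -> E}} {om : E -> E -> E} {N : E -> R}.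
Hypothesis H : step2_norm P om N.
Hypothesis SC : strictly_convex_on_range P N.
Implicit Types (x y z : E) (s t a : R) (gamma : R -> E).

Lemma ray_unit_step gamma : ray om N gamma ->
  exists Y, forall a, 0 <= a -> P (gamma (a + 1)) - P (gamma a) = Y.
Proof.
move=> Hray; have [K HK] := step2_norm_bounds H.
have [q [B [B0 unshort q_vert q_bracket]]] := ray_reduction H Hray HK.
have [Y [PY NY qY mY]] := asymptotic_direction H HK Hray B0 unshort q_vert q_bracket.
by exists Y => a a0; exact: (unit_step H HK SC Hray B0 unshort q_vert q_bracket PY NY qY mY a0).
Qed.

Definition dil a x : E := a *: P x + a ^+ 2 *: (x - P x).

Lemma P_dil a x : P (dil a x) = a *: P x.
Proof. by rewrite /dil linearD !linearZ /= (Pvert H) (s2_PP H) scaler0 addr0. Qed.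

Lemma inc_dil gamma l s t :
  inc om (fun t => dil l (gamma t)) s t = dil l (inc om gamma s t).
Proof.
rewrite {2}/dil (P_inc H) /inc.
have -> : om (dil l (gamma s)) (dil l (gamma t)) = l ^+ 2 *: om (gamma s) (gamma t).
  rewrite -(omPl H) -(s2_omP H) !P_dil (omZl H) (s2_omZ H) (omPl H) (s2_omP H) scalerA.
  by rewrite expr2.
rewrite /dil; move: (gamma s) (gamma t) (om (gamma s) _) (P (gamma s)) (P (gamma t)) => x1 x2 x3 x4 x5.
by apply/rowP => i; rewrite !mxE; ring.
Qed.

Lemma rescaled_ray gamma l : 0 < l -> ray om N gamma ->
  ray om N (fun t => dil l^-1 (gamma (l * t))).
Proof.
move=> l0 Hray s t s0 t0.
rewrite (inc_dil (fun t => gamma (l * t))) (s2_dil H) ?invr_gt0 //.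
have -> : inc om (fun t => gamma (l * t)) s t = inc om gamma (l * s) (l * t) by [].
rewrite Hray ?mulr_ge0 ?(ltW l0) // -mulrBr normrM gtr0_norm // mulKf //.
by rewrite gt_eqF.
Qed.

(** [ray_unit_step] applied to the ray rescaled by [l]. *)
Lemma ray_step gamma (l a b : R) : ray om N gamma -> 0 <= l -> 0 <= a -> 0 <= b ->
  P (gamma (a + l)) - P (gamma a) = P (gamma (b + l)) - P (gamma b).
Proof.
move=> Hray; rewrite le_eqVlt => /predU1P[<-|l0] a0 b0; first by rewrite !addr0 !subrr.
have [Y HY] := ray_unit_step (rescaled_ray l0 Hray).
have key c : 0 <= c -> P (gamma (c + l)) - P (gamma c) = l *: Y.
  move=> c0; have := HY (l^-1 * c); rewrite mulr_ge0 ?invr_ge0 ?(ltW l0) // => /(_ isT) <-.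
  rewrite !P_dil mulrDr mulVKf ?gt_eqF // mulr1 -scalerBr scalerA divff ?gt_eqF //.
  by rewrite scale1r.
by rewrite !key.
Qed.

(** The difference between [Z t] and [t Z(1)] is additive and bounded, since it
    vanishes at the integers. *)
Lemma additive_bounded_linear (Z : R -> E) (C : R) :
  (forall s t, 0 <= s -> 0 <= t -> Z (s + t) = Z s + Z t) ->
  (forall t, 0 <= t -> `|Z t| <= C * t) -> forall t, 0 <= t -> Z t = t *: Z 1.
Proof.
move=> ZD ZC t t0.
have Z0 : Z 0 = 0.
  by apply/eqP; rewrite -normr_eq0 eq_le normr_ge0 andbT; have := ZC 0 (lexx 0); rewrite mulr0.
pose u s := Z s - s *: Z 1.
have uD s s' : 0 <= s -> 0 <= s' -> u (s + s') = u s + u s'.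
  by move=> s0 s0'; rewrite /u ZD // scalerDl opprD addrACA.
have uM (k : nat) s : 0 <= s -> u (k%:R * s) = k%:R *: u s.
  move=> s0; elim: k => [|k IH]; first by rewrite mul0r scale0r /u Z0 scale0r subrr.
  by rewrite -natr1 mulrDl mul1r uD ?mulr_ge0 // IH scalerDl scale1r.
have u1 : u 1 = 0 by rewrite /u scale1r subrr.
have C0 : 0 <= C by have := ZC 1 ler01; rewrite mulr1; apply: le_trans.
pose D := C + `|Z 1|; have D0 : 0 <= D by rewrite addr_ge0.
have uB s : 0 <= s -> `|u s| <= D.
  move=> s0; pose m := Num.truncn s; have /andP[ms sm] := truncn_itv s0.
  have um : u m%:R = 0 by have := uM m 1 ler01; rewrite mulr1 u1 scaler0.
  have -> : u s = u (s - m%:R).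
    by rewrite -[RHS]addr0 -um -uD ?subr_ge0 // subrK.
  have f0 : 0 <= s - m%:R by rewrite subr_ge0.
  have f1 : s - m%:R <= 1 by move: sm; rewrite -natr1 -/m; lra.
  apply: le_trans (ler_normB _ _) _; rewrite normrZ (ger0_norm f0) lerD //.
    by apply: le_trans (ZC _ f0) _; rewrite -[leRHS]mulr1 ler_wpM2l.
  by rewrite -[leRHS]mul1r ler_wpM2r.
suff : u t = 0 by move/eqP; rewrite subr_eq0 => /eqP.
apply/eqP; rewrite -normr_eq0 eq_le normr_ge0 andbT; apply/ler_addgt0Pr => e e0; rewrite add0r.
pose k := (Num.truncn (D / e)).+1.
have k0 : 0 < k%:R :> R by [].
have := uB (k%:R * t); rewrite mulr_ge0 // => /(_ isT); rewrite uM // normrZ ger0_norm //.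
rewrite -ler_pdivlMl // => /le_trans; apply; rewrite mulrC ler_pdivrMr // mulrC -ler_pdivrMr //.
by apply/ltW/truncnS_gt.
Qed.

(** Horizontally the increments depend only on the duration, hence are linear in
    it. The vertical parts are then additive, and quadratically small, so they
    vanish. *)
Theorem ray_is_line gamma : ray om N gamma ->
  exists2 Y, P Y = Y & forall t, 0 <= t -> inc om gamma 0 t = t *: Y.
Proof.
move=> Hray; have [K HK] := step2_norm_bounds H; have K0 := nb_gt0 HK.
pose Z t := P (gamma t) - P (gamma 0).
have ZE t : Z t = P (inc om gamma 0 t) by rewrite (P_inc H).
have ZD s t : 0 <= s -> 0 <= t -> Z (s + t) = Z s + Z t.
  move=> s0 t0; rewrite /Z; have := ray_step Hray t0 s0 (lexx 0); rewrite add0r => <-.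
  by rewrite [RHS]addrC subrKA.
have ZC t : 0 <= t -> `|Z t| <= K * t.
  by move=> t0; have := P_inc_bound H Hray HK (lexx 0) t0; rewrite ZE subr0 (ger0_norm t0).
have Zlin := additive_bounded_linear ZD ZC.
have PZ t : P (Z t) = Z t by rewrite ZE (s2_PP H).
exists (Z 1); first exact: PZ.
have Pinc s t : 0 <= s -> 0 <= t -> P (inc om gamma s t) = (t - s) *: Z 1.
  move=> s0 t0; have -> : P (inc om gamma s t) = Z t - Z s.
    by rewrite (P_inc H) /Z opprB addrA subrK.
  by rewrite (Zlin t) // (Zlin s) // -scalerBl.
pose V s t := inc om gamma s t - P (inc om gamma s t).
have VD s t u : 0 <= s -> 0 <= t -> 0 <= u -> V s u = V s t + V t u.
  move=> s0 t0 u0; rewrite /V (incM H s t u).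
  have -> : om (inc om gamma s t) (inc om gamma t u) = 0.
    by rewrite -(omPl H) -(s2_omP H) !Pinc // (omZl H) (s2_omZ H) (omxx H) !scaler0.
  have PD x y : P (x + y) = P x + P y by exact: linearD.
  rewrite addr0 (PD (inc _ _ _ _)); move: (inc _ _ _ _) (inc _ _ _ _) => x y.
  by rewrite opprD addrACA.
move=> t t0; suff V0 : V 0 t = 0.
  by move/eqP: V0; rewrite subr_eq0 Pinc // subr0 => /eqP.
have VB s : 0 <= s -> forall k : nat, `|V 0 (k%:R * s)| <= k%:R * (4 * K * s ^+ 2).
  move=> s0; elim=> [|k IH].
    have := vert_inc_bound H Hray HK (lexx 0) (lexx 0).
    by rewrite !mul0r subrr expr0n mulr0.
  have ks0 : 0 <= k%:R * s by rewrite mulr_ge0.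
  have ks1 : 0 <= k.+1%:R * s by rewrite mulr_ge0.
  rewrite (VD 0 (k%:R * s)) // -[k.+1%:R in leRHS]natr1 mulrDl mul1r.
  apply: le_trans (ler_normD _ _) _; rewrite lerD //.
  have := vert_inc_bound H Hray HK ks0 ks1.
  have -> // : k.+1%:R * s - k%:R * s = s.
  by rewrite -[k.+1%:R]natr1 mulrDl mul1r addrAC subrr add0r.
apply/eqP; rewrite -normr_eq0 eq_le normr_ge0 andbT; apply/ler_addgt0Pr => e e0; rewrite add0r.
pose F := 4 * K * t ^+ 2; have F0 : 0 <= F by rewrite !mulr_ge0 ?exprn_ge0 // ltW.
pose k := (Num.truncn (F / e)).+1.
have k0 : 0 < k%:R :> R by [].
have := VB (k%:R^-1 * t); rewrite mulr_ge0 ?invr_ge0 // => /(_ isT k).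
rewrite (mulVKf (lt0r_neq0 k0)) => /le_trans; apply.
have -> : k%:R * (4 * K * (k%:R^-1 * t) ^+ 2) = F / k%:R.
  by rewrite /F; field; rewrite gt_eqF.
rewrite ler_pdivrMr // mulrC -ler_pdivrMr //.
by apply/ltW/truncnS_gt.
Qed.

End RayTheorem.

(** * Step two groups in the chart *)

Section StepTwoChart.
Context {R : realType} (G : stratifiedGroup R) (step2 : step G = 2%N).
Context (d : G -> G -> R) (hd : homogeneous_distance d).
Local Notation E := 'rV[R]_(lie_dim G).
Local Notation exp := (lie_exp G).
Local Notation log := (lie_log G).
Implicit Types (g h : G) (X Y Z : E).

Definition chart_norm X : R := d 1%g (exp X).

Lemma hproj_half_bracket X Y : hproj (half_bracket X Y) = 0.
Proof.
by apply: hproj_layer2 => //; rewrite memvZ // bracket_layer11 // hproj_in.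
Qed.

Lemma chart_step2_norm : step2_norm (@hproj R G) (@half_bracket R G) chart_norm.
Proof.
have hp := @hproj_in R G.
split => /=.
- by move=> X; rewrite hproj_id.
- by move=> X Y Z; rewrite /half_bracket linearD /= bracketDr // scalerDr.
- move=> a X Y; rewrite /half_bracket linearZ /= bracketZr // !scalerA.
  by rewrite mulrC.
- by move=> X Y; rewrite /half_bracket bracketC // scalerN.
- by move=> X Y; rewrite /half_bracket [hproj (hproj _)]hproj_id.
- exact: hproj_half_bracket.
- by move=> X; exact: hnorm_ge0.
- move=> X /(hdist_eq0 hd)/esym; rewrite -(exp0 G) => /(congr1 log).
  by rewrite !lie_expK.
- by move=> X; rewrite /chart_norm expN hnormV.
- by move=> X Y; rewrite /chart_norm -chart_mul_step2 // exp_mul hnormM.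
- by move=> a X a0; rewrite /chart_norm -dilation_exp2 // hnorm_dilation.
Qed.

Lemma chart_strictly_convex : strictly_convex_projection_norm d ->
  strictly_convex_on_range (@hproj R G) chart_norm.
Proof.
move=> SC X Y PX PY XY; apply: SC => //; first by rewrite -PX hproj_in.
by rewrite -PY hproj_in.
Qed.

Lemma exp_inc (u : R -> E) s t :
  exp (inc (@half_bracket R G) u s t) = ((exp (u s))^-1 * exp (u t))%g.
Proof.
rewrite -expN -exp_mul; congr exp; rewrite chart_mul_step2 // /inc.
by rewrite (omNl chart_step2_norm) [- _ + _]addrC.
Qed.

(** The abelianization of the group, in coordinates. *)
Definition hlog g : E := hproj (log g).

Lemma hlogM g h : hlog (g * h)%g = hlog g + hlog h.
Proof.
rewrite /hlog -{1}[g](lie_logK (l := G)) -{1}[h](lie_logK (l := G)) -/(chart_mul _ _).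
by rewrite chart_mul_step2 // !linearD /= hproj_half_bracket addr0.
Qed.

Lemma hlogV g : hlog g^-1%g = - hlog g.
Proof. by rewrite /hlog logV linearN. Qed.

Lemma hproj_hlog g : hproj (hlog g) = hlog g.
Proof. by rewrite /hlog hproj_id // hproj_in. Qed.

Lemma hlog_lipschitz g h : chart_norm (hlog g - hlog h) <= d h g.
Proof.
rewrite (hdistE hd) addrC -hlogV -hlogM.
apply: le_trans (N_horiz_le chart_step2_norm _) _.
by rewrite /chart_norm lie_logK.
Qed.

End StepTwoChart.

(** * Horizontal lines *)

Section Lines.
Context {R : realType} (H : stratifiedGroup R) (d : H -> H -> R).
Hypothesis hd : homogeneous_distance d.
Local Notation E := 'rV[R]_(lie_dim H).
Local Notation exp := (lie_exp H).
Local Notation log := (lie_log H).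
Local Notation N g := (d 1%g g).
Implicit Types (g h : H) (X Y Z : E).

Lemma hnorm_line X (t : R) : X \in layer H 1 -> N (exp (t *: X)) = `|t| * N (exp X).
Proof.
move=> X1; have pos s : 0 < s -> N (exp (s *: X)) = `|s| * N (exp X).
  move=> s0; rewrite gtr0_norm // -(hnorm_dilation hd) //.
  by rewrite (dilation_layer s (k := Ordinal (step_gt0 H)) X1) expr1.
have [t0|t0|->] := ltgtP t 0; last by rewrite scale0r exp0 normr0 mul0r (hnorm1 hd).
  by rewrite -(hnormV hd) -expN -scaleNr pos ?oppr_gt0 // normrN.
exact: pos.
Qed.

Lemma iter_bracket_layer X Y j : X \in layer H 1 -> Y \in layer H 1 -> (j <= step H)%N ->
  iter j (lie_bracket X) Y \in layer H j.+1.
Proof.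
move=> X1 Y1; elim: j => [//|j IH] js /=.
have [|B _] := layer_bracket (s := H) (k := j.+1); first by rewrite js.
by apply: B => //; apply: IH; exact: ltnW.
Qed.

(** The conjugate of [exp Y] by [exp (- t X)] is, up to the dilation by [t], at
    distance [O(1 / t)] from the identity in the chart: its component in the
    [j]-th layer grows like [t ^ (j - 1)] only. *)
Lemma conj_line_dilation X Y (t : R) : X \in layer H 1 -> Y \in layer H 1 -> 0 < t ->
  exp (chart_conj (exp (- t *: X)) Y) =
  dilation t (exp (t^-1 *: chart_conj (exp (- 1 *: X)) Y)).
Proof.
move=> X1 Y1 t0.
have nil : iter (step H) (lie_bracket X) Y = 0.
  by have := iter_bracket_layer X1 Y1 (leqnn _); rewrite layer_stepS memv0 => /eqP.
rewrite !(conj_flow_formula nil) scaler_sumr.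
rewrite dilation_exp; last first.
  by move=> j; rewrite !memvZ // iter_bracket_layer // ltnW.
congr exp; apply: eq_bigr => j _; rewrite !scalerA; congr (_ *: _).
rewrite [in LHS]exprNn exprS; move: ((-1) ^+ j) (t ^+ j) => a b.
by field; rewrite pnatr_eq0 -lt0n fact_gt0 gt_eqF.
Qed.

(** Undo the dilation in [conj_line_dilation]: the norm being continuous at the
    identity, the distance is [t * o(1)]. *)
Lemma parallel_lines_sublinear X Y : X \in layer H 1 -> Y \in layer H 1 ->
  forall e : R, 0 < e -> exists2 T : R, 0 < T &
    forall t, T < t -> d (exp (t *: X)) (exp Y * exp (t *: X))%g <= e * t.
Proof.
move=> X1 Y1 e e0; have [dl dl0 Hdl] := hnorm_small hd e0.
set C := chart_conj (exp (- 1 *: X)) Y.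
exists (`|C| / dl + 1); first by rewrite ltr_wpDl // divr_ge0 // ltW.
move=> t tT; have t0 : 0 < t by apply: lt_trans tT; rewrite ltr_wpDl // divr_ge0 // ltW.
have -> : d (exp (t *: X)) (exp Y * exp (t *: X))%g = N (exp (chart_conj (exp (- t *: X)) Y)).
  by rewrite (hdistE hd) exp_conj scaleNr expN invgK mulgA.
rewrite conj_line_dilation // (hnorm_dilation hd) // mulrC ler_wpM2r ?(ltW t0) //.
apply/ltW/Hdl; rewrite normrZ gtr0_norm ?invr_gt0 // ltr_pdivrMl // -ltr_pdivrMr //.
by apply: lt_trans tT; rewrite ltrDl.
Qed.

End Lines.

(** * Isometric embeddings are affine *)

Section Embedding.
Context {R : realType} {H G : stratifiedGroup R} {dH : H -> H -> R} {dG : G -> G -> R}.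
Hypotheses (hdH : homogeneous_distance dH) (hdG : homogeneous_distance dG).
Hypothesis step2 : step G = 2%N.
Hypothesis hconv : strictly_convex_projection_norm dG.
Context {f : H -> G}.
Hypothesis hf : isometric_embedding dH dG f.
Local Notation EH := 'rV[R]_(lie_dim H).
Local Notation EG := 'rV[R]_(lie_dim G).
Local Notation expH := (lie_exp H).
Local Notation expG := (lie_exp G).
Local Notation logH := (lie_log H).
Local Notation logG := (lie_log G).
Local Notation norm := (chart_norm dG).
Implicit Types (h k : H) (X : EH).

Let s2 := chart_step2_norm step2 hdG.
Let sc := chart_strictly_convex hconv.

(** The direction of the image of the horizontal line [t |-> h * exp (t X)]. *)
Definition line_direction h X : EG := hlog (f (h * expH X)%g) - hlog (f h).

Lemma hproj_line_direction h X : hproj (line_direction h X) = line_direction h X.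
Proof. by rewrite /line_direction linearB /= !hproj_hlog. Qed.

(** With unit speed parametrization the image of a horizontal half-line is a
    geodesic ray of [G], hence a half-line. *)
Lemma image_line h X (t : R) : X \in layer H 1 -> 0 <= t ->
  f (h * expH (t *: X))%g = (f h * expG (t *: line_direction h X))%g.
Proof.
move=> X1; have [->|X0] := eqVneq X 0.
  by move=> _; rewrite /line_direction scaler0 exp0 mulg1 subrr scaler0 exp0 mulg1.
move=> t0; suff [Y PY fY] : exists2 Y, hproj Y = Y &
    forall s : R, 0 <= s -> f (h * expH (s *: X))%g = (f h * expG (s *: Y))%g.
  suff -> : line_direction h X = Y by exact: fY.
  have := fY 1 ler01; rewrite !scale1r /line_direction => ->.
  by rewrite (hlogM step2) addrAC subrr add0r /hlog lie_expK.
pose c := dH 1%g (expH X).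
have c0 : 0 < c.
  rewrite lt_def (hdist_ge0 hdH) andbT; apply/eqP => /(hdist_eq0 hdH)/esym.
  by rewrite -(exp0 H) => /(congr1 logH); rewrite !lie_expK; apply/eqP.
pose gamma (s : R) := logG (f (h * expH (s *: (c^-1 *: X)))%g).
have Hray : ray (@half_bracket R G) norm gamma.
  move=> s t' _ _; rewrite /chart_norm (exp_inc step2 hdG) !lie_logK.
  rewrite -(hdistE hdG) hf (hdist_left_inv hdH) (hdistE hdH) -expN -scaleNr.
  rewrite -exp_mul /chart_mul -expZD lie_expK scalerA (hnorm_line hdH) // addrC.
  by rewrite normrM [`|c^-1|]gtr0_norm ?invr_gt0 // -/c divfK // gt_eqF.
have [Y PY lineY] := ray_is_line s2 sc Hray.
exists (c *: Y); first by rewrite linearZ /= PY.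
move=> s s0; have ct0 : 0 <= c * s by rewrite mulr_ge0 // ltW.
have := lineY (c * s) ct0; move=> /(congr1 expG); rewrite (exp_inc step2 hdG) !lie_logK.
rewrite scale0r exp0 mulg1 !scalerA [c * s]mulrC mulfK ?gt_eqF // => <-.
by rewrite mulVKg.
Qed.

(** The images of the half-lines of direction [X] from [h] and from
    [h * exp K] diverge linearly if their directions differ, whereas the
    half-lines themselves diverge sublinearly. *)
Lemma line_direction_horizontal h K X : X \in layer H 1 -> K \in layer H 1 ->
  line_direction (h * expH K)%g X = line_direction h X.
Proof.
move=> X1 K1.
set Y := line_direction h X; set Y' := line_direction _ X.
set v := hlog (f (h * expH K)%g) - hlog (f h).
suff : norm (Y' - Y) = 0 by move=> /(s2_eq0 s2)/eqP; rewrite subr_eq0 => /eqP.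
have Pd : hproj (Y' - Y) = Y' - Y by rewrite linearB /= !hproj_line_direction.
apply/eqP; rewrite eq_le (s2_ge0 s2) andbT; apply/ler_addgt0Pr => e e0; rewrite add0r.
have e2 : 0 < e / 2 by rewrite divr_gt0.
have [T T0 HT] := parallel_lines_sublinear hdH X1 K1 e2.
(* Large enough for the sublinear bound to hold and for [norm v] to be absorbed. *)
pose t := T + norm v / (e / 2) + 1.
have nv0 : 0 <= norm v := s2_ge0 s2 v.
have ve : 0 <= norm v / (e / 2) by rewrite divr_ge0 // ltW.
have tT : T < t by rewrite /t; lra.
have t0 : 0 < t by apply: lt_trans tT.
have A : norm (v + t *: (Y' - Y)) <= e / 2 * t.
  have -> : v + t *: (Y' - Y) = hlog (f (h * expH K * expH (t *: X))%g) - hlog (f (h * expH (t *: X))%g).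
    rewrite !image_line // ?ltW // !(hlogM step2) /hlog !lie_expK -!/(hlog _) !linearZ /=.
    rewrite !hproj_line_direction scalerBr /v.
    by rewrite opprD addrACA.
  apply: le_trans (hlog_lipschitz step2 hdG _ _) _; rewrite hf.
  by rewrite -mulgA (hdist_left_inv hdH) HT.
have B : t * norm (Y' - Y) <= e / 2 * t + norm v.
  have Pv : hproj v = v by rewrite /v linearB /= !hproj_hlog.
  have Pt : hproj (t *: (Y' - Y)) = t *: (Y' - Y) by rewrite linearZ /= Pd.
  have Ps : hproj (v + t *: (Y' - Y)) = v + t *: (Y' - Y) by rewrite linearD /= Pv Pt.
  have := N_hB s2 Ps Pv; rewrite [v + _]addrC addrK (N_hZ s2) // (gtr0_norm t0).
  by move=> /le_trans; apply; rewrite lerD2r addrC.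
have C : norm v <= e / 2 * t.
  rewrite mulrC -ler_pdivrMr // /t; lra.
by rewrite -(ler_pM2l t0); lra.
Qed.

(** The two quantities are the norms of [k^-1 * u i] and of its conjugate by
    [a^-1], which converge to the identity in the chart. *)
Lemma chart_close (u : nat -> H) k : logH (u i) @[i --> \oo] --> logH k ->
  forall (a : H) (e : R), 0 < e -> exists i, dH (u i) k < e /\ dH (u i * a)%g (k * a)%g < e.
Proof.
move=> uk a e e0; have [dl dl0 Hdl] := hnorm_small hdH e0.
pose v i : EH := logH (k^-1 * u i)%g.
have v0 : v i @[i --> \oo] --> (0 : EH).
  pose F (X : EH) := chart_mul (- logH k) X.
  have Fc : continuous F.
    by move=> X; apply: differentiable_continuous; apply: differentiable_chart_mul.
  have <- : F (logH k) = 0 by rewrite /F /chart_mul expN lie_logK mulVg log1.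
  have -> : v = fun i => F (logH (u i)).
    by apply/funext => i; rewrite /F /chart_mul expN !lie_logK.
  exact: (cvg_comp _ _ uk (Fc (logH k))).
have w0 : chart_conj a^-1%g (v i) @[i --> \oo] --> (0 : EH).
  have := cvg_comp _ _ v0 (@chart_conj_continuous R H a^-1%g 0).
  by rewrite chart_conj0.
have /cvgrPdist_lt/(_ dl dl0) Hv := v0; have /cvgrPdist_lt/(_ dl dl0) Hw := w0.
have [i _ /(_ i (leqnn i))[]] := filterI Hv Hw.
rewrite /= !sub0r !normrN => /Hdl vi /Hdl wi; exists i.
rewrite !(hdist_sym hdH (u i)) !(hdist_sym hdH (u i * a)%g) !(hdistE hdH k).
rewrite (hdistE hdH (k * a)%g); split; first by rewrite lie_logK in vi.
by move: wi; rewrite exp_conj lie_logK invgK invgM !mulgA.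
Qed.

(** The elements [k] such that translation by [k] preserves all directions form
    a closed subgroup that contains the first layer. *)
Lemma line_direction_constant h X : X \in layer H 1 ->
  line_direction h X = line_direction 1%g X.
Proof.
move=> X1; rewrite -[h in LHS]mul1g.
suff : forall k h X, X \in layer H 1 -> line_direction (h * k)%g X = line_direction h X by apply.
apply: closed_subgroup_full; last first.
  by move=> K K1 h' X' X1'; exact: line_direction_horizontal.
split.
- by move=> h' X' _; rewrite mulg1.
- by move=> k k' Hk Hk' h' X' X1'; rewrite mulgA Hk' // Hk.
- by move=> k Hk h' X' X1'; have := Hk (h' * k^-1)%g X' X1'; rewrite mulgVK => ->.
move=> u k Hu uk h' X' X1'.
suff : norm (line_direction (h' * k)%g X' - line_direction h' X') = 0.
  by move=> /(s2_eq0 s2)/eqP; rewrite subr_eq0 => /eqP.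
apply/eqP; rewrite eq_le (s2_ge0 s2) andbT; apply/ler_addgt0Pr => e e0; rewrite add0r.
have e2 : 0 < e / 2 by rewrite divr_gt0.
have [i [A B]] := chart_close uk (expH X') e2.
rewrite -(Hu i h' X' X1') /line_direction.
set p := f (h' * k * expH X')%g; set p' := f (h' * u i * expH X')%g.
have -> : hlog p - hlog (f (h' * k)%g) - (hlog p' - hlog (f (h' * u i)%g)) =
    (hlog p - hlog p') - (hlog (f (h' * k)%g) - hlog (f (h' * u i)%g)).
  by apply/rowP => j; rewrite !mxE; ring.
have Ph (x y : G) : hproj (hlog x - hlog y) = hlog x - hlog y.
  by rewrite linearB /= !hproj_hlog.
apply: le_trans (N_hB s2 (Ph _ _) (Ph _ _)) _.
have C := hlog_lipschitz step2 hdG p p'.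
have D := hlog_lipschitz step2 hdG (f (h' * k)%g) (f (h' * u i)%g).
rewrite /p /p' hf -!mulgA (hdist_left_inv hdH) in C.
rewrite hf (hdist_left_inv hdH) in D.
rewrite /p /p' -!mulgA; lra.
Qed.

Definition centered h : G := ((f 1)^-1 * f h)%g.

(** The elements [k] such that the formula holds for all [h] form a closed
    subgroup, which contains the first layer because directions are constant. *)
Lemma centeredM h k : centered (h * k)%g = (centered h * centered k)%g.
Proof.
suff : forall k h, centered (h * k)%g = (centered h * centered k)%g by apply.
have c1 : centered 1%g = 1%g by rewrite /centered mulVg.
have cd x y : dG (centered x) (centered y) = dH x y by rewrite /centered (hdist_left_inv hdG) hf.
have cX h' X : X \in layer H 1 -> centered (h' * expH X)%g = (centered h' * expG (line_direction 1%g X))%g.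
  move=> X1; have := image_line h' X1 ler01; rewrite !scale1r line_direction_constant // => fX.
  by rewrite /centered fX mulgA.
apply: closed_subgroup_full; last first.
  by move=> X X1 h'; rewrite -[expH X in RHS]mul1g !cX // c1 mul1g.
split.
- by move=> h'; rewrite c1 !mulg1.
- by move=> k1 k2 H1 H2 h'; rewrite (mulgA h') (H2 (h' * k1)%g) (H1 h') (H2 k1); exact: (esym (mulgA _ _ _)).
- move=> k1 H1 h'; have : (centered k1^-1 * centered k1 = 1)%g by rewrite -H1 mulVg.
  move=> /(congr1 (fun x => x * (centered k1)^-1)%g); rewrite mulgK mul1g => ->.
  by have := H1 (h' * k1^-1)%g; rewrite mulgVK => ->; rewrite mulgK.
move=> u k1 Hu uk h'; apply/(hdist_eq0 hdG).
apply/eqP; rewrite eq_le (hdist_ge0 hdG) andbT; apply/ler_addgt0Pr => e e0; rewrite add0r.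
have e2 : 0 < e / 2 by rewrite divr_gt0.
have [i [A _]] := chart_close uk 1%g e2.
apply: le_trans (hdist_triangle hdG _ (centered (h' * u i)%g) _) _.
rewrite cd (hdist_left_inv hdH) (hdist_sym hdH) Hu (hdist_left_inv hdG) cd; lra.
Qed.

End Embedding.
Arguments centered {R H G} f h.

Theorem theorem1p3 (R : realType) (H G : stratifiedGroup R)
    (dH : H -> H -> R) (dG : G -> G -> R)
    (hdH : homogeneous_distance dH) (hdG : homogeneous_distance dG)
    (hstep : step G = 2%N)
    (hconv : strictly_convex_projection_norm dG)
    (f : H -> G) (hf : isometric_embedding dH dG f) :
  affine_map f.
Proof.
have cM : {morph centered f : h k / (h * k)%g}.
  exact: (centeredM hdH hdG hstep hconv hf).
exists (f 1%g), (HB.pack_for {multiplicative H -> G} (centered f) (isMultiplicative.Build H G (centered f) cM)).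
by move=> h /=; rewrite /centered mulVKg.
Qed.
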